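(* Let $u_0\in BV(\mathbb{R})$ be non-negative with $\operatorname{supp}^*(u_0)=[a,b]$, $a<b$, let $u(t,x)$ be the strong solution to the Total Variation Flow on $(0,\infty)\times\mathbb{R}$ with initial datum $u_0$, and set $$T=\frac12\int_a^b u_0(x)\,dx.$$ Then $\operatorname{supp}(u(t))=[a,b]$ for all $t\in(0,T)$, and $$\left\|\frac{u(t,\cdot)}{T-t}-2\,\frac{\chi_{[a,b]}}{b-a}\right\|_{L^1([a,b])}\longrightarrow 0\qquad\text{as }t\to T^-.$$
   Context: $BV(\mathbb{R})$ is the set of $f\in L^1_{loc}(\mathbb{R})$ whose distributional derivative $Df$ is a signed measure of finite total variation. The extended support $\operatorname{supp}^*(f)$ of a function $f$ is the smallest closed interval $[a,b]$ containing the (closed, essential) support $\operatorname{supp}(f)$. Strong solution of the Total Variation Flow (TVF) $\partial_t u=\partial_x(Du/|Du|)$ on $\mathbb{R}$ with initial datum $u_0$: a function $u\in L^\infty([0,\infty),BV(\mathbb{R}))\cap W^{1,2}_{loc}([0,\infty),L^2(\mathbb{R}))$ with $u(0,\cdot)=u_0$ for which there exists a measurable $z$ on $(0,\infty)\times\mathbb{R}$ with $\|z\|_\infty\le 1$, $\partial_x z\in L^2_{loc}([0,\infty),L^2(\mathbb{R}))$ (so that $z(t,\cdot)$ is taken to be continuous for a.e. $t$), such that $\partial_t u=\partial_x z$ on $(0,\infty)\times\mathbb{R}$ and, for all $\tau>0$, $\int_0^\tau\int_{\mathbb{R}} z(t,x)\,Du(t,dx)\,dt=\int_0^\tau |Du(t,\cdot)|(\mathbb{R})\,dt$.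 *)

(* Defs.v *)
From HB Require Import structures.
From mathcomp Require Import all_boot all_order all_algebra.
From mathcomp Require Import all_classical all_reals all_analysis.

Set Implicit Arguments.
Unset Strict Implicit.
Unset Printing Implicit Defensive.

Import Order.TTheory GRing.Theory Num.Theory.
Import numFieldNormedType.Exports.

Local Open Scope classical_set_scope.
Local Open Scope ring_scope.

(** * Test functions *)

(* C^oo: every iterated directional derivative, for any finite list of
   directions, is (Frechet) differentiable everywhere. *)
Definition smooth (R : realType) (V : normedModType R) (f : V -> R) : Prop :=
  forall (vs : seq V) (x : V),
    differentiable (foldr (fun v g => 'D_v g) (f : V -> R^o) vs) x.

(* C_c^oo(D), as functions on the whole space. *)
Definition test_function (R : realType) (V : normedModType R) (D : set V)
    (phi : V -> R) : Prop :=
  let S := closure [set x | phi x != 0] in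
  [/\ smooth phi, compact S & S `<=` D].

(** * Signed measures

   A charge takes finite values, so it is a signed measure of finite total
   variation. A Hahn decomposition is chosen, which is harmless since the Jordan
   parts do not depend on it. *)

Section signed_measures.
Context d (T : measurableType d) (R : realType).
Implicit Type nu : {charge set T -> \bar R}.

Lemma Hahn_decomposition_pair nu :
  exists PN : set T * set T, hahn_decomposition nu PN.1 PN.2.
Proof. by have [P [N PN]] := Hahn_decomposition nu; exists (P, N). Qed.

Definition hahn_proof nu := projT2 (cid (Hahn_decomposition_pair nu)).

Definition charge_integral nu (f : T -> R) : R :=
  \int[jordan_pos (hahn_proof nu)]_x f x -
  \int[jordan_neg (hahn_proof nu)]_x f x.

(* |nu|(A) *)
Definition charge_tv nu (A : set T) : \bar R :=
  charge_variation (hahn_proof nu) A.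

End signed_measures.

(** * BV functions and essential supports on the line *)

Section real_line.
Context (R : realType).
Local Notation mu := (@lebesgue_measure R).
Implicit Type f : R -> R.

(* Df = nu in the sense of distributions *)
Definition deriv_measure f (nu : {charge set (measurableTypeR R) -> \bar R}) :
    Prop :=
  forall phi : R -> R, test_function (V := R^o) setT phi ->
    \int[mu]_x (f x * derive1 (phi : R -> R^o) x) = - charge_integral nu phi.

Definition BV f : Prop :=
  locally_integrable setT f /\ exists nu, deriv_measure f nu.

(* Complement of the largest open set on which f vanishes a.e. *)
Definition ess_supp f : set R :=
  ~` [set x | exists U : set R,
       [/\ open U, U x & {ae mu, forall y, U y -> f y = 0}]].

(* The closed intervals are stable under intersection, so this is the smallest
   one containing [ess_supp f]; it is empty when f = 0 a.e. *)
Definition ext_supp f : set R :=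
  \bigcap_(I in [set I : set R |
                  [/\ closed I, is_interval I & ess_supp f `<=` I]]) I.

End real_line.

(** * Functions of time and space *)

Section space_time.
Context (R : realType).
Local Notation mu := (@lebesgue_measure R).
Local Notation mu2 := (mu \x mu)%E.
Implicit Type f g : R -> R -> R.

Definition strip (I : set R) : set (measurableTypeR R * measurableTypeR R) :=
  I `*` setT.

(* L^2_loc([0,oo), L^2(R)) *)
Definition L2loc_L2 f : Prop :=
  measurable_fun (strip `[0, +oo[) (fun p => f p.1 p.2) /\
  forall tau : R, 0 < tau ->
    finite_norm mu2 2%:E ((fun p => f p.1 p.2) \_ (strip `[0, tau])).

(* g is the distributional derivative of f in the direction v on (0,oo) x R *)
Definition weak_deriv (v : R * R) f g : Prop :=
  let D := strip `]0, +oo[ in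
  forall phi : R * R -> R, test_function (V := (R^o * R^o)%type) D phi ->
    \int[mu2]_(p in D) (f p.1 p.2 * 'D_v (phi : R^o * R^o -> R^o) p) =
    - \int[mu2]_(p in D) (g p.1 p.2 * phi p).

Local Notation "'d_t'" := (weak_deriv (1, 0)).
Local Notation "'d_x'" := (weak_deriv (0, 1)).

(* u is the representative in C([0,oo), L^2(R)) of an element of
   W^{1,2}_loc([0,oo), L^2(R)), with time derivative ut; only for this
   representative is u(t) meaningful for every t. *)
Definition W12loc_L2 u ut : Prop :=
  [/\ L2loc_L2 u, L2loc_L2 ut, d_t u ut,
      forall t : R, 0 <= t -> finite_norm mu 2%:E (u t) &
      forall t : R, 0 <= t ->
        'N[mu]_2%:E[EFin \o (u s \- u t)%R]%E
          @[s --> within `[0, +oo[ (nbhs t)] --> 0%E].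

(* u \in L^oo([0,oo), BV(R)), where Du t is the derivative of u(t). The bound is
   on the seminorm |Du(t)|(R), which controls the sup norm of u(t) as soon as
   u(t) is also in L^2(R). *)
Definition Linfty_BV u (Du : R -> {charge set (measurableTypeR R) -> \bar R}) :
    Prop :=
  {ae mu, forall t : R, 0 < t ->
    locally_integrable setT (u t) /\ deriv_measure (u t) (Du t)} /\
  exists M : R, {ae mu, forall t : R, 0 < t ->
    (charge_tv (Du t) setT <= M%:E)%E}.

Definition TVF_strong_solution (u0 : R -> R) u : Prop :=
  exists (ut z zx : R -> R -> R)
         (Du : R -> {charge set (measurableTypeR R) -> \bar R}),
    [/\ Linfty_BV u Du, W12loc_L2 u ut & {ae mu, forall x, u 0 x = u0 x}] /\
    [/\ measurable_fun (strip `]0, +oo[) (fun p => z p.1 p.2),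
        {ae mu2, forall p, 0 < p.1 -> `|z p.1 p.2| <= 1},
        {ae mu, forall t : R, 0 < t -> continuous (z t)},
        L2loc_L2 zx & d_x z zx] /\
    {ae mu2, forall p, 0 < p.1 -> ut p.1 p.2 = zx p.1 p.2} /\
    forall tau : R, 0 < tau ->
      (\int[mu]_(t in `]0%R, tau[) (charge_integral (Du t) (z t))%:E =
       \int[mu]_(t in `]0%R, tau[) charge_tv (Du t) setT)%E.

End space_time.

(* Main.v *)
Require Import Defs.
From HB Require Import structures.
From mathcomp Require Import all_boot all_order all_algebra.
From mathcomp Require Import all_classical all_reals all_analysis.
From mathcomp Require Import measurable_realfun ring lra.

Set Implicit Arguments.
Unset Strict Implicit.
Unset Printing Implicit Defensive.

Import Order.TTheory GRing.Theory Num.Theory.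
Import numFieldNormedType.Exports.

Local Open Scope classical_set_scope.
Local Open Scope ring_scope.

(** Above any level the flow loses mass at rate 2 per maximum, and this
    determines both the support and the extinction profile.

    At almost every time t, u(t) has a right-continuous representative U. As z(t)
    is a primitive of u_t(t) bounded by 1, - int w u_t is at most the variation
    of w for every competitor w, while the identity between int z dDu and
    |Du|(R) says that - int U u_t is at least the variation of U along any grid
    ([tv_flow_calibrated]). So int (U - w) u_t <= - c as soon as the variation of
    w is less than that of U by c. If g is nondecreasing and 1-Lipschitz, the
    variation of U is the sum of those of g(U) and U - g(U) ([var_split]); hence
    int g(u) u_t is at most minus the variation of g(U), and int F(u) decreases
    accordingly when F is convex with derivative g ([energy_decay]).

    With g(s) = min((s - k)_+, e) and e -> 0, the mass above the level k decreases
    at rate at least 2 as long as it is positive ([level_peak]), and at rate at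
    least 4 while U exceeds k on both sides of a point where it is below k
    ([level_valley]). For k = 0 the bound |z| <= 1 gives the opposite inequality,
    so the total mass is 2 (T - t) ([mass_eq]); by subtraction, the mass below the
    level k, int min(u, k), does not decrease while there is some mass above k
    ([below_mono]).

    For small times u(s) is not small near a nor near b. If it were below a small
    level k somewhere between a + d and b - d at almost every small time, the mass
    above k would decrease at rate 4 and the total mass at rate 2 only, although
    they differ by k (b - a) at most. So u(s) >= k on [a + d, b - d] at some time
    s ([fill]), and from then on int min(u, l) >= l (b - a - 2 d) for l <= k, as
    long as the level l is not extinct ([below_fill]). This leaves no room for a
    gap in the support ([flow_support]). Close to T it shows that u(t) is at most
    m / (b - a - 2 d), where m is the mass: hardly more than the average
    m / (b - a), which is the convergence in L^1 ([flow_flat]).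

    Before that, the distributional hypotheses are turned into statements about
    sections: z(t) is the primitive of u_t(t) ([weak_primitive]), u(t) is the
    distribution function of Du(t) ([bv_rep0]), and the increments of u in time
    are integrals of u_t ([W12_increment]). The test functions are products of
    smooth cutoffs which tend to indicators of rectangles. *)

(** * Real-valued integrals and square-integrable functions *)

Local Notation intg m f := (m.-integrable setT (EFin \o f)).

Section integration.
Context d (T : measurableType d) (R : realType).
Variable m : {measure set T -> \bar R}.
Implicit Types f g h : T -> R.

Lemma intg_meas f : intg m f -> measurable_fun setT f.
Proof. by move=> /integrableP[/measurable_EFinP]. Qed.

Lemma intg_dom g f : measurable_fun setT f -> intg m g ->
  (forall x, `|f x| <= g x) -> intg m f.
Proof.
move=> mf ig fg; apply: (le_integrable measurableT _ _ ig).
  exact/measurable_EFinP.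
by move=> x _ /=; rewrite lee_fin (le_trans (fg x))// ler_norm.
Qed.

Lemma intgD f g : intg m f -> intg m g -> intg m (fun x => f x + g x).
Proof. by move=> fi gi; exact: (integrableD measurableT fi gi). Qed.

Lemma intgB f g : intg m f -> intg m g -> intg m (fun x => f x - g x).
Proof. by move=> fi gi; exact: (integrableB measurableT fi gi). Qed.

Lemma intgZ c f : intg m f -> intg m (fun x => c * f x).
Proof.
move=> fi; have := integrableZl measurableT c fi.
by apply: eq_integrable => // x _ /=; rewrite EFinM.
Qed.

Lemma intg0 : intg m (cst 0 : T -> R).
Proof. exact: integrable0. Qed.

Lemma intg_norm f : intg m f -> intg m (fun x => `|f x|).
Proof. by move=> fi; exact: (integrable_norm fi). Qed.

Lemma intg_sum I (s : seq I) (F : I -> T -> R) :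
  (forall i, intg m (F i)) -> intg m (fun x => \sum_(i <- s) F i x).
Proof.
move=> Fi; elim: s => [|i s ih].
  by under eq_fun do rewrite big_nil; exact: intg0.
by under eq_fun do rewrite big_cons; exact: intgD.
Qed.

Lemma Rint_sum I (s : seq I) (F : I -> T -> R) : (forall i, intg m (F i)) ->
  \int[m]_x (\sum_(i <- s) F i x) = \sum_(i <- s) \int[m]_x F i x.
Proof.
move=> Fi; elim: s => [|i s ih].
  by under eq_Rintegral do rewrite big_nil; rewrite big_nil Rintegral_cst// mul0r.
under eq_Rintegral do rewrite big_cons; rewrite big_cons -ih.
by rewrite RintegralD//; exact: intg_sum.
Qed.

Lemma intg_ae f g : measurable_fun setT g -> {ae m, forall x, f x = g x} ->
  intg m f -> intg m g.
Proof.
move=> mg fg /[dup] fi /integrableP[mf foo]; apply/integrableP; split.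
  exact/measurable_EFinP.
rewrite -(@ae_eq_integral _ _ _ m setT
  (fun x => `|(EFin \o g) x|)%E (fun x => `|(EFin \o f) x|)%E)//.
- exact: measurableT_comp.
- by apply: measurableT_comp => //; exact/measurable_EFinP.
- by apply: filterS fg => x /= -> .
Qed.

Lemma Rint_ae f g : measurable_fun setT f -> measurable_fun setT g ->
  {ae m, forall x, f x = g x} -> \int[m]_x f x = \int[m]_x g x.
Proof.
move=> mf mg fg; congr fine; apply: ae_eq_integral => //.
- exact/measurable_EFinP.
- exact/measurable_EFinP.
- by apply: filterS fg => x /= -> .
Qed.

Lemma Rint_ge0_ae f : measurable_fun setT f -> {ae m, forall x, 0 <= f x} ->
  0 <= \int[m]_x f x.
Proof.
move=> mf f0.
rewrite (@Rint_ae f (fun x => `|f x|))//; last first.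
- by apply: filterS f0 => x /ger0_norm.
- exact: measurableT_comp.
by apply: Rintegral_ge0.
Qed.

Lemma le_Rint_ae f g : intg m f -> intg m g -> {ae m, forall x, f x <= g x} ->
  \int[m]_x f x <= \int[m]_x g x.
Proof.
move=> fi gi fg; rewrite -subr_ge0 -RintegralB//.
apply: Rint_ge0_ae; first by apply: measurable_funB; exact: intg_meas.
by apply: filterS fg => x; rewrite subr_ge0.
Qed.

Lemma le_Rint f g : intg m f -> intg m g -> (forall x, f x <= g x) ->
  \int[m]_x f x <= \int[m]_x g x.
Proof. by move=> fi gi fg; apply: le_Rint_ae => //; exact: nearW. Qed.

Lemma Rint_eq0_ae f : intg m f -> {ae m, forall x, 0 <= f x} ->
  \int[m]_x f x <= 0 -> {ae m, forall x, f x = 0}.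
Proof.
move=> fi f0 If.
have If0 : \int[m]_x `|f x| = 0.
  rewrite (@Rint_ae _ f); last first.
  - by apply: filterS f0 => x /ger0_norm.
  - exact: intg_meas.
  - by apply: measurableT_comp => //; exact: intg_meas.
  apply/le_anti; rewrite If /=; apply: Rint_ge0_ae => //; exact: intg_meas.
have /measurable_EFinP mf := intg_meas fi.
have := ae_eq_integral_abs m measurableT mf.
move=> [H _].
have {}H : ae_eq m setT (EFin \o f) (cst 0%E).
  apply: H; have := integrable_fin_num measurableT (intg_norm fi).
  move=> /fineK <-; congr EFin; exact: If0.
by apply: filterS H => x /= /(_ I) [].
Qed.

Lemma dctR_ae (f_ : nat -> T -> R) f g :
  (forall n, measurable_fun setT (f_ n)) -> measurable_fun setT f ->
  {ae m, forall x, f_ ^~ x @ \oo --> f x} ->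
  intg m g -> {ae m, forall x, forall n, `|f_ n x| <= g x} ->
  \int[m]_x f_ n x @[n --> \oo] --> \int[m]_x f x.
Proof.
move=> mf_ mf cf ig fg.
have [] := @dominated_convergence _ _ _ m setT measurableT
  (fun n => EFin \o f_ n) (EFin \o f) (EFin \o g).
- by move=> n; exact/measurable_EFinP.
- exact/measurable_EFinP.
- apply: filterS cf => x cf _.
  by apply/fine_cvgP; split; [exact: nearW|exact: cf].
- exact: ig.
- by apply: filterS fg => x fgx n _ /=; rewrite lee_fin.
move=> ifi _ cv.
apply: fine_cvg; rewrite fineK; first exact: cv.
exact: integrable_fin_num.
Qed.

Lemma dctR (f_ : nat -> T -> R) f g :
  (forall n, measurable_fun setT (f_ n)) -> measurable_fun setT f ->
  {ae m, forall x, f_ ^~ x @ \oo --> f x} ->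
  intg m g -> (forall n x, `|f_ n x| <= g x) ->
  \int[m]_x f_ n x @[n --> \oo] --> \int[m]_x f x.
Proof. by move=> mf_ mf cf ig fg; apply: dctR_ae ig _ => //; exact: aeW. Qed.

Lemma Rint0 : \int[m]_x (0 : R) = 0.
Proof. by rewrite /Rintegral integral0_eq. Qed.

Lemma normr2 (x : R) : `|x| ^+ 2 = x ^+ 2.
Proof. by rewrite real_normK// num_real. Qed.

Lemma ae_imp (P Q : T -> Prop) : (forall x, P x -> Q x) ->
  {ae m, forall x, P x} -> {ae m, forall x, Q x}.
Proof. by move=> PQ; exact: filterS. Qed.

Lemma ae_and (P Q : T -> Prop) : {ae m, forall x, P x} ->
  {ae m, forall x, Q x} -> {ae m, forall x, P x /\ Q x}.
Proof. by move=> aP aQ; apply: filterS2 aP aQ. Qed.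

Lemma ae_all (P : nat -> T -> Prop) : (forall n, {ae m, forall x, P n x}) ->
  {ae m, forall x, forall n, P n x}.
Proof. by move=> aP; apply/ae_foralln. Qed.

Definition L2 f := measurable_fun setT f /\ intg m (fun x => f x ^+ 2).

Lemma L2_mul f g : L2 f -> L2 g -> intg m (fun x => f x * g x).
Proof.
move=> [mf f2] [mg g2].
apply: (@intg_dom (fun x => f x ^+ 2 + g x ^+ 2)).
- exact: measurable_funM.
- exact: intgD.
- move=> x; rewrite normrM -(normr2 (f x)) -(normr2 (g x)).
  by have := sqr_ge0 (`|f x| - `|g x|); have := normr_ge0 (f x); have := normr_ge0 (g x); nra.
Qed.

Lemma L2D f g : L2 f -> L2 g -> L2 (fun x => f x + g x).
Proof.
move=> f2 g2; have fg := L2_mul f2 g2; move: f2 g2 => [mf f2] [mg g2].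
split; first exact: measurable_funD.
have := intgD (intgD f2 g2) (intgZ 2 fg).
by apply: eq_integrable => // x _ /=; congr EFin; ring.
Qed.

Lemma L2Z c f : L2 f -> L2 (fun x => c * f x).
Proof.
move=> [mf f2]; split; first exact: measurable_funM.
have := intgZ (c ^+ 2) f2.
by apply: eq_integrable => // x _ /=; congr EFin; ring.
Qed.

Lemma L2B f g : L2 f -> L2 g -> L2 (fun x => f x - g x).
Proof.
move=> f2 /(L2Z (-1)) g2; have := L2D f2 g2.
by under eq_fun do rewrite mulN1r.
Qed.

Lemma L2_dom g f : measurable_fun setT f -> L2 g ->
  (forall x, `|f x| <= `|g x|) -> L2 f.
Proof.
move=> mf [mg g2] fg; split => //; apply: intg_dom g2 _.
  exact: measurable_funX.
by move=> x; rewrite normrX -(normr2 (g x)) lerXn2r ?nnegrE.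
Qed.

Lemma L2_ae f g : measurable_fun setT g -> {ae m, forall x, f x = g x} ->
  L2 f -> L2 g.
Proof.
move=> mg fg [mf f2]; split => //; apply: intg_ae f2.
  exact: measurable_funX.
by apply: filterS fg => x ->.
Qed.

Lemma L2_indic A : measurable A -> (m A < +oo)%E -> L2 (\1_A).
Proof.
move=> mA Aoo; split; first exact: measurable_indic.
have : intg m (\1_A : T -> R).
  apply/integrableP; split; first exact/measurable_EFinP/measurable_indic.
  under eq_integral do rewrite /= ger0_norm//.
  by rewrite integral_indic// setIT.
apply: eq_integrable => // x _ /=.
by rewrite indicE; case: (_ \in _); rewrite ?expr1n ?expr0n.
Qed.

Lemma young_Rint c f g : 0 < c -> L2 f -> L2 g ->
  `|\int[m]_x (f x * g x)| <=
  c * \int[m]_x (f x ^+ 2) + c^-1 * \int[m]_x (g x ^+ 2).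
Proof.
move=> c0 f2 g2; have fg := L2_mul f2 g2.
apply: (le_trans (le_normr_Rintegral measurableT fg)).
rewrite -!RintegralZl//; [|exact: g2.2|exact: f2.2].
rewrite -RintegralD//; [|exact: (intgZ _ f2.2)|exact: (intgZ _ g2.2)].
apply: le_Rint; first exact: intg_norm.
  by apply: intgD; apply: intgZ; [exact: f2.2|exact: g2.2].
move=> x /=; rewrite normrM -(normr2 (f x)) -(normr2 (g x)).
set a := `|f x|; set b := `|g x|.
have a0 : 0 <= a by exact: normr_ge0.
have b0 : 0 <= b by exact: normr_ge0.
have -> : c * a ^+ 2 + c^-1 * b ^+ 2 = c^-1 * ((c * a) ^+ 2 + b ^+ 2).
  by field; rewrite gt_eqF.
rewrite mulrC ler_pdivlMl//.
by have := sqr_ge0 (c * a - b); have := sqr_ge0 (c * a + b); nra.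
Qed.

Lemma cvg_L2_mul (I : Type) (F : set_system I) (FF : Filter F) (f_ : I -> T -> R) g :
  (\forall s \near F, L2 (f_ s)) -> L2 g ->
  \int[m]_x (f_ s x ^+ 2) @[s --> F] --> 0 ->
  \int[m]_x (f_ s x * g x) @[s --> F] --> 0.
Proof.
move=> f2 g2 f0; apply/cvgr0Pnorm_lt => e e0.
pose B := \int[m]_x (g x ^+ 2).
have B0 : 0 <= B by apply: Rintegral_ge0 => x _; exact: sqr_ge0.
pose c := 2 * (B + 1) / e.
have c0 : 0 < c by rewrite divr_gt0// mulr_gt0// ltr_wpDl.
have ec : 0 < e / 2 / c by apply: divr_gt0 => //; apply: divr_gt0.
move/cvgr0Pnorm_lt : f0 => /(_ _ ec) f0; apply: filterS (filterI f2 f0) => n [f2n fn].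
apply: le_lt_trans (young_Rint c0 f2n g2) _.
have h1 : c * \int[m]_x (f_ n x ^+ 2) < e / 2.
  rewrite -ltr_pdivlMl// mulrC; apply: le_lt_trans fn; exact: ler_norm.
have h2 : c^-1 * B <= e / 2.
  rewrite ler_pdivrMl//.
  have -> : c * (e / 2) = B + 1 by rewrite /c; field; rewrite gt_eqF.
  by rewrite lerDl.
rewrite -/B; lra.
Qed.

Lemma finite_norm_L2 f : measurable_fun setT f -> finite_norm m 2%:E f -> L2 f.
Proof.
move=> mf ff; split => //; apply: Lfun2_integrable_sqr.
by rewrite !inE; apply/andP; split; [rewrite inE|rewrite inE].
Qed.

Lemma Lnorm2E f : L2 f ->
  ('N[m]_2%:E[EFin \o f] `^ 2)%E = (\int[m]_x (f x ^+ 2))%:E.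
Proof.
move=> [mf f2].
rewrite powR_Lnorm// /Rintegral fineK; last exact: integrable_fin_num.
by apply: eq_integral => x _ /=; rewrite powR_mulrn// normr2.
Qed.

Lemma Lnorm2_cvg0 (I : Type) (F : set_system I) (FF : Filter F)
    (f_ : I -> T -> R) : (\forall s \near F, L2 (f_ s)) ->
  'N[m]_2%:E[EFin \o f_ s]%E @[s --> F] --> 0%E ->
  \int[m]_x (f_ s x ^+ 2) @[s --> F] --> 0.
Proof.
move=> f2 N0; apply/cvgr0Pnorm_lt => e e0.
have se : 0 < Num.sqrt e by rewrite sqrtr_gt0.
move/fine_cvgP : N0 => [Nfin /cvgr0Pnorm_lt /(_ _ se) Nlt].
near=> s.
have f2s : L2 (f_ s) by near: s.
have Ns : 'N[m]_2%:E[EFin \o f_ s]%E \is a fin_num by near: s.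
have Nl : `|fine 'N[m]_2%:E[EFin \o f_ s]%E| < Num.sqrt e by near: s.
have := Lnorm2E f2s; rewrite -(fineK Ns) poweR_EFin => -[] H.
rewrite -H powR_mulrn ?fine_ge0 ?Lnorm_ge0//.
rewrite normrX -(sqr_sqrtr (ltW e0)).
by rewrite ltrXn2r// ?nnegrE.
Unshelve. all: by end_near. Qed.

End integration.

(** * Integrals over a product *)

Section fubini.
Context d1 d2 (T1 : measurableType d1) (T2 : measurableType d2) (R : realType).
Variables (m1 : {sigma_finite_measure set T1 -> \bar R})
          (m2 : {sigma_finite_measure set T2 -> \bar R}).
Local Notation m12 := (m1 \x m2)%E.
Implicit Type F : T1 * T2 -> R.

Lemma measurable_section F t : measurable_fun setT F ->
  measurable_fun setT (fun x => F (t, x)).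
Proof. by move=> mF; exact: measurableT_comp. Qed.

Lemma ae_section (P : T1 * T2 -> Prop) : {ae m12, forall p, P p} ->
  {ae m1, forall t, {ae m2, forall x, P (t, x)}}.
Proof.
move=> [A [mA A0 PA]].
have : (\int[m1]_t `|(m2 \o xsection A) t| = 0)%E.
  by rewrite -[RHS]A0 /product_measure1; apply: eq_integral => t _; rewrite gee0_abs.
have mxA : measurable_fun setT (m2 \o xsection A) by exact: measurable_fun_xsection.
move=> /(ae_eq_integral_abs m1 measurableT mxA).
apply: filterS => t /= /(_ I) At0.
exists (xsection A t); split => //; first exact: measurable_xsection.
by move=> x /= nP; rewrite /xsection/= inE; exact: PA.
Qed.

Lemma fubini_intg_section F : intg m12 F ->
  {ae m1, forall t, intg m2 (fun x => F (t, x))}.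
Proof. by move=> /ae_integrable1. Qed.

(** Measurability of partial integrals holds without integrability: the positive
    and negative parts of F are handled by Tonelli. *)
Lemma meas_Rint F : measurable_fun setT F ->
  measurable_fun setT (fun t => \int[m2]_x F (t, x)).
Proof.
move=> mF; have mFe : measurable_fun setT (EFin \o F) by exact/measurable_EFinP.
have : measurable_fun setT (fun t => \int[m2]_x (F (t, x))%:E)%E.
  have -> : (fun t => \int[m2]_x (F (t, x))%:E)%E =
      ((fun t => \int[m2]_x ((EFin \o F)^\+ (t, x))) \-
       (fun t => \int[m2]_x ((EFin \o F)^\- (t, x))))%E.
    apply/funext => t; rewrite [LHS]integralE /=; congr (_ - _)%E;
    by apply: eq_integral => x _; rewrite ?funeposE ?funenegE.
  apply: emeasurable_funB; apply: measurable_fun_fubini_tonelli_F => //.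
    exact: measurable_funepos.
  exact: measurable_funeneg.
by move=> /(measurableT_comp (fine_measurable measurableT)); apply.
Qed.

Lemma fubini_meas F : intg m12 F ->
  measurable_fun setT (fun t => \int[m2]_x F (t, x)).
Proof. by move=> /intg_meas/meas_Rint. Qed.

Lemma fubini_intg F : intg m12 F ->
  intg m1 (fun t => \int[m2]_x F (t, x)).
Proof.
move=> iF; apply: (le_integrable measurableT _ _ (integrable_fubini_F iF)).
  by apply/measurable_EFinP; exact: fubini_meas.
move=> t _ /=; rewrite /Rintegral /fubini_F /=.
by case: (\int[m2]_y _)%E => //= *; rewrite ?normr0 ?leey.
Qed.

Lemma fubiniE F : intg m12 F ->
  \int[m12]_p F p = \int[m1]_t \int[m2]_x F (t, x).
Proof.
move=> iF; rewrite /Rintegral -integral12_prod_meas1//; congr fine.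
apply: ae_eq_integral => //.
- exact: (measurable_fubini_F iF).
- by apply/measurable_EFinP; exact: fubini_meas.
apply: filterS (fubini_intg_section iF) => t it _ /=.
by rewrite fineK//; exact: (integrable_fin_num measurableT it).
Qed.

Lemma fubini_swap F : intg m12 F ->
  \int[m1]_t \int[m2]_x F (t, x) = \int[m2]_x \int[m1]_t F (t, x).
Proof.
move=> iF; rewrite -fubiniE// /Rintegral -integral21_prod_meas1//; congr fine.
apply: ae_eq_integral => //.
- exact: (measurable_fubini_G iF).
- apply/measurable_EFinP; have := measurable_fubini_G iF.
  by move=> /(measurableT_comp (fine_measurable measurableT)); apply.
apply: filterS (ae_integrable2 iF) => x ix _ /=.
by rewrite fineK//; exact: (integrable_fin_num measurableT ix).
Qed.

Lemma fubini_intg2 F : intg m12 F ->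
  intg m2 (fun x => \int[m1]_t F (t, x)).
Proof.
move=> iF; have mF := intg_meas iF.
have mG : measurable_fun setT (fun x => \int[m1]_t F (t, x)).
  have := measurable_fubini_G iF.
  by move=> /(measurableT_comp (fine_measurable measurableT)); apply.
apply/integrableP; split; first exact/measurable_EFinP.
have mFe : measurable_fun setT (EFin \o F) by exact/measurable_EFinP.
apply: le_lt_trans ((integrable21ltyP m1 m2 mFe).1 iF).
apply: ge0_le_integral => //.
- by apply: measurableT_comp => //; exact/measurable_EFinP.
- apply: (@measurable_fun_fubini_tonelli_G _ _ _ _ _ m1 (fun p => `|(EFin \o F) p|%E)) => //.
  exact: measurableT_comp.
- move=> x _ /=; rewrite /Rintegral.
  apply: (@le_trans _ _ `|\int[m1]_t (F (t, x))%:E|%E).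
    by case: (\int[m1]_y _)%E => //= *; rewrite ?normr0 ?leey.
  apply: le_abse_integral => //; apply/measurable_EFinP.
  exact: measurableT_comp.
Qed.

Lemma intg_tensor (f : T1 -> R) (g : T2 -> R) :
  intg m1 f -> intg m2 g ->
  intg m12 (fun p => f p.1 * g p.2).
Proof.
move=> fi gi; have mf := intg_meas fi; have mg := intg_meas gi.
have mfg : measurable_fun setT (fun p : T1 * T2 => f p.1 * g p.2).
  by apply: measurable_funM; exact: measurableT_comp.
apply/integrable12ltyP; first exact/measurable_EFinP.
under eq_integral => x _.
  under eq_integral do rewrite /= normrM EFinM.
  rewrite ge0_integralZl//; last by apply/measurable_EFinP; exact: measurableT_comp.
  over.
rewrite /= ge0_integralZr//; last 2 first.
- by apply/measurable_EFinP; exact: measurableT_comp.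
- exact: integral_ge0.
move/integrableP : fi => [_ foo]; move/integrableP : gi => [_ goo].
apply: lte_mul_pinfty => //; first exact: integral_ge0.
by rewrite ge0_fin_numE//; exact: integral_ge0.
Qed.

Lemma L2_section F : L2 m12 F -> {ae m1, forall t, L2 m2 (fun x => F (t, x))}.
Proof.
move=> [mF /fubini_intg_section F2]; apply: filterS F2 => t; split => //.
exact: measurable_section.
Qed.

Lemma L2_tensor (f : T1 -> R) (g : T2 -> R) : L2 m1 f -> L2 m2 g ->
  L2 m12 (fun p => f p.1 * g p.2).
Proof.
move=> [mf f2] [mg g2]; split.
  by apply: measurable_funM; exact: measurableT_comp.
have := intg_tensor f2 g2.
by apply: eq_integrable => // p _ /=; rewrite exprMn.
Qed.

End fubini.

(** * Lebesgue measure on the line *)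

Section lebesgue.
Context (R : realType).
Local Notation mu := (@lebesgue_measure R).
Implicit Types f g h : R -> R.

Lemma L2_itv (i : interval R) (a b : R) : [set` i] `<=` `[a, b] ->
  L2 mu (\1_[set` i]).
Proof.
move=> ab; apply: L2_indic => //.
apply: (@le_lt_trans _ _ (mu `[a, b])); first by apply: le_measure; rewrite ?inE.
by rewrite lebesgue_measure_itv /=; case: ifP => _ //; rewrite -EFinB ltry.
Qed.

Lemma intg_itv (i : interval R) (a b : R) : [set` i] `<=` `[a, b] ->
  intg mu (\1_[set` i] : R -> R).
Proof.
move=> iab; have [_] := L2_itv iab.
apply: eq_integrable => // x _ /=.
by rewrite indicE; case: (_ \in _); rewrite ?expr1n ?expr0n.
Qed.

Lemma itv_sub_cc (x y : bool) (p q : R) :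
  [set` Interval (BSide x p) (BSide y q)] `<=` `[p, q].
Proof. by apply: subset_itv; rewrite bnd_simp; case: x; case: y. Qed.

Lemma L2_bnd (x y : bool) (p q : R) :
  L2 mu (\1_([set` Interval (BSide x p) (BSide y q)])).
Proof. exact/L2_itv/itv_sub_cc. Qed.

Lemma intg_bnd (x y : bool) (p q : R) :
  intg mu (\1_([set` Interval (BSide x p) (BSide y q)]) : R -> R).
Proof. exact/intg_itv/itv_sub_cc. Qed.

Lemma Rint_itv (x y : bool) (p q : R) : p <= q ->
  \int[mu]_z (\1_([set` Interval (BSide x p) (BSide y q)]) z) = q - p.
Proof.
move=> pq; rewrite /Rintegral integral_indic// setIT.
have -> : q - p = fine (q - p)%:E by [].
congr fine; transitivity (lebesgue_measure [set` Interval (BSide x p) (BSide y q)]) => //.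
rewrite lebesgue_measure_itv/= lte_fin; case: ltP => //= qp.
by rewrite (_ : q = p) ?subrr//; apply/le_anti; rewrite pq qp.
Qed.

Lemma indic_sub (A B : set R) x : A `<=` B -> \1_A x <= \1_B x :> R.
Proof.
move=> AB; rewrite !indicE; case: (boolP (x \in A)) => // xA.
by rewrite mem_set //; apply: AB; exact: set_mem.
Qed.

Lemma locint_intg f (i : interval R) (a b : R) : locally_integrable setT f ->
  [set` i] `<=` `[a, b] ->
  intg mu (fun x => \1_[set` i] x * f x).
Proof.
move=> [mf _ fK] ab.
have /integrable_mkcond : mu.-integrable `[a, b] (EFin \o f).
  apply/integrableP; split; first exact/measurable_EFinP/measurable_funTS.
  by apply: fK => //; exact: segment_compact.
move=> /(_ (measurable_itv _)) iab.
apply: (le_integrable measurableT _ _ iab).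
  by apply/measurable_EFinP; apply: measurable_funM => //; exact: measurable_indic.
move=> x _ /=; rewrite /patch indicE; case: ifPn => xab /=.
  by rewrite normrM lee_fin ler_piMl//; case: (_ \in _); rewrite ?normr1 ?normr0.
suff -> : (x \in [set` i]) = false by rewrite mul0r normr0.
apply/negbTE; apply: contra xab; rewrite !inE; exact: ab.
Qed.

Lemma ae_neq (a : R) : {ae mu, forall x : R, x != a}.
Proof.
exists [set a]; split => //; first exact: lebesgue_measure_set1.
by move=> x /= /negP; rewrite negbK => /eqP.
Qed.

Lemma L2_locint f : L2 mu f -> locally_integrable setT f.
Proof.
move=> [mf f2]; split => // [|K _ cK]; first exact: openT.
have mK : measurable K by exact: compact_measurable.
have Koo : (mu K < +oo)%E by exact: compact_finite_measure.
have := L2_mul (@L2_indic _ _ _ mu K mK Koo) (conj mf f2).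
move=> /integrableP[_]; apply: le_lt_trans.
rewrite [leLHS]integral_mkcond; apply: ge0_le_integral => //.
- by move=> x _; apply: erestrict_ge0.
- apply/(measurable_restrictT _ mK); apply/measurable_EFinP.
  by apply: measurableT_comp => //; exact: measurable_funTS.
- apply: measurableT_comp => //; apply/measurable_EFinP.
  by apply: measurable_funM => //; exact: measurable_indic.
- move=> x _ /=; rewrite /patch indicE.
  by case: ifPn => xK; rewrite ?mul1r ?mul0r ?normr0.
Qed.

End lebesgue.

(** * Lebesgue points *)

Section lebesgue_points.
Context (R : realType).
Local Notation mu := (@lebesgue_measure R).
Implicit Types f g h : R -> R.

Lemma cvg_harmonic2 : (2 * n.+1%:R^-1 : R) @[n --> \oo] --> 0^'+.
Proof.
have c0 : (2 * n.+1%:R^-1 : R) @[n --> \oo] --> (0 : R).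
  by rewrite -[X in _ --> X](mulr0 2); apply: cvgMr; exact: cvg_harmonic.
move=> P H; have /= := c0 _ H; rewrite !near_simpl; apply: filterS => n; apply.
by rewrite mulr_gt0// invr_gt0.
Qed.

(** An approximate identity supported on one side of p is dominated by the
    average over a ball centred at p, at the price of a constant. *)
Lemma lebesgue_pt_kernel f p (C : R) (rho : nat -> R -> R) :
  locally_integrable setT f -> lebesgue_pt f p ->
  (forall n, measurable_fun setT (rho n)) ->
  (forall n x, `|rho n x| <= C * n.+1%:R * \1_(`[p, p + n.+1%:R^-1]%classic) x) ->
  (forall n, \int[mu]_x rho n x = 1) ->
  \int[mu]_x (f x * rho n x) @[n --> \oo] --> f p.
Proof.
move=> lf fp mrho rhoC rho1; have [mf _ _] := lf.
pose B n : set R := ball p (2 * n.+1%:R^-1).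
have n0 n : 0 < n.+1%:R^-1 :> R by rewrite invr_gt0.
have BE n : B n = `]p - 2 * n.+1%:R^-1, p + 2 * n.+1%:R^-1[%classic.
  by rewrite /B ball_itv.
have Bsub n : `]p - 2 * n.+1%:R^-1, p + 2 * n.+1%:R^-1[ `<=`
    `[p - 2 * n.+1%:R^-1, p + 2 * n.+1%:R^-1]%classic.
  by apply: subset_itvW.
have C0 : 0 <= C.
  have := rhoC 0%N p; rewrite indicE mem_set.
    by rewrite !mulr1; exact: le_trans.
  by rewrite /= in_itv /= lexx /= lerDl ltW.
have Isub n : `[p, p + n.+1%:R^-1] `<=` B n.
  rewrite BE => x /=; rewrite !in_itv /=.
  move: (n.+1%:R^-1) (n0 n) => r r0 /andP[? ?]; apply/andP; split; lra.
have ifB n : intg mu (fun x => \1_(B n) x * (f x - f p)).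
  have : intg mu (fun x => \1_(B n) x * f x).
    rewrite BE; exact: locint_intg (Bsub n).
  move=> H1.
  have H2 : intg mu (fun x => f p * \1_(B n) x).
    by apply: intgZ; rewrite BE; exact: intg_itv (Bsub n).
  by have := intgB H1 H2; apply: eq_integrable => // x _ /=; congr EFin; ring.
have irho n : intg mu (rho n).
  apply: (@intg_dom _ _ _ mu _ _ (mrho n) _ (rhoC n)).
  by apply: intgZ; exact: (intg_itv (@subset_refl _ _)).
have rhoB n x : `|rho n x| <= C * n.+1%:R * \1_(B n) x.
  apply: (le_trans (rhoC n x)); apply: ler_wpM2l; first by rewrite mulr_ge0.
  rewrite !indicE; case: (boolP (x \in `[p, _]%classic)) => // xI.
  by rewrite mem_set //; apply: Isub; exact: set_mem.
have ifr n : intg mu (fun x => (f x - f p) * rho n x).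
  apply: (@intg_dom _ _ _ mu (fun x => C * n.+1%:R * `|\1_(B n) x * (f x - f p)|)).
  - by apply: measurable_funM; [apply: measurable_funB|exact: mrho].
  - by apply: intgZ; exact: intg_norm.
  - move=> x; rewrite !normrM mulrC mulrA ler_wpM2r//.
    by rewrite (ger0_norm (_ : 0 <= \1_(B n) x)).
have E n : `|\int[mu]_x (f x * rho n x) - f p| <=
    C * n.+1%:R * \int[mu]_x `|\1_(B n) x * (f x - f p)|.
  have -> : \int[mu]_x (f x * rho n x) - f p = \int[mu]_x ((f x - f p) * rho n x).
    rewrite -[X in _ - X]mulr1 -(rho1 n) -RintegralZl//.
    have H : intg mu (fun x => f x * rho n x).
      have := intgD (ifr n) (intgZ (f p) (irho n)).
      by apply: eq_integrable => // x _ /=; congr EFin; ring.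
    rewrite -RintegralB//; last exact: intgZ.
    by apply: eq_Rintegral => x _; ring.
  apply: (le_trans (le_normr_Rintegral measurableT (ifr n))).
  rewrite -RintegralZl//; last exact: intg_norm.
  apply: le_Rint; [exact: intg_norm|by apply: intgZ; exact: intg_norm|].
  move=> x; rewrite !normrM mulrC mulrA ler_wpM2r//.
  by rewrite (ger0_norm (_ : 0 <= \1_(B n) x)).
have D n : (`|\int[mu]_x (f x * rho n x) - f p|%:E <=
    (4 * C)%:E * davg f p (2 * n.+1%:R^-1))%E.
  have -> : davg f p (2 * n.+1%:R^-1) =
      (n.+1%:R / 4 * \int[mu]_x `|\1_(B n) x * (f x - f p)|)%:E.
    rewrite /davg /iavg -/(B n) EFinM; congr (_ * _)%E.
      rewrite BE lebesgue_measure_itv/= lte_fin ifT; last first.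
        by move: (n.+1%:R^-1) (n0 n) => r r0; lra.
      rewrite -EFinB inver ifF; last first.
        by move: (n.+1%:R^-1) (n0 n) => r r0; apply/eqP; lra.
      congr EFin; field.
      have -> : p * (1 + n%:R) + 2 - (p * (1 + n%:R) - 2) = 4 by ring.
      by rewrite addrC natr1 !pnatr_eq0.
    rewrite /Rintegral fineK; last first.
      exact: (integrable_fin_num measurableT (intg_norm (ifB n))).
    rewrite [LHS]integral_mkcond; apply: eq_integral => x _ /=.
    rewrite /patch indicE; case: ifPn => // xB.
      by rewrite mul1r.
    by rewrite mul0r normr0.
  rewrite -EFinM lee_fin; apply: (le_trans (E n)).
  by rewrite le_eqVlt; apply/orP; left; apply/eqP; field.
have davg0 : davg f p (2 * n.+1%:R^-1) @[n --> \oo] --> 0%E.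
  exact: (cvg_comp _ _ cvg_harmonic2 fp).
apply/cvgrPdist_lt => e e0.
have ec : 0 < e / (4 * C + 1) by rewrite divr_gt0// ltr_wpDl// mulr_ge0.
move/fine_cvgP : davg0 => [dfin /cvgr0Pnorm_lt /(_ _ ec) dlt].
near=> n.
have dn : davg f p (2 * n.+1%:R^-1) \is a fin_num by near: n.
have dl : `|fine (davg f p (2 * n.+1%:R^-1))| < e / (4 * C + 1) by near: n.
rewrite distrC; have := D n; rewrite -(fineK dn) -EFinM lee_fin.
move=> /le_lt_trans; apply.
apply: (@le_lt_trans _ _ (4 * C * (e / (4 * C + 1)))).
  apply: ler_wpM2l; first by rewrite mulr_ge0.
  by apply: le_trans (ltW dl); exact: ler_norm.
rewrite mulrA ltr_pdivrMr ?ltr_wpDl ?mulr_ge0// mulrC ltr_pM2l// ltrDl.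
exact: ltr01.
Unshelve. all: by end_near. Qed.

(** At a Lebesgue point, f is the limit of its averages to the right. *)
Lemma ae0_itv f : locally_integrable setT f ->
  (forall p q, p < q -> \int[mu]_x (\1_(`]p, q]%classic) x * f x) = 0) ->
  {ae mu, forall x, f x = 0}.
Proof.
move=> lf f0; apply: ae_imp (lebesgue_differentiation lf) => p fp.
pose rho (n : nat) x : R := n.+1%:R * \1_(`]p, p + n.+1%:R^-1]%classic) x.
have n0 n : 0 < n.+1%:R^-1 :> R by rewrite invr_gt0.
have sub n : `]p, p + n.+1%:R^-1] `<=` `[p, p + n.+1%:R^-1]%classic.
  by apply/subset_itvP; exact: subset_itv_oc_cc.
have H : \int[mu]_x (f x * rho n x) @[n --> \oo] --> f p.
  apply: (@lebesgue_pt_kernel f p 1) => //.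
  - by move=> n; apply: measurable_funM => //; exact: measurable_indic.
  - move=> n x; rewrite /rho mul1r normrM ger0_norm// ler_wpM2l//.
    rewrite ger0_norm// !indicE; case: (boolP (x \in `]p, _]%classic)) => // xI.
    by rewrite mem_set //; apply: sub; exact: set_mem.
  - move=> n; rewrite RintegralZl//; last exact: intg_itv (sub n).
    by rewrite Rint_itv ?lerDl// addrAC subrr add0r divff.
have : \int[mu]_x (f x * rho n x) @[n --> \oo] --> (0 : R).
  apply: cvg_near_cst; apply: nearW => n.
  rewrite -[RHS](mulr0 n.+1%:R) -(f0 p (p + n.+1%:R^-1)) ?ltrDl//.
  rewrite -RintegralZl//; last exact: locint_intg (sub n).
  by apply: eq_Rintegral => x _; rewrite /rho; ring.
by move=> /(cvg_unique _ H) ->.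
Qed.

End lebesgue_points.

(** * Smooth cutoffs *)

Section flat_function.
Context (R : realType).
Implicit Types (n : nat) (x y : R).

(** These functions y^-n exp(-1/y), extended by 0, span a space closed under
    differentiation; this is how smoothness is proved. *)
Definition flat n y : R := if 0 < y then y ^- n * expR (- y^-1) else 0.

Lemma flat_le0 n y : y <= 0 -> flat n y = 0.
Proof. by rewrite /flat ltNge => ->. Qed.

Lemma flat_ge0 n y : 0 <= flat n y.
Proof.
rewrite /flat; case: ifPn => // y0.
by rewrite mulr_ge0 ?expR_ge0// invr_ge0 exprn_ge0// ltW.
Qed.

Lemma flat0_gt0 y : 0 < y -> 0 < flat 0 y.
Proof. by move=> y0; rewrite /flat y0 expr0 invr1 mul1r expR_gt0. Qed.

(** This quadratic bound makes [flat] differentiable at 0. *)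
Lemma flat_bound n y : flat n y <= n.+2`!%:R * y ^+ 2.
Proof.
have [y0|y0] := ltP 0 y; last first.
  by rewrite flat_le0// mulr_ge0// sqr_ge0.
rewrite /flat y0 expRN -invfM -ler_pdivrMr ?exprn_gt0//.
have yn m : 0 < y ^+ m by exact: exprn_gt0.
rewrite -invfM -[leRHS]invrK lef_pV2 ?posrE ?invr_gt0 ?ltr0n ?fact_gt0//; last first.
  by rewrite !mulr_gt0 ?expR_gt0.
have yV : 0 <= y^-1 by rewrite invr_ge0 ltW.
have := expR_ge1Dxn n.+1 yV; rewrite exprVn => H.
have {}H : y ^- n.+2 / n.+2`!%:R <= expR y^-1.
  by apply: le_trans H; rewrite lerDr.
have -> : y ^+ n * expR y^-1 * y ^+ 2 = expR y^-1 * y ^+ n.+2.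
  by rewrite -(addn2 n) exprD; ring.
by rewrite -ler_pdivrMr// mulrC.
Qed.

Lemma is_derive_flat n y :
  is_derive (y : R^o) 1 (flat n : R^o -> R^o) (- n%:R * flat n.+1 y + flat n.+2 y).
Proof.
have [y0|y0|y0] := ltgtP y 0.
- rewrite !flat_le0 ?ltW// mulr0 addr0.
  apply: (near_eq_is_derive _ (is_derive_cst (0 : R^o) (y : R^o) 1)).
  near=> z; apply/esym; rewrite flat_le0//= ltW//; near: z.
  exact: lt_nbhsl.
- have dV : is_derive (y : R^o) 1 (GRing.inv : R^o -> R^o) (- y ^- 2).
    have := @is_deriveV _ id y 1 1 (lt0r_neq0 y0) (is_derive_id _ _).
    by rewrite /GRing.scale/= mulr1.
  have dE : is_derive (y : R^o) 1 (fun z => expR (- z^-1) : R^o) (y ^- 2 * expR (- y^-1)).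
    have dN : is_derive (y : R^o) 1 (fun z => - z^-1 : R^o) (y ^- 2).
      by have := @is_deriveN _ _ _ _ _ _ _ dV; rewrite opprK.
    have := @is_derive1_comp _ expR (fun z => - z^-1 : R^o) y _ _ (is_derive_expR _) dN.
    by rewrite mulrC.
  have dP := @is_deriveX _ _ _ n _ _ _ dV.
  have d1 := @is_deriveM _ _ _ _ _ _ _ _ dP dE.
  apply: (@near_eq_is_derive _ _ _ _ _ _ _ _ _ (is_derive_eq d1 _)).
    near=> z; rewrite /flat ifT ?exprVn//=; last first.
      by near: z; exact: lt_nbhsr.
    by rewrite fctE exprfctE exprVn.
  rewrite /flat y0 !exprfctE /GRing.scale/=.
  rewrite -!exprVn; move: (y^-1) (expR _) => i e.
  by case: (n) => [|m] /=; rewrite ?exprS; ring.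
- rewrite y0 !flat_le0// mulr0 addr0.
  have H : h^-1 *: (flat n (h *: 1 + 0) - flat n 0) @[h --> 0^'] --> (0 : R^o).
    apply/cvgr0Pnorm_le => e e0.
    near=> h.
    have h0 : h != 0 by near: h; exact: nbhs_dnbhs_neq.
    rewrite addr0 /GRing.scale/= mulr1 (@flat_le0 _ 0)// subr0 normrM normfV.
    rewrite ler_pdivrMl ?normr_gt0//.
    rewrite ger0_norm ?flat_ge0//; apply: (le_trans (flat_bound _ _)).
    rewrite -(normr2 h) expr2 mulrA mulrC ler_wpM2l//.
    rewrite -ler_pdivlMl ?ltr0n ?fact_gt0//.
    near: h; apply: dnbhs0_le.
    by rewrite mulr_gt0// invr_gt0 ltr0n fact_gt0.
  apply: DeriveDef; first by apply/cvg_ex; exists 0.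
  exact: cvg_lim H.
Unshelve. all: by end_near. Qed.

End flat_function.

Section smooth_algebra.
Context (R : realType) (V : normedModType R).
Implicit Types (f g : V -> R^o) (B : set (V -> R^o)).

(** The algebra generated by B. If B is made of differentiable functions whose
    derivatives are in the algebra, then all its elements are smooth. *)
Inductive diffalg B : (V -> R^o) -> Prop :=
| diffalg_base f : B f -> diffalg B f
| diffalg_cst (c : R) : diffalg B (fun=> c)
| diffalg_add f g : diffalg B f -> diffalg B g -> diffalg B (fun x => f x + g x)
| diffalg_mul f g : diffalg B f -> diffalg B g ->
    diffalg B (fun x => (f x : R) * g x).

Lemma diffalg_differentiable B : (forall f, B f -> forall x, differentiable f x) ->
  forall f, diffalg B f -> forall x, differentiable f x.
Proof.
move=> Bd f; elim=> {f} [f /Bd//|c x|f g _ fd _ gd x|f g _ fd _ gd x].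
- exact: differentiable_cst.
- exact: differentiableD.
- exact: differentiableM.
Qed.

Lemma diffalg_derive B : (forall f, B f -> forall x, differentiable f x) ->
  (forall f v, B f -> diffalg B ('D_v f)) ->
  forall f, diffalg B f -> forall v, diffalg B ('D_v f).
Proof.
move=> Bd BD f; elim=> {f} [f Bf v|c v|f g fB fD gB gD v|f g fB fD gB gD v].
- exact: BD.
- have -> : 'D_v (fun=> c : R^o) = (fun=> 0) :> (V -> R^o).
    by apply/funext => x; exact: derive_cst.
  exact: diffalg_cst.
- have -> : 'D_v (fun x => f x + g x) = (fun x => 'D_v f x + 'D_v g x).
    apply/funext => x; apply: deriveD; apply: diff_derivable;
    exact: (diffalg_differentiable Bd).
  exact: diffalg_add.
- have -> : 'D_v (fun x => (f x : R) * g x) =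
      (fun x => (f x : R) * 'D_v g x + (g x : R) * 'D_v f x).
    apply/funext => x; apply: deriveM; apply: diff_derivable;
    exact: (diffalg_differentiable Bd).
  by apply: diffalg_add; apply: diffalg_mul.
Qed.

Lemma diffalg_smooth B : (forall f, B f -> forall x, differentiable f x) ->
  (forall f v, B f -> diffalg B ('D_v f)) ->
  forall f, diffalg B f -> smooth (f : V -> R).
Proof.
move=> Bd BD f Bf vs x; apply: (diffalg_differentiable Bd).
elim: vs => //= v vs ih; exact: (diffalg_derive Bd BD ih).
Qed.

End smooth_algebra.

Section smooth_step.
Context (R : realType).
Implicit Types (n : nat) (x y : R).

Definition flat_den y : R := flat 0 y + flat 0 (1 - y).

Lemma flat_den_gt0 y : 0 < flat_den y.
Proof.
have [y0|y0] := ltP 0 y.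
  by rewrite ltr_pwDl ?flat0_gt0 ?flat_ge0.
by rewrite ltr_wpDl ?flat_ge0// flat0_gt0// subr_gt0 (le_lt_trans y0).
Qed.

(** A smooth transition from 0 on ]-oo, 0] to 1 on [1, +oo[. *)
Definition sstep y : R := flat 0 y * (flat_den y)^-1.

Lemma sstep_le0 y : y <= 0 -> sstep y = 0.
Proof. by move=> y0; rewrite /sstep flat_le0// mul0r. Qed.

Lemma sstep_ge1 y : 1 <= y -> sstep y = 1.
Proof.
move=> y1; have := flat_den_gt0 y; rewrite /sstep /flat_den.
by rewrite (@flat_le0 _ _ (1 - y)) ?subr_le0// addr0 => /lt0r_neq0/divff.
Qed.

Lemma sstep_ge0 y : 0 <= sstep y.
Proof. by rewrite mulr_ge0 ?flat_ge0// invr_ge0 ltW// flat_den_gt0. Qed.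

Lemma sstep_le1 y : sstep y <= 1.
Proof. by rewrite ler_pdivrMr ?flat_den_gt0// mul1r lerDl flat_ge0. Qed.

(** Generators of an algebra containing [sstep] and stable under differentiation
    and affine changes of variable; both are needed since [step] rescales. *)
Definition step_base : set (R^o -> R^o) := [set f | exists a b : R,
  (exists n, f = fun x => flat n (a * x + b)) \/ f = fun x => (flat_den (a * x + b))^-1].

Lemma is_derive_affine (f : R^o -> R^o) (a b x df : R) :
  is_derive (a * x + b : R^o) 1 f df ->
  is_derive (x : R^o) 1 (fun x => f (a * x + b) : R^o) (a * df).
Proof.
move=> fdf.
have da : is_derive (x : R^o) 1 (fun x => a * x + b : R^o) a.
  have := @is_deriveZ _ _ _ _ a _ _ _ (is_derive_id (x : R^o) 1).
  move=> H; have := @is_deriveD _ _ _ _ _ _ _ _ _ H (is_derive_cst (b : R^o) x 1).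
  by rewrite /GRing.scale/= mulr1 addr0.
have := @is_derive1_comp _ f (fun x => a * x + b) x _ _ fdf da.
by rewrite mulrC.
Qed.

Lemma is_derive_dir (f : R^o -> R^o) (x v df : R) : is_derive (x : R^o) 1 f df ->
  differentiable f (x : R^o) /\ 'D_v f (x : R^o) = v * df.
Proof.
move=> [/derivable1_diffP fd fE]; split => //.
rewrite deriveE// -[v]mulr1 -[v * 1]/(v *: (1 : R^o)) linearZ /= -deriveE// fE.
by rewrite /GRing.scale/= mulr1.
Qed.

Lemma is_derive_den y :
  is_derive (y : R^o) 1 (flat_den : R^o -> R^o)
    (flat 2 y - flat 2 (1 - y)).
Proof.
have d1 := is_derive_flat 0 y.
have d2 : is_derive (y : R^o) 1 (fun y => flat 0 (-1 * y + 1) : R^o) (-1 * (- 0%:R * flat 1 (-1 * y + 1) + flat 2 (-1 * y + 1))).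
  by apply: (@is_derive_affine (flat 0)); exact: is_derive_flat.
have -> : (flat_den : R^o -> R^o) = (flat 0 : R^o -> R^o) \+ (fun y => flat 0 (-1 * y + 1) : R^o).
  apply/funext => z; rewrite /flat_den/=; congr (_ + flat _ _); ring.
apply: (is_derive_eq (@is_deriveD _ _ _ _ _ _ _ _ _ d1 d2)).
by rewrite !mulN1r oppr0 !mul0r !add0r addrC (addrC (- y)) addrC.
Qed.

Lemma step_base_derive f : step_base f -> forall x, exists df : R,
  is_derive (x : R^o) 1 f df.
Proof.
move=> [a [b [[n ->]|->]]] x.
  eexists; apply: (@is_derive_affine (flat n)); exact: is_derive_flat.
eexists; apply: (@is_derive_affine (fun y => (flat_den y)^-1)).
apply: is_deriveV; first by rewrite gt_eqF// flat_den_gt0.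
exact: is_derive_den.
Qed.

Lemma step_base_differentiable f : step_base f -> forall x, differentiable f x.
Proof.
by move=> /step_base_derive H x; have [df /(is_derive_dir 1)[]] := H x.
Qed.

Lemma step_base_D f v : step_base f -> diffalg step_base ('D_v f).
Proof.
move=> [a [b [[n ->]|->]]].
  have -> : 'D_v (fun x : R^o => flat n (a * x + b) : R^o) =
      (fun x => (v * a : R) * ((- n%:R : R) * flat n.+1 (a * x + b) + flat n.+2 (a * x + b))).
    apply/funext => x; rewrite -mulrA.
    apply: (is_derive_dir v _).2; apply: (@is_derive_affine (flat n)).
    exact: is_derive_flat.
  apply: diffalg_mul; first exact: diffalg_cst.
  apply: diffalg_add; last by apply: diffalg_base; exists a, b; left; exists n.+2.
  apply: diffalg_mul; first exact: diffalg_cst.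
  by apply: diffalg_base; exists a, b; left; exists n.+1.
pose d x : R := (flat_den (a * x + b))^-1.
have -> : 'D_v (fun x : R^o => (flat_den (a * x + b))^-1 : R^o) =
    (fun x => (- (v * a) : R) * ((d x * d x) *
      (flat 2 (a * x + b) + (-1) * flat 2 ((- a) * x + (1 - b))))).
  apply/funext => x.
  have H := @is_deriveV _ _ _ _ _ (lt0r_neq0 (flat_den_gt0 (a * x + b))) (is_derive_den _).
  rewrite (is_derive_dir v (@is_derive_affine (fun y => (flat_den y)^-1) _ _ _ _ H)).2.
  rewrite (_ : - a * x + (1 - b) = 1 - (a * x + b)); last by ring.
  by rewrite /GRing.scale/= /d -exprVn expr2; ring.
have dB : diffalg step_base (d : R^o -> R^o).
  by apply: diffalg_base; exists a, b; right.
apply: diffalg_mul; first exact: diffalg_cst.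
apply: diffalg_mul; first exact: diffalg_mul.
apply: diffalg_add; first by apply: diffalg_base; exists a, b; left; exists 2%N.
apply: diffalg_mul; first exact: diffalg_cst.
by apply: diffalg_base; exists (- a), (1 - b); left; exists 2%N.
Qed.

Lemma diffalg_sstep a b : diffalg step_base (fun x : R^o => sstep (a * x + b) : R^o).
Proof.
apply: diffalg_mul; apply: diffalg_base; exists a, b; first by left; exists 0%N.
by right.
Qed.

End smooth_step.

Section cutoffs.
Context (R : realType).
Local Notation mu := (@lebesgue_measure R).
Implicit Types (n : nat) (x y p q : R).

(** As n grows, the transition takes place in ]p, p + 1/(n+1)]: it stays to the
    right of p, so that the limit is the indicator of ]p, +oo[ at every point. *)
Definition step p n x : R := sstep (n.+1%:R * x + - (n.+1%:R * p)).

Definition kern p n : R -> R := derive1 (step p n : R^o -> R^o).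

Definition cutoff p q n x : R := step p n x - step q n x.

Lemma stepE p n x : step p n x = sstep (n.+1%:R * (x - p)).
Proof. by rewrite /step mulrBr. Qed.

Lemma step_le p n x : x <= p -> step p n x = 0.
Proof. by move=> xp; rewrite stepE sstep_le0// mulr_ge0_le0// subr_le0. Qed.

Lemma step_ge p n x : p + n.+1%:R^-1 <= x -> step p n x = 1.
Proof.
move=> xp; rewrite stepE sstep_ge1// -ler_pdivrMl// mulr1.
by rewrite lerBrDl.
Qed.

Lemma diffalg_step p n : diffalg (@step_base R) (step p n : R^o -> R^o).
Proof. exact: diffalg_sstep. Qed.

Lemma diffalg_step_derivable (f : R^o -> R^o) : diffalg (@step_base R) f ->
  forall x, derivable f (x : R^o) 1.
Proof.
move=> Af x; apply/derivable1_diffP.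
exact: (diffalg_differentiable (@step_base_differentiable R)).
Qed.

Lemma diffalg_step_continuous (f : R^o -> R^o) : diffalg (@step_base R) f ->
  continuous f.
Proof.
move=> Af x; apply: differentiable_continuous.
exact: (diffalg_differentiable (@step_base_differentiable R)).
Qed.

Lemma diffalg_step_meas (f : R^o -> R^o) : diffalg (@step_base R) f ->
  measurable_fun setT (f : R -> R).
Proof. by move=> /diffalg_step_continuous; exact: continuous_measurable_fun. Qed.

Lemma kern_diffalg p n : diffalg (@step_base R) (kern p n : R^o -> R^o).
Proof.
have -> : (kern p n : R^o -> R^o) = 'D_1 (step p n : R^o -> R^o).
  by apply/funext => x; exact: derive1E.
apply: (diffalg_derive (@step_base_differentiable R) (@step_base_D R)).
exact: diffalg_step.
Qed.

Lemma step_meas p n : measurable_fun setT (step p n).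
Proof. exact: diffalg_step_meas (diffalg_step p n). Qed.

Lemma kern_meas p n : measurable_fun setT (kern p n).
Proof. exact: diffalg_step_meas (kern_diffalg p n). Qed.

Lemma cutoff_meas p q n : measurable_fun setT (cutoff p q n).
Proof. by apply: measurable_funB; exact: step_meas. Qed.

Lemma kern_out p n x : x < p \/ p + n.+1%:R^-1 < x -> kern p n x = 0.
Proof.
move=> xp; rewrite /kern derive1E.
have [c H] : exists c : R, \forall y \near (x : R^o), (cst c : R^o -> R^o) y = step p n y.
  case: xp => xp; [exists 0|exists 1]; near=> y; apply/esym.
    by rewrite step_le// ltW//; near: y; exact: lt_nbhsl.
  by rewrite step_ge// ltW//; near: y; exact: lt_nbhsr.
have [_ ->//] := near_eq_is_derive H (is_derive_cst (c : R^o) (x : R^o) 1).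
Unshelve. all: by end_near. Qed.

Lemma kern_scale p n x : kern p n x = n.+1%:R * kern 0 0 (n.+1%:R * (x - p)).
Proof.
have d0 : is_derive (n.+1%:R * x + - (n.+1%:R * p) : R^o) 1
    (step 0 0 : R^o -> R^o) (kern 0 0 (n.+1%:R * (x - p))).
  rewrite -mulrBr /kern derive1E.
  apply: DeriveDef => //; exact: (diffalg_step_derivable (diffalg_step 0 0)).
have [_ <-] := is_derive_affine d0; rewrite [LHS]/kern derive1E.
congr (derive _ (x : R^o) (1 : R^o)); apply/funext => y.
by rewrite /step mulr0 oppr0 addr0 mul1r.
Qed.

(** By scaling, it is enough to bound the derivative of a single step. *)
Lemma kern_bound : exists2 C : R, 0 <= C & forall p n x,
  `|kern p n x| <= C * n.+1%:R * \1_(`[p, p + n.+1%:R^-1]%classic) x.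
Proof.
have cK : {within `[0, 1]%classic, continuous (fun x : R => `|kern 0 0 x|)}.
  apply: continuous_subspaceT => x; apply: continuous_comp.
    exact: (diffalg_step_continuous (kern_diffalg 0 0)).
  exact: norm_continuous.
have [c _ Hc] := EVT_max (@ler01 R) cK.
exists `|kern 0 0 c| => // p n x.
have [/orP xp|] := boolP ((x < p) || (p + n.+1%:R^-1 < x)).
  by rewrite kern_out// normr0 mulr_ge0// mulr_ge0.
rewrite negb_or -!leNgt => /andP[px xp].
rewrite indicE mem_set ?mulr1; last by rewrite /= in_itv/= px.
rewrite kern_scale normrM mulrC normr_nat ler_wpM2r//.
apply: Hc; rewrite in_itv/= mulr_ge0 ?subr_ge0//=.
by rewrite -ler_pdivlMl// mulr1 lerBlDl.
Qed.

Lemma Rint_kern p n : \int[mu]_x kern p n x = 1.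
Proof.
have pn : p < p + n.+1%:R^-1 by rewrite ltrDl invr_gt0.
have -> : \int[mu]_x kern p n x = \int[mu]_(x in `[p, p + n.+1%:R^-1]) kern p n x.
  rewrite [RHS]Rintegral_mkcond; apply: eq_Rintegral => x _.
  rewrite patchE; case: ifPn => //; rewrite notin_setE /= in_itv/= => /negP.
  by rewrite negb_and -!ltNge => /orP/kern_out.
rewrite /Rintegral (@continuous_FTC2 _ _ (step p n))//.
- by rewrite /= step_ge// step_le// subr0.
- apply: continuous_subspaceT; exact: (diffalg_step_continuous (kern_diffalg p n)).
- have cS := diffalg_step_continuous (diffalg_step p n).
  split.
  + by move=> x _; exact: (diffalg_step_derivable (diffalg_step p n)).
  + by apply: cvg_at_right_filter; exact: cS.
  + by apply: cvg_at_left_filter; exact: cS.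
Qed.

Lemma step_bound p n x : 0 <= step p n x <= 1.
Proof. by rewrite sstep_ge0 sstep_le1. Qed.

Lemma cutoff_out p q n x : p <= q -> (x <= p) || (q + 1 <= x) -> cutoff p q n x = 0.
Proof.
move=> pq; have n1 : n.+1%:R^-1 <= 1 :> R by rewrite invf_le1 ?ler1n.
move=> /orP[xp|qx]; rewrite /cutoff.
  by rewrite !step_le// ?subrr// (le_trans xp).
by rewrite !step_ge ?subrr//; apply: le_trans qx; rewrite ?lerD.
Qed.

Lemma cutoff_bound p q n x : p <= q -> `|cutoff p q n x| <= \1_(`]p, q + 1]%classic) x.
Proof.
move=> pq; have [|] := boolP ((x <= p) || (q + 1 <= x)).
  by move=> /(cutoff_out n pq) ->; rewrite normr0.
rewrite negb_or -!ltNge => /andP[px xq].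
rewrite indicE mem_set /=; last by rewrite in_itv/= px ltW.
have := step_bound p n x; have := step_bound q n x; rewrite /cutoff.
move=> /andP[? ?] /andP[? ?]; rewrite ler_norml; lra.
Qed.

Lemma cvg_step p x : step p n x @[n --> \oo] --> (\1_(`]p, +oo[%classic) x : R).
Proof.
rewrite indicE; case: (boolP (x \in _)).
  rewrite inE /= in_itv/= andbT => px.
  apply: cvg_near_cst.
  have xp : 0 < x - p by rewrite subr_gt0.
  have /cvgr0Pnorm_le/(_ _ xp) := @cvg_harmonic R.
  apply: filterS => n; rewrite /harmonic/= ger0_norm// => H.
  by rewrite step_ge// -lerBrDl.
rewrite notin_setE /= in_itv/= andbT => /negP; rewrite -leNgt => xp.
by apply: cvg_near_cst; apply: nearW => n; exact: step_le.
Qed.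

Lemma cvg_cutoff p q x : p <= q ->
  cutoff p q n x @[n --> \oo] --> (\1_(`]p, q]%classic) x : R).
Proof.
move=> pq.
have -> : \1_(`]p, q]%classic) x = \1_(`]p, +oo[%classic) x - \1_(`]q, +oo[%classic) x :> R.
  rewrite !indicE !mem_setE !in_itv/= !andbT.
  by case: (ltP p x) => px; case: (ltP q x) => qx; rewrite /= ?subrr ?subr0//; lra.
by apply: cvgB; exact: cvg_step.
Qed.

Lemma derive1_cutoff p q n x :
  derive1 (cutoff p q n : R^o -> R^o) x = kern p n x - kern q n x.
Proof.
rewrite derive1E deriveB ?/kern ?derive1E//;
exact: (diffalg_step_derivable (diffalg_step _ _)).
Qed.

Lemma diffalg_cutoff p q n : diffalg (@step_base R) (cutoff p q n : R^o -> R^o).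
Proof.
apply: diffalg_add; first exact: diffalg_step.
have -> : (fun x : R^o => - step q n x : R^o) = (fun x => (-1 : R) * step q n x).
  by apply/funext => x; rewrite mulN1r.
by apply: diffalg_mul; [exact: diffalg_cst|exact: diffalg_step].
Qed.

Lemma test_function_cutoff p q n : p <= q ->
  test_function (V := R^o) setT (cutoff p q n).
Proof.
move=> pq; split => //.
  apply: (diffalg_smooth (@step_base_differentiable R) (@step_base_D R)).
  exact: diffalg_cutoff.
apply: (@subclosed_compact _ _ (`[p, q + 1]%classic : set R^o)).
- exact: closed_closure.
- exact: segment_compact.
- have H : closed (`[p, q + 1]%classic : set R^o) by exact: interval_closed.
  rewrite [X in _ `<=` X]((closure_id _).1 H); apply: closureS => x /=.
  rewrite in_itv/=; apply: contraR.
  by rewrite negb_and -!ltNge => /orP[] xp; apply/eqP; apply: cutoff_out => //; rewrite (ltW xp) ?orbT.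
Qed.

Definition plane_base : set ((R^o * R^o)%type -> R^o) :=
  [set F | exists f : R^o -> R^o, diffalg (@step_base R) f /\
    (F = (fun z : R^o * R^o => f z.1) \/ F = (fun z : R^o * R^o => f z.2))].

Lemma plane_base_differentiable F : plane_base F -> forall z, differentiable F z.
Proof.
move=> [f [Af [->|->]]] z.
  apply: (@differentiable_comp _ _ _ _ fst f).
    by apply: linear_differentiable => ?; exact: cvg_fst.
  exact: (diffalg_differentiable (@step_base_differentiable R)).
apply: (@differentiable_comp _ _ _ _ snd f).
  by apply: linear_differentiable => ?; exact: cvg_snd.
exact: (diffalg_differentiable (@step_base_differentiable R)).
Qed.

Lemma plane_base_D F v : plane_base F -> diffalg plane_base ('D_v F).
Proof.
move=> [f [Af [->|->]]]; apply: diffalg_base.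
  exists ('D_(v.1) f); split.
    exact: (diffalg_derive (@step_base_differentiable R) (@step_base_D R)).
  by left; apply/funext.
exists ('D_(v.2) f); split.
  exact: (diffalg_derive (@step_base_differentiable R) (@step_base_D R)).
by right; apply/funext.
Qed.

Definition cutoff2 t1 t2 n p q k (z : R * R) := cutoff t1 t2 n z.1 * cutoff p q k z.2.

Lemma diffalg_cutoff2 t1 t2 n p q k :
  diffalg plane_base (cutoff2 t1 t2 n p q k : (R^o * R^o)%type -> R^o).
Proof.
apply: diffalg_mul; apply: diffalg_base.
  by exists (cutoff t1 t2 n); split; [exact: diffalg_cutoff|left].
by exists (cutoff p q k); split; [exact: diffalg_cutoff|right].
Qed.

Lemma test_function_cutoff2 t1 t2 n p q k : 0 < t1 -> t1 <= t2 -> p <= q ->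
  test_function (V := (R^o * R^o)%type) (strip `]0, +oo[%classic)
    (cutoff2 t1 t2 n p q k).
Proof.
move=> t10 t12 pq.
have sub : closure [set z : (R^o * R^o)%type | cutoff2 t1 t2 n p q k z != 0] `<=`
    (`[t1, t2 + 1]%classic : set R^o) `*` (`[p, q + 1]%classic : set R^o).
  have H : closed ((`[t1, t2 + 1]%classic : set R^o) `*` (`[p, q + 1]%classic : set R^o)).
    have -> : ((`[t1, t2 + 1]%classic : set R^o) `*` (`[p, q + 1]%classic : set R^o)) =
        (fst @^-1` (`[t1, t2 + 1]%classic : set R^o)) `&`
        (snd @^-1` (`[p, q + 1]%classic : set R^o)) by [].
    apply: closedI; apply: closed_comp; try exact: interval_closed.
      by move=> ? _; exact: cvg_fst.
    by move=> ? _; exact: cvg_snd.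
  rewrite [X in _ `<=` X]((closure_id _).1 H); apply: closureS => -[x y] /=.
  rewrite !in_itv/= /cutoff2 /= mulf_eq0 negb_or => /andP[H1 H2]; split.
    apply: contraR H1.
    by rewrite negb_and -!ltNge => /orP[] xp; apply/eqP; apply: cutoff_out => //; rewrite (ltW xp) ?orbT.
  apply: contraR H2.
  by rewrite negb_and -!ltNge => /orP[] xp; apply/eqP; apply: cutoff_out => //; rewrite (ltW xp) ?orbT.
split.
- apply: (diffalg_smooth plane_base_differentiable plane_base_D).
  exact: diffalg_cutoff2.
- apply: subclosed_compact sub; first exact: closed_closure.
  by apply: compact_setX; exact: segment_compact.
- apply: (subset_trans sub) => -[x y] [/= + _].
  by rewrite /strip/= !in_itv/= andbT => /andP[+ _]; move=> /(lt_le_trans t10).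
Qed.

Lemma cutoff2_D t1 t2 n p q k (v z : (R^o * R^o)%type) :
  'D_v (cutoff2 t1 t2 n p q k : (R^o * R^o)%type -> R^o) z =
  v.1 * (kern t1 n z.1 - kern t2 n z.1) * cutoff p q k z.2 +
  v.2 * cutoff t1 t2 n z.1 * (kern p k z.2 - kern q k z.2).
Proof.
pose F1 : (R^o * R^o)%type -> R^o := fun z => cutoff t1 t2 n z.1.
pose F2 : (R^o * R^o)%type -> R^o := fun z => cutoff p q k z.2.
have B1 : plane_base F1.
  by exists (cutoff t1 t2 n); split; [exact: diffalg_cutoff|left].
have B2 : plane_base F2.
  by exists (cutoff p q k); split; [exact: diffalg_cutoff|right].
have -> : (cutoff2 t1 t2 n p q k : (R^o * R^o)%type -> R^o) = F1 * F2 by [].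
rewrite deriveM; last 2 first.
- exact/diff_derivable/plane_base_differentiable.
- exact/diff_derivable/plane_base_differentiable.
have dir p' q' m (w y : R) : 'D_w (cutoff p' q' m : R^o -> R^o) y =
    w * (kern p' m y - kern q' m y).
  have D : is_derive (y : R^o) 1 (cutoff p' q' m : R^o -> R^o) (kern p' m y - kern q' m y).
    apply: DeriveDef; first exact: (diffalg_step_derivable (diffalg_cutoff _ _ _)).
    by rewrite -derive1E derive1_cutoff.
  exact: (is_derive_dir w D).2.
have -> : 'D_v F1 z = v.1 * (kern t1 n z.1 - kern t2 n z.1) by exact: dir.
have -> : 'D_v F2 z = v.2 * (kern p k z.2 - kern q k z.2) by exact: dir.
rewrite /F1 /F2 /GRing.scale/=.
move: (cutoff t1 t2 n z.1) (cutoff p q k z.2) (kern t1 n z.1 - _) (kern p k z.2 - _).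
by move: (v.1) (v.2) => v1 v2 A B C D; ring.
Qed.

End cutoffs.

(** * Weak derivatives in the half plane *)

Section weak_derivatives.
Context (R : realType).
Local Notation mu := (@lebesgue_measure R).
Local Notation mu2 := (mu \x mu)%E.
Local Notation pos := (`]0, +oo[%classic : set R).
Implicit Types (f g : R -> R -> R) (a b : R -> R).

Definition box (tau K : R) (z : R * R) : R :=
  \1_(`]0, tau]%classic) z.1 * \1_(`]- K, K]%classic) z.2.

(** Only positive times matter: multiplying by their indicator lets every
    integral run over the whole plane. *)
Definition box_intg f := measurable_fun setT (fun z : R * R => \1_pos z.1 * f z.1 z.2) /\
  forall tau K, 0 < tau -> 0 < K ->
  intg mu2 (fun z => box tau K z * f z.1 z.2).

Lemma box_pos f tau K z : box tau K z * f z.1 z.2 = box tau K z * (\1_pos z.1 * f z.1 z.2).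
Proof.
rewrite /box !indicE; case: (boolP (z.1 \in `]0, tau]%classic)); rewrite ?mul0r//.
rewrite inE /= in_itv/= => /andP[z0 _].
by rewrite (_ : z.1 \in pos) ?mul1r// inE /= in_itv/= z0.
Qed.

Definition bdd_on (i : interval R) (A : R) a :=
  measurable_fun setT a /\ forall t, `|a t| <= A * \1_([set` i]) t.

Definition cvg_on (i : interval R) (A : R) (a_ : nat -> R -> R) a :=
  [/\ forall n, bdd_on i A (a_ n), bdd_on i A a & forall t, a_ n t @[n --> \oo] --> a t].

Lemma indic_itv_meas (i : interval R) : measurable_fun setT (\1_([set` i]) : R -> R).
Proof. exact: measurable_indic. Qed.

Lemma bdd_on_indic (i j : interval R) : [set` i] `<=` [set` j] -> bdd_on j 1 (\1_([set` i])).
Proof.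
move=> ij; split; first exact: indic_itv_meas.
by move=> t; rewrite mul1r ger0_norm//; exact: indic_sub.
Qed.

Lemma bdd_on_le (i j : interval R) A a : 0 <= A -> [set` i] `<=` [set` j] ->
  bdd_on i A a -> bdd_on j A a.
Proof.
move=> A0 ij [ma aA]; split=> // t; apply: (le_trans (aA t)).
by rewrite ler_wpM2l//; exact: indic_sub.
Qed.

Lemma bdd_onB i A B a b : bdd_on i A a -> bdd_on i B b ->
  bdd_on i (A + B) (fun t => a t - b t).
Proof.
move=> [ma aA] [mb bB]; split; first exact: measurable_funB.
by move=> t; rewrite mulrDl (le_trans (ler_normB _ _))// lerD.
Qed.

Lemma cvg_on_cst i A a : bdd_on i A a -> cvg_on i A (fun=> a) a.
Proof. by move=> ba; split => // t; exact: cvg_cst. Qed.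

Section box.
Variables (f : R -> R -> R) (tau K : R).
Hypotheses (fi : box_intg f) (tau0 : 0 < tau) (K0 : 0 < K).

Lemma box_bound a b A B z : bdd_on `]0, tau] A a -> bdd_on `]- K, K] B b ->
  `|(\1_pos z.1 * f z.1 z.2) * (a z.1 * b z.2)| <= (A * B) * `|box tau K z * f z.1 z.2|.
Proof.
move=> [_ aA] [_ bB]; rewrite box_pos normrM [X in _ <= _ * X]normrM mulrA mulrC.
apply: ler_wpM2r => //.
rewrite normrM /box (ger0_norm (_ : 0 <= _ * \1__ _)) ?mulr_ge0// mulrACA.
by apply: ler_pM.
Qed.

Lemma box_meas a b A B : bdd_on `]0, tau] A a -> bdd_on `]- K, K] B b ->
  measurable_fun setT (fun z : R * R => (\1_pos z.1 * f z.1 z.2) * (a z.1 * b z.2)).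
Proof.
move=> [ma _] [mb _]; apply: measurable_funM; first exact: fi.1.
by apply: measurable_funM; exact: measurableT_comp.
Qed.

Lemma box_intg_prod a b A B : bdd_on `]0, tau] A a -> bdd_on `]- K, K] B b ->
  intg mu2 (fun z => (\1_pos z.1 * f z.1 z.2) * (a z.1 * b z.2)).
Proof.
move=> aA bB; apply: (@intg_dom _ _ _ mu2 (fun z => (A * B) * `|box tau K z * f z.1 z.2|)).
- exact: box_meas aA bB.
- by apply: intgZ; apply: intg_norm; exact: fi.2.
- by move=> z; exact: box_bound.
Qed.

Lemma dct_box (a_ b_ : nat -> R -> R) a b A B :
  cvg_on `]0, tau] A a_ a -> cvg_on `]- K, K] B b_ b ->
  \int[mu2]_z ((\1_pos z.1 * f z.1 z.2) * (a_ n z.1 * b_ n z.2)) @[n --> \oo] -->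
  \int[mu2]_z ((\1_pos z.1 * f z.1 z.2) * (a z.1 * b z.2)).
Proof.
move=> [aA a1 ca] [bB b1 cb].
apply: (@dctR _ _ _ mu2 _ _ (fun z => (A * B) * `|box tau K z * f z.1 z.2|)).
- by move=> n; exact: box_meas (aA n) (bB n).
- exact: box_meas a1 b1.
- apply: nearW => z; apply: cvgM; first exact: cvg_cst.
  by apply: cvgM; [exact: ca|exact: cb].
- by apply: intgZ; apply: intg_norm; exact: fi.2.
- by move=> n z; exact: box_bound.
Qed.

Lemma box_fubini a b A B : bdd_on `]0, tau] A a -> bdd_on `]- K, K] B b ->
  intg mu (fun t => a t * \int[mu]_x (\1_pos t * f t x * b x)) /\
  \int[mu2]_z ((\1_pos z.1 * f z.1 z.2) * (a z.1 * b z.2)) =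
  \int[mu]_t (a t * \int[mu]_x (\1_pos t * f t x * b x)).
Proof.
move=> aA bB; have Fi := box_intg_prod aA bB.
have E : {ae mu, forall t, \int[mu]_x (\1_pos t * f t x * (a t * b x)) =
    a t * \int[mu]_x (\1_pos t * f t x * b x)}.
  apply: ae_imp (fubini_intg_section Fi) => t Ft.
  have [at0|at0] := eqVneq (a t) 0.
    rewrite at0 mul0r; under eq_Rintegral do rewrite mul0r mulr0.
    by rewrite Rintegral_cst// mul0r.
  rewrite -RintegralZl//; first by apply: eq_Rintegral => x _; ring.
  have := intgZ (a t)^-1 Ft; apply: eq_integrable => // x _ /=; congr EFin.
  by field.
have mH : measurable_fun setT (fun t => a t * \int[mu]_x (\1_pos t * f t x * b x)).
  apply: measurable_funM; first exact: aA.1.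
  apply: (@meas_Rint _ _ _ _ _ mu (fun z => (\1_pos z.1 * f z.1 z.2) * b z.2)).
  by apply: measurable_funM; [exact: fi.1|exact: measurableT_comp bB.1 _].
have iF := fubini_intg Fi.
split; first exact: (@intg_ae _ _ _ mu _ _ mH E iF).
by rewrite fubiniE//; apply: Rint_ae => //; exact: intg_meas iF.
Qed.

End box.

Lemma weak_cutoff (v : R * R) f g (t1 t2 p q : R) n k : weak_deriv v f g ->
  0 < t1 -> t1 <= t2 -> p <= q ->
  \int[mu2]_z ((\1_pos z.1 * f z.1 z.2) *
    (v.1 * (kern t1 n z.1 - kern t2 n z.1) * cutoff p q k z.2 +
     v.2 * cutoff t1 t2 n z.1 * (kern p k z.2 - kern q k z.2))) =
  - \int[mu2]_z ((\1_pos z.1 * g z.1 z.2) * (cutoff t1 t2 n z.1 * cutoff p q k z.2)).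
Proof.
move=> fg t10 t12 pq.
have := fg _ (test_function_cutoff2 n k t10 t12 pq).
rewrite [X in X = _ -> _]Rintegral_mkcond [X in _ = - X -> _]Rintegral_mkcond => H.
transitivity (\int[mu2]_x
   ((fun p0 : R * R =>
      f p0.1 p0.2 * 'D_v (cutoff2 t1 t2 n p q k : R^o * R^o -> R^o) p0) \_ (strip `]0, +oo[%classic)) x).
  apply: eq_Rintegral => z _; rewrite patchE indicE.
  rewrite (_ : (z \in strip _) = (z.1 \in pos)); last first.
    by apply/idP/idP; rewrite !inE /strip/=; [case|split].
  by case: (_ \in _); rewrite ?mul0r// mul1r cutoff2_D.
rewrite H; congr (- _); apply: eq_Rintegral => z _; rewrite patchE indicE.
rewrite (_ : (z \in strip _) = (z.1 \in pos)); last first.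
  by apply/idP/idP; rewrite !inE /strip/=; [case|split].
by case: (_ \in _); rewrite ?mul0r// mul1r.
Qed.

Definition rad (p q : R) := `|p| + `|q| + 2.

Lemma rad_gt0 p q : 0 < rad p q.
Proof. by rewrite ltr_wpDl// addr_ge0. Qed.

Lemma sub_rad (p q x : R) : p <= x <= q + 1 -> - rad p q < x <= rad p q.
Proof.
move=> /andP[px xq]; rewrite /rad.
have := ler_norm (- p); rewrite normrN; have := ler_norm q.
have := normr_ge0 p; have := normr_ge0 q; lra.
Qed.

Lemma sub_rad_itv (p q : R) : `]p, q] `<=` `]- rad p q, rad p q].
Proof.
move=> x /=; rewrite !in_itv/= => /andP[px xq]; apply: sub_rad.
by rewrite ltW//= (le_trans xq)// lerDl.
Qed.

Lemma bdd_on_cutoff i (p q : R) n : p <= q -> `]p, q + 1] `<=` [set` i] ->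
  bdd_on i 1 (cutoff p q n).
Proof.
move=> pq pqi; apply: bdd_on_le pqi _ => //; split; first exact: cutoff_meas.
by move=> x; rewrite mul1r; exact: cutoff_bound.
Qed.

Lemma cvg_on_cutoff i (p q : R) : p <= q -> `]p, q + 1] `<=` [set` i] ->
  cvg_on i 1 (cutoff p q) (\1_(`]p, q]%classic)).
Proof.
move=> pq pqi; split => [n||x]; [exact: bdd_on_cutoff| |exact: cvg_cutoff].
apply: bdd_on_indic; apply: subset_trans pqi => x /=; rewrite !in_itv/= => /andP[-> xq].
by rewrite (le_trans xq)// lerDl.
Qed.

Lemma sub_rad_itv1 (p q : R) : `]p, q + 1] `<=` `]- rad p q, rad p q].
Proof. by move=> x /=; rewrite !in_itv/= => /andP[/ltW px xq]; rewrite sub_rad ?px. Qed.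

Lemma sub_pos_itv (p q : R) : 0 < p -> `]p, q] `<=` `]0, q].
Proof.
by move=> p0 x /=; rewrite !in_itv/= => /andP[px ->]; rewrite (lt_trans p0 px).
Qed.

Lemma bdd_on_kern : exists2 C : R, 0 <= C & forall i n (p : R),
  `[p, p + 1] `<=` [set` i] -> bdd_on i (C * n.+1%:R) (kern p n).
Proof.
have [C C0 HC] := @kern_bound R; exists C => // i n p pi.
have pn : `[p, p + n.+1%:R^-1] `<=` [set` i].
  apply: subset_trans pi => x /=; rewrite !in_itv/= => /andP[-> xp].
  by rewrite (le_trans xp)// lerD// invf_le1 ?ler1n.
apply: bdd_on_le pn _; first by rewrite mulr_ge0.
by split; [exact: kern_meas|exact: HC].
Qed.

(** The test function is a product of cutoffs. The one in space is first sent to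
    an indicator; then the derivative of the one in time concentrates at t1 and
    t2, where the values of H are recovered as those at Lebesgue points. *)
Lemma weak_deriv_t f g (t1 t2 p q : R) : box_intg f -> box_intg g ->
  weak_deriv (1, 0) f g -> 0 < t1 -> t1 <= t2 -> p <= q ->
  let H (t : R) := \int[mu]_x (\1_pos t * f t x * \1_(`]p, q]%classic) x) in
  lebesgue_pt H t1 -> lebesgue_pt H t2 -> locally_integrable setT H ->
  H t2 - H t1 = \int[mu2]_z ((\1_pos z.1 * g z.1 z.2) *
     (\1_(`]t1, t2]%classic) z.1 * \1_(`]p, q]%classic) z.2)).
Proof.
move=> fi gi fg t10 t12 pq H H1 H2 lH.
have [C C0 HC] := bdd_on_kern; have K0 := rad_gt0 p q.
have t20 : 0 < t2 + 1 by rewrite (lt_trans (lt_le_trans t10 t12))// ltrDl.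
have bk s n : t1 <= s -> s <= t2 -> bdd_on `]0, t2 + 1] (C * n.+1%:R) (kern s n).
  move=> s1 s2; apply: HC => x /=; rewrite !in_itv/= => /andP[sx xs].
  by rewrite (lt_le_trans t10 (le_trans s1 sx)) (le_trans xs)// lerD2r.
have bkk n := bdd_onB (bk t1 n (lexx _) t12) (bk t2 n t12 (lexx _)).
have cx := cvg_on_cutoff pq (@sub_rad_itv1 p q).
have ct := cvg_on_cutoff t12 (@sub_pos_itv t1 (t2 + 1) t10).
have bI := bdd_on_indic (@sub_rad_itv p q).
have E n : \int[mu2]_z ((\1_pos z.1 * f z.1 z.2) *
     ((kern t1 n z.1 - kern t2 n z.1) * \1_(`]p, q]%classic) z.2)) =
   - \int[mu2]_z ((\1_pos z.1 * g z.1 z.2) * (cutoff t1 t2 n z.1 * \1_(`]p, q]%classic) z.2)).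
  have c1 := dct_box fi t20 K0 (cvg_on_cst (bkk n)) cx.
  have [bc _ _] := ct.
  have c2 := dct_box gi t20 K0 (cvg_on_cst (bc n)) cx.
  move: c1; under eq_fun => k.
    have := weak_cutoff n k fg t10 t12 pq; under eq_Rintegral do rewrite /= mul0r mul0r addr0 mul1r.
    move=> ->. over.
  by move=> c1; exact: (cvg_unique _ c1 (cvgN c2)).
have F n : \int[mu2]_z ((\1_pos z.1 * f z.1 z.2) *
     ((kern t1 n z.1 - kern t2 n z.1) * \1_(`]p, q]%classic) z.2)) =
   \int[mu]_t (H t * kern t1 n t) - \int[mu]_t (H t * kern t2 n t).
  have [_ ->] := box_fubini fi t20 K0 (bkk n) bI.
  have iHk s : t1 <= s -> s <= t2 -> intg mu (fun t => H t * kern s n t).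
    move=> s1 s2; have [Hi _] := box_fubini fi t20 K0 (bk s n s1 s2) bI.
    by move: Hi; apply: eq_integrable => // t _ /=; congr EFin; rewrite mulrC.
  rewrite -RintegralB//; [|exact: iHk|exact: iHk].
  by apply: eq_Rintegral => t _; rewrite -/(H t); ring.
have c3 := dct_box gi t20 K0 ct (cvg_on_cst bI).
have c4 : \int[mu]_t (H t * kern t1 n t) - \int[mu]_t (H t * kern t2 n t)
    @[n --> \oo] --> H t1 - H t2.
  have [C' _ HC'] := @kern_bound R.
  by apply: cvgB; apply: (lebesgue_pt_kernel lH) => //;
    [move=> ?; exact: kern_meas|move=> ?; exact: Rint_kern|move=> ?; exact: kern_meas|move=> ?; exact: Rint_kern].
move: c4; under eq_fun do rewrite -F E.
move=> c4; rewrite -[LHS]opprK opprB.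
by rewrite (cvg_unique _ c4 (cvgN c3)) ?opprK//; exact: Rhausdorff.
Qed.

Lemma ae0_pos (A : R -> R) : measurable_fun setT A ->
  (forall t1 t2, 0 < t1 -> t1 <= t2 ->
    intg mu (fun t => \1_(`]t1, t2]%classic) t * A t) /\
    \int[mu]_t (\1_(`]t1, t2]%classic) t * A t) = 0) ->
  {ae mu, forall t, 0 < t -> A t = 0}.
Proof.
move=> mA H.
pose f (n : nat) t := \1_(`]n.+1%:R^-1, n.+1%:R]%classic) t * A t.
have n0 n : 0 < n.+1%:R^-1 :> R by rewrite invr_gt0.
have n1 n : n.+1%:R^-1 <= n.+1%:R :> R.
  by apply: (@le_trans _ _ 1); rewrite ?ler1n// invf_le1 ?ler1n.
have fae n : {ae mu, forall t, f n t = 0}.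
  apply: ae0_itv.
    apply: open_integrable_locally; first exact: openT.
    exact: (H _ _ (n0 n) (n1 n)).1.
  move=> p q pq.
  pose p' := Num.max p n.+1%:R^-1; pose q' := Num.min q n.+1%:R.
  have E : (fun t => \1_(`]p, q]%classic) t * f n t) =
      (fun t => \1_(`]p', q']%classic) t * A t).
    apply/funext => t; rewrite /f mulrA !indicE !mem_setE !in_itv/= gt_max le_min.
    case: (p < t); case: (t <= q); case: (_ < t); case: (t <= _);
    by rewrite /= ?mul0r ?mul1r ?mul0r.
  rewrite E; have [pq'|qp'] := leP p' q'.
    have p'0 : 0 < p' by rewrite (lt_le_trans (n0 n))// le_max lexx orbT.
    by have [_ ->] := H p' q' p'0 pq'.
  rewrite (_ : `]p', q']%classic = set0); last first.
    by apply/seteqP; split => // x /=; rewrite in_itv/=; lra.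
  under eq_Rintegral do rewrite indic0 mul0r.
  by rewrite Rintegral_cst// mul0r.
apply: ae_imp (ae_all fae) => t ft t0.
have [n tn] : exists n : nat, n.+1%:R^-1 < t <= n.+1%:R.
  exists (maxn (Num.truncn t) (Num.truncn t^-1)).
  apply/andP; split.
    rewrite invf_plt ?posrE//; apply: (lt_le_trans (truncnS_gt _)).
    by rewrite ler_nat ltnS leq_maxr.
  apply: ltW; apply: (lt_le_trans (truncnS_gt _)).
  by rewrite ler_nat ltnS leq_maxl.
by have := ft n; rewrite /f indicE mem_set ?mul1r//= in_itv.
Qed.

(** Sending only the time cutoff to an indicator leaves, for a fixed test function
    in x, an identity integrated over an arbitrary time interval. *)
Lemma weak_deriv_x f g (p q : R) (k : nat) : box_intg f -> box_intg g ->
  weak_deriv (0, 1) f g -> p <= q ->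
  {ae mu, forall t, 0 < t -> \int[mu]_x (f t x * (kern p k x - kern q k x)) =
     - \int[mu]_x (g t x * cutoff p q k x)}.
Proof.
move=> fi gi fg pq; have [C C0 HC] := bdd_on_kern; have K0 := rad_gt0 p q.
have bk s : p <= s -> s <= q -> bdd_on `]- rad p q, rad p q] (C * k.+1%:R) (kern s k).
  move=> s1 s2; apply: HC => x /=; rewrite !in_itv/= => /andP[sx xs].
  by rewrite sub_rad// (le_trans s1 sx) (le_trans xs)// lerD2r.
pose b x := kern p k x - kern q k x.
have bb : bdd_on _ _ b := bdd_onB (bk p (lexx _) pq) (bk q pq (lexx _)).
have bc := bdd_on_cutoff k pq (@sub_rad_itv1 p q).
pose A t := \int[mu]_x (\1_pos t * f t x * b x) +
            \int[mu]_x (\1_pos t * g t x * cutoff p q k x).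
have mA : measurable_fun setT A.
  apply: measurable_funD.
    apply: (@meas_Rint _ _ _ _ _ mu (fun z => (\1_pos z.1 * f z.1 z.2) * b z.2)).
    by apply: measurable_funM; [exact: fi.1|exact: measurableT_comp bb.1 _].
  apply: (@meas_Rint _ _ _ _ _ mu (fun z => (\1_pos z.1 * g z.1 z.2) * cutoff p q k z.2)).
  by apply: measurable_funM; [exact: gi.1|exact: measurableT_comp bc.1 _].
have : {ae mu, forall t, 0 < t -> A t = 0}.
  apply: ae0_pos => // t1 t2 t10 t12.
  have t20 : 0 < t2 + 1 by rewrite (lt_trans (lt_le_trans t10 t12))// ltrDl.
  have ct := cvg_on_cutoff t12 (@sub_pos_itv t1 (t2 + 1) t10).
  have [_ bI _] := ct.
  have [i1 e1] := box_fubini fi t20 K0 bI bb.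
  have [i2 e2] := box_fubini gi t20 K0 bI bc.
  have i12 := intgD i1 i2.
  have E : EFin \o (fun t => \1_(`]t1, t2]%classic) t * A t) = EFin \o (fun t =>
      \1_(`]t1, t2]%classic) t * \int[mu]_x (\1_pos t * f t x * b x) +
      \1_(`]t1, t2]%classic) t * \int[mu]_x (\1_pos t * g t x * cutoff p q k x)).
    by apply/funext => t /=; rewrite mulrDr.
  split; first by rewrite E.
  transitivity (\int[mu]_t (\1_(`]t1, t2]%classic) t * \int[mu]_x (\1_pos t * f t x * b x) +
      \1_(`]t1, t2]%classic) t * \int[mu]_x (\1_pos t * g t x * cutoff p q k x))).
    by apply: eq_Rintegral => t _; rewrite mulrDr.
  rewrite RintegralD// -e1 -e2.
  have c1 := dct_box fi t20 K0 ct (cvg_on_cst bb).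
  have c2 := dct_box gi t20 K0 ct (cvg_on_cst bc).
  move: c1; under eq_fun => n.
    have := weak_cutoff n k fg t10 t12 pq.
    under eq_Rintegral do rewrite /= !mul0r add0r mul1r.
    move=> ->. over.
  move=> c1; rewrite (cvg_unique _ c1 (cvgN c2)); last exact: Rhausdorff.
  by rewrite addNr.
apply: ae_imp => t At t0; have := At t0.
rewrite /A indicE mem_set/=; last by rewrite in_itv/= t0.
under eq_Rintegral do rewrite mul1r; under [X in _ + X]eq_Rintegral do rewrite mul1r.
by move=> /eqP; rewrite addr_eq0 => /eqP.
Qed.

End weak_derivatives.

(** * Primitives *)

Section fundamental_theorem.
Context (R : realType).
Local Notation mu := (@lebesgue_measure R).

Lemma continuous_lebesgue_ptT (z : R -> R) p : continuous z -> lebesgue_pt z p.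
Proof.
move=> cz; apply: (@continuous_lebesgue_pt _ _ _ setT) => //.
- by split=> //; exact: openT.
- exact: continuous_measurable_fun.
- exact: cz.
Qed.

Lemma continuous_locint (z : R -> R) : continuous z -> locally_integrable setT z.
Proof.
move=> cz; split; [exact: continuous_measurable_fun|exact: openT|].
move=> K _ cK.
have := @continuous_compact_integrable R z K cK (continuous_subspaceT cz).
by move=> /integrableP[_].
Qed.

Lemma kern_lim (f : R -> R) p : locally_integrable setT f -> lebesgue_pt f p ->
  \int[mu]_x (f x * kern p n x) @[n --> \oo] --> f p.
Proof.
move=> lf fp; have [C _ HC] := @kern_bound R.
by apply: (lebesgue_pt_kernel lf fp) => //; [move=> n; exact: kern_meas|move=> n; exact: Rint_kern].
Qed.

Lemma locint_kern (f : R -> R) p n : locally_integrable setT f ->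
  intg mu (fun x => f x * kern p n x).
Proof.
move=> lf; have [C _ HC] := @kern_bound R.
have := locint_intg lf (@subset_refl _ `[p, p + n.+1%:R^-1]%classic).
move=> /intg_norm /(intgZ (C * n.+1%:R)) H.
apply: (@intg_dom _ _ _ mu _ _ _ H).
  by apply: measurable_funM; [case: lf|exact: kern_meas].
move=> x; rewrite normrM mulrC normrM mulrA ler_wpM2r//.
by rewrite (ger0_norm (_ : 0 <= \1__ x)).
Qed.

Lemma cutoff_lim (g : R -> R) p q : locally_integrable setT g -> p <= q ->
  \int[mu]_x (g x * cutoff p q n x) @[n --> \oo] -->
  \int[mu]_x (\1_(`]p, q]%classic) x * g x).
Proof.
move=> lg pq; have [mg _ _] := lg.
have sub : `]p, q + 1] `<=` `[p, q + 1]%classic.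
  by apply/subset_itvP; exact: subset_itv_oc_cc.
apply: (@dctR _ _ _ mu _ _ (fun x => `|\1_(`]p, q + 1]%classic) x * g x|)).
- by move=> n; apply: measurable_funM => //; exact: cutoff_meas.
- by apply: measurable_funM => //; exact: measurable_indic.
- apply: nearW => x; rewrite [X in _ --> X]mulrC.
  by apply: cvgM; [exact: cvg_cst|exact: cvg_cutoff].
- exact: (intg_norm (locint_intg lg sub)).
- move=> n x; rewrite normrM mulrC normrM ler_wpM2r//.
  by rewrite (ger0_norm (_ : 0 <= \1__ x))//; exact: cutoff_bound.
Qed.

Lemma rat_approx (p : R) : exists r : nat -> rat,
  (forall n, p < ratr (r n)) /\ (ratr (r n) : R) @[n --> \oo] --> p.
Proof.
have H n : exists r : rat, p < ratr r < p + n.+1%:R^-1.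
  have [r] := @rat_in_itvoo R p (p + n.+1%:R^-1) ltac:(by rewrite ltrDl invr_gt0).
  by rewrite in_itv/=; exists r.
exists (fun n => projT1 (cid (H n))); split=> [n|].
  by case: cid => r /= /andP[].
apply: (@squeeze_cvgr _ _ _ _ (fun=> p) (fun n => p + n.+1%:R^-1)).
- by apply: nearW => n; case: cid => r /= /andP[? ?]; rewrite !ltW.
- exact: cvg_cst.
- rewrite -[X in _ --> X]addr0; apply: cvgD; first exact: cvg_cst.
  exact: cvg_harmonic.
Qed.

Lemma cvg_indic_right (p q : R) (p_ q_ : nat -> R) x :
  (forall n, p <= p_ n) -> (forall n, q <= q_ n) ->
  p_ @ \oo --> p -> q_ @ \oo --> q ->
  \1_(`]p_ n, q_ n]%classic) x @[n --> \oo] --> (\1_(`]p, q]%classic) x : R).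
Proof.
move=> pp qq cp cq; apply: cvg_near_cst.
have [xp|px] := leP x p.
  apply: nearW => n; rewrite !indicE !memNset//= in_itv/= ltNge ?xp//.
  by rewrite (le_trans xp).
have [qx|xq] := ltP q x.
  have H : \forall n \near \oo, q_ n < x by exact: (cvgr_lt _ cq).
  apply: filterS H => n qnx.
  by rewrite !indicE !memNset//= in_itv/= leNgt ?qx ?qnx ?andbF.
have H : \forall n \near \oo, p_ n < x by exact: (cvgr_lt _ cp).
apply: filterS H => n pnx.
by rewrite !indicE !mem_set//= in_itv/= ?px ?pnx//= (le_trans xq).
Qed.

(** Only countably many test functions are used, so that the identities may hold
    outside of a null set of times which does not depend on them; other endpoints
    are reached by rational ones from the right. *)
Lemma weak_primitive (z g : R -> R) : continuous z -> locally_integrable setT g ->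
  (forall (r s : rat) k, r <= s -> \int[mu]_x (z x * (kern (ratr r) k x - kern (ratr s) k x)) =
     - \int[mu]_x (g x * cutoff (ratr r) (ratr s) k x)) ->
  forall p q, p <= q -> z q - z p = \int[mu]_x (\1_(`]p, q]%classic) x * g x).
Proof.
move=> cz lg zg.
have lz := continuous_locint cz.
have Hr (r s : rat) : r <= s -> z (ratr s) - z (ratr r) =
    \int[mu]_x (\1_(`](ratr r), (ratr s)]%classic) x * g x).
  move=> rs; have rs' : ratr r <= ratr s :> R by rewrite ler_rat.
  have c1 : \int[mu]_x (z x * (kern (ratr r) k x - kern (ratr s) k x)) @[k --> \oo] -->
      z (ratr r) - z (ratr s).
    under eq_fun => k.
      under eq_Rintegral do rewrite mulrBr.
      rewrite RintegralB//; [over|exact: locint_kern|exact: locint_kern].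
    by apply: cvgB; apply: kern_lim => //; exact: continuous_lebesgue_ptT.
  move: c1; under eq_fun => k do rewrite (zg r s k rs).
  have c2 := cutoff_lim lg rs'.
  move=> c1; rewrite -[LHS]opprK opprB.
  by rewrite (cvg_unique _ c1 (cvgN c2)) ?opprK//; exact: Rhausdorff.
move=> p q; rewrite le_eqVlt => /orP[/eqP->|pq].
  rewrite subrr set_itvoc0; under eq_Rintegral do rewrite indic0 mul0r.
  by rewrite Rintegral_cst// mul0r.
have [r [pr cr]] := rat_approx p; have [s [qs cs]] := rat_approx q.
have sub : `]p, q + 1] `<=` `[p, q + 1]%classic.
  by apply/subset_itvP; exact: subset_itv_oc_cc.
have [mg _ _] := lg.
pose s' n := Num.min (ratr (s n) : R) (q + 1).
have near_rs : \forall n \near \oo, ratr (r n) <= (ratr (s n) : R) /\ (ratr (s n) : R) <= q + 1.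
  have h1 : \forall n \near \oo, ratr (r n) < q by exact: (cvgr_lt _ cr).
  have q1 : q < q + 1 by rewrite ltrDl.
  have h2 : \forall n \near \oo, ratr (s n) < q + 1 by exact: (cvgr_lt _ cs).
  near=> n; split; last by apply: ltW; near: n.
  apply: (le_trans _ (ltW (qs n))); apply: ltW; near: n; exact: h1.
have c1 : z (ratr (s n)) - z (ratr (r n)) @[n --> \oo] --> z q - z p.
  apply: cvgB; first exact: (cvg_comp _ _ cs (cz q)).
  exact: (cvg_comp _ _ cr (cz p)).
have c2 : \int[mu]_x (\1_(`](ratr (r n)), (s' n)]%classic) x * g x) @[n --> \oo] -->
    \int[mu]_x (\1_(`]p, q]%classic) x * g x).
  apply: (@dctR _ _ _ mu _ _ (fun x => `|\1_(`]p, q + 1]%classic) x * g x|)).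
  - by move=> n; apply: measurable_funM => //; exact: measurable_indic.
  - by apply: measurable_funM => //; exact: measurable_indic.
  - apply: nearW => x; apply: cvgM; last exact: cvg_cst.
    apply: cvg_indic_right => //.
    + by move=> n; exact: ltW.
    + by move=> n; rewrite le_min (ltW (qs n)) lerDl ler01.
    + apply: cvg_trans cs; apply: near_eq_cvg.
      by apply: filterS near_rs => n [_ h]; rewrite /s' min_l.
  - exact: (intg_norm (locint_intg lg sub)).
  - move=> n x; rewrite !normrM ler_wpM2r// !ger0_norm//; apply: indic_sub => y /=.
    rewrite !in_itv/= => /andP[ry ys]; rewrite (lt_trans (pr n) ry)/=.
    by move: ys; rewrite le_min => /andP[].
apply: (cvg_unique _ c1); first exact: Rhausdorff.
apply: cvg_trans c2; apply: near_eq_cvg.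
apply: filterS near_rs => n [rs sq].
rewrite /s' min_l// Hr//.
by rewrite -(ler_rat R).
Unshelve. all: by end_near. Qed.

End fundamental_theorem.

(** * Distribution functions of signed measures *)

Section discrete_variation.
Context (R : realType).
Implicit Types (v w : nat -> R) (n : nat).

(** The variation of the sequence 0, v 0, ..., v n, 0: for a function which vanishes
    at infinity, the two outer jumps account for what happens outside of the grid. *)
Definition var v n : R := `|v 0%N| + \sum_(i < n) `|v i.+1 - v i| + `|v n|.

End discrete_variation.

Section finite_measures.
Context (R : realType).
Variable m : {finite_measure set (measurableTypeR R) -> \bar R}.
Implicit Type f : R -> R.

Lemma bnd_intg f C : measurable_fun setT f -> (forall x, `|f x| <= C) ->
  intg m f.
Proof.
move=> mf fC; apply: (@intg_dom _ _ _ m (cst C)) => //.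
exact: finite_measure_integrable_cst.
Qed.

Lemma bounded_cvg (f_ : nat -> R -> R) f C : (forall n, measurable_fun setT (f_ n)) ->
  measurable_fun setT f -> (forall n x, `|f_ n x| <= C) ->
  (forall x, f_ n x @[n --> \oo] --> f x) ->
  \int[m]_x f_ n x @[n --> \oo] --> \int[m]_x f x.
Proof.
move=> mf_ mf fC cf; apply: (@dctR _ _ _ m _ _ (cst C)) => //.
  exact: nearW.
exact: finite_measure_integrable_cst.
Qed.

Lemma Rint_cstT (c : R) : \int[m]_x c = c * fine (m setT).
Proof. exact: Rintegral_cst. Qed.

Lemma Rint_bound f C : measurable_fun setT f -> (forall x, `|f x| <= C) ->
  `|\int[m]_x f x| <= C * fine (m setT).
Proof.
move=> mf fC; rewrite -Rint_cstT.
apply: (le_trans (le_normr_Rintegral measurableT (bnd_intg mf fC))).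
apply: le_Rint => //; first exact: intg_norm (bnd_intg mf fC).
exact: finite_measure_integrable_cst.
Qed.

Lemma indic_intg (A : set R) : measurable A -> intg m (\1_A : R -> R).
Proof.
move=> mA; apply: (@bnd_intg _ 1); first exact: measurable_indic.
by move=> x; rewrite indicE; case: (_ \in _); rewrite ?normr1 ?normr0.
Qed.

End finite_measures.

(** Right-continuity along sequences, the form used with dominated convergence. *)
Definition rcs (R : realType) (f : R -> R) := forall x (y_ : nat -> R),
  (forall n, x <= y_ n) -> y_ @ \oo --> x -> f (y_ n) @[n --> \oo] --> f x.

Lemma cvg_indic_ray (R : realType) (p : R) (p_ : nat -> R) x :
  (forall n, p <= p_ n) -> p_ @ \oo --> p ->
  \1_(`]-oo, p_ n]%classic) x @[n --> \oo] --> (\1_(`]-oo, p]%classic) x : R).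
Proof.
move=> pp cp; apply: cvg_near_cst.
have [xp|px] := leP x p.
  by apply: nearW => n; rewrite !indicE !mem_set//= in_itv/=// (le_trans xp).
have H : \forall n \near \oo, p_ n < x by exact: (cvgr_lt _ cp).
apply: filterS H => n pnx.
by rewrite !indicE !memNset//= in_itv/= leNgt ?px ?pnx.
Qed.

Section difference_of_measures.
Context (R : realType).
Variables P N : {finite_measure set (measurableTypeR R) -> \bar R}.
Implicit Type f : R -> R.

Definition dint f : R := \int[P]_x f x - \int[N]_x f x.
Definition total_mass : R := fine (P setT) + fine (N setT).

Definition bdd_meas (C : R) f := measurable_fun setT f /\ forall x, `|f x| <= C.

Lemma dintB f g C D : bdd_meas C f -> bdd_meas D g -> dint (fun x => f x - g x) = dint f - dint g.
Proof.
move=> [mf fC] [mg gD]; rewrite /dint.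
rewrite !RintegralB//; first ring.
- exact: bnd_intg mf fC.
- exact: bnd_intg mg gD.
- exact: bnd_intg mf fC.
- exact: bnd_intg mg gD.
Qed.

Lemma dintZ c f C : bdd_meas C f -> dint (fun x => c * f x) = c * dint f.
Proof.
move=> [mf fC]; rewrite /dint !RintegralZl ?mulrBr//; exact: bnd_intg mf fC.
Qed.

Lemma dint_sum n (F : 'I_n -> R -> R) C : (forall i, bdd_meas C (F i)) ->
  dint (fun x => \sum_(i < n) F i x) = \sum_(i < n) dint (F i).
Proof.
move=> FC; rewrite /dint !Rint_sum ?sumrB//;
by move=> i; have [? ?] := FC i; apply: bnd_intg; eauto.
Qed.

Lemma dint_bounded_cvg (f_ : nat -> R -> R) f C : (forall n, bdd_meas C (f_ n)) ->
  measurable_fun setT f -> (forall x, f_ n x @[n --> \oo] --> f x) ->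
  dint (f_ n) @[n --> \oo] --> dint f.
Proof.
by move=> fC mf cf; apply: cvgB; apply: (@bounded_cvg _ _ _ _ C) => // n; have [] := fC n.
Qed.

Lemma dint_bound f C : bdd_meas C f -> `|dint f| <= C * total_mass.
Proof.
move=> [mf fC]; apply: (le_trans (ler_normB _ _)).
by rewrite mulrDr; apply: lerD; exact: Rint_bound.
Qed.

Lemma bdd_meas_indic (A : set R) : measurable A -> bdd_meas 1 (\1_A : R -> R).
Proof.
move=> mA; split; first exact: measurable_indic.
by move=> x; rewrite indicE; case: (_ \in _); rewrite ?normr1 ?normr0.
Qed.

Definition dcdf x := dint (\1_(`]-oo, x]%classic) : R -> R).
(** Distribution functions: the increments of the one of P - N are controlled by
    those of the one of P + N. *)
Definition tcdf x := \int[P]_y (\1_(`]-oo, x]%classic) y) + \int[N]_y (\1_(`]-oo, x]%classic) y).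

Lemma indic_rayB (x y z : R) : x <= y ->
  \1_(`]-oo, y]%classic) z - \1_(`]-oo, x]%classic) z = \1_(`]x, y]%classic) z :> R.
Proof.
move=> xy; rewrite !indicE !mem_setE !in_itv/=.
by case: (leP z y) => zy; case: (leP z x) => zx; rewrite /= ?subrr ?subr0//; lra.
Qed.

Lemma dcdfB x y : x <= y -> dcdf y - dcdf x = dint (\1_(`]x, y]%classic) : R -> R).
Proof.
move=> xy; rewrite /dcdf -(dintB (bdd_meas_indic _) (bdd_meas_indic _))//.
by congr dint; apply/funext => z; exact: indic_rayB.
Qed.

Lemma dint_indic_bound (A : set R) : measurable A ->
  `|dint (\1_A : R -> R)| <= \int[P]_y \1_A y + \int[N]_y \1_A y.
Proof.
move=> mA; apply: (le_trans (ler_normB _ _)).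
by rewrite !ger0_norm//; apply: Rintegral_ge0.
Qed.

Lemma tcdfB x y : x <= y -> tcdf y - tcdf x =
  \int[P]_z (\1_(`]x, y]%classic) z) + \int[N]_z (\1_(`]x, y]%classic) z).
Proof.
move=> xy; rewrite /tcdf opprD addrACA -!RintegralB//; try exact: indic_intg.
by congr (_ + _); apply: eq_Rintegral => z _; exact: indic_rayB.
Qed.

Lemma dcdf_tcdf x y : x <= y -> `|dcdf y - dcdf x| <= tcdf y - tcdf x.
Proof. by move=> xy; rewrite dcdfB// tcdfB//; exact: dint_indic_bound. Qed.

Lemma dcdf_le x : `|dcdf x| <= tcdf x.
Proof. exact: dint_indic_bound. Qed.

Lemma tcdf_mono x y : x <= y -> tcdf x <= tcdf y.
Proof.
by move=> xy; rewrite -subr_ge0 (le_trans _ (dcdf_tcdf xy)).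
Qed.

Lemma total_massE : total_mass = \int[P]_y (cst 1 y) + \int[N]_y (cst 1 y).
Proof. by rewrite /total_mass !Rint_cstT !mul1r. Qed.

Lemma dcdf_top x : `|dint (cst 1) - dcdf x| <= total_mass - tcdf x.
Proof.
have E z : 1 - \1_(`]-oo, x]%classic) z = \1_(`]x, +oo[%classic) z :> R.
  rewrite !indicE !mem_setE !in_itv/= andbT.
  by case: (leP z x) => zx; rewrite /= ?subrr ?subr0.
have b1 : bdd_meas 1 (cst 1 : R -> R) by split => // y; rewrite normr1.
rewrite -(dintB b1 (bdd_meas_indic _))// total_massE /tcdf opprD addrACA.
rewrite -!RintegralB//; try exact: indic_intg; try exact: finite_measure_integrable_cst.
rewrite (_ : (fun x0 => cst 1 x0 - _) = \1_(`]x, +oo[%classic)); last first.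
  by apply/funext => z; exact: E.
exact: dint_indic_bound.
Qed.

Lemma dcdf_rcs : rcs dcdf.
Proof.
move=> x y_ xy cy; apply: (@dint_bounded_cvg _ _ 1).
- by move=> n; exact: bdd_meas_indic.
- exact: measurable_indic.
- by move=> z; exact: cvg_indic_ray.
Qed.

Lemma dcdf_meas : measurable_fun setT dcdf.
Proof.
have H (m : {finite_measure set (measurableTypeR R) -> \bar R}) :
    measurable_fun setT (fun x : R => \int[m]_y (\1_(`]-oo, x]%classic) y)).
  pose S := [set z : R * R | z.2 <= z.1].
  have mS : measurable S.
    have -> : S = (fun z : R * R => z.1 - z.2) @^-1` `[0, +oo[%classic.
      by apply/seteqP; split=> z /=; rewrite in_itv/= andbT subr_ge0.
    rewrite -[X in measurable X]setTI.
    have : measurable_fun setT (fun z : R * R => z.1 - z.2).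
      by apply: measurable_funB; [exact: measurable_fst|exact: measurable_snd].
    by apply => //; exact: measurable_itv.
  have mI : measurable_fun setT (\1_S : R * R -> R) by exact: measurable_indic.
  have := @meas_Rint _ _ _ _ _ m _ mI.
  have E x : \int[m]_y (\1_S (x, y)) = \int[m]_y (\1_(`]-oo, x]%classic) y).
    by apply: eq_Rintegral => y _; rewrite !indicE !mem_setE in_itv.
  by under eq_fun do rewrite E.
by apply: measurable_funB; exact: H.
Qed.

Lemma tcdf_Ny (e : R) : 0 < e -> exists n : nat, tcdf (- n%:R) < e.
Proof.
move=> e0.
have cI z : \1_(`]-oo, (- n%:R : R)]%classic) z @[n --> \oo] --> (cst 0 z : R).
  apply: cvg_near_cst; apply: filterS (nbhs_infty_gtr (- z)) => n zn.
  by rewrite indicE memNset//= in_itv/= leNgt ltrNl zn.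
have c0 : tcdf (- n%:R) @[n --> \oo] --> (\int[P]_y (cst 0 y) + \int[N]_y (cst 0 y) : R).
  by apply: cvgD; apply: (@bounded_cvg _ _ _ _ 1) => //;
    solve [move=> n; exact: measurable_indic |move=> n x; exact: (bdd_meas_indic _).2].
rewrite !Rint_cstT !mul0r addr0 in c0.
have [n _ Hn] : \forall n \near \oo, tcdf (- n%:R) < e by exact: (cvgr_lt _ c0).
by exists n; apply: Hn => /=.
Qed.

Lemma tcdf_y (e : R) : 0 < e -> exists n : nat, total_mass - e < tcdf n%:R.
Proof.
move=> e0.
have cI z : \1_(`]-oo, (n%:R : R)]%classic) z @[n --> \oo] --> (cst 1 z : R).
  apply: cvg_near_cst; apply: filterS (nbhs_infty_gtr z) => n zn.
  by rewrite indicE mem_set//= in_itv/= ltW.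
have c0 : tcdf n%:R @[n --> \oo] --> (\int[P]_y (cst 1 y) + \int[N]_y (cst 1 y) : R).
  by apply: cvgD; apply: (@bounded_cvg _ _ _ _ 1) => //;
    solve [move=> n; exact: measurable_indic |move=> n x; exact: (bdd_meas_indic _).2].
rewrite -total_massE in c0.
have tv1 : total_mass - e < total_mass by rewrite ltrBlDr ltrDl.
have [n _ Hn] : \forall n \near \oo, total_mass - e < tcdf n%:R by exact: (cvgr_gt _ c0).
by exists n; apply: Hn => /=.
Qed.

(** The outer jumps of [var] are bounded by the mass to the left of x_ 0 and, since
    P and N have equal masses, by the mass to the right of x_ n. *)
Lemma var_dcdf (x_ : nat -> R) n : {homo x_ : i j / (i <= j)%N >-> i <= j} ->
  dint (cst 1) = 0 -> var (dcdf \o x_) n <= total_mass.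
Proof.
move=> xh d1; rewrite /var.
have H1 : \sum_(i < n) `|dcdf (x_ i.+1) - dcdf (x_ i)| <= tcdf (x_ n) - tcdf (x_ 0%N).
  elim: n => [|n ih]; first by rewrite big_ord0 subrr.
  rewrite big_ord_recr /=.
  have := dcdf_tcdf (xh n n.+1 (leqnSn n)); move: ih; lra.
have := dcdf_top (x_ n); rewrite d1 sub0r normrN => H2.
have := dcdf_le (x_ 0%N) => H3 /=; lra.
Qed.

End difference_of_measures.

(** * Representatives of BV functions *)

Section bv_representative.
Context (R : realType).
Local Notation mu := (@lebesgue_measure R).

Lemma ae_itv_ex (A : R -> Prop) (a b : R) : {ae mu, forall x, A x} -> a < b ->
  exists x, a < x < b /\ A x.
Proof.
move=> [S [mS S0 AS]] ab; apply: contrapT => nex.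
have sub : `]a, b[%classic `<=` S.
  move=> x /=; rewrite in_itv/= => xab.
  by apply: AS => /= Ax; apply: nex; exists x.
have : (mu `]a, b[%classic <= mu S)%E by apply: le_measure; rewrite ?inE.
by rewrite S0 lebesgue_measure_itv/= lte_fin ab -EFinB lee_fin subr_le0 leNgt ab.
Qed.

(** This fixes the constants of integration: if l were not 0, the integral of f^2
    over long enough intervals would be arbitrarily large. *)
Lemma L2_level (f : R -> R) (l : R) : L2 mu f ->
  (forall e K, 0 < e -> 0 < K -> exists p, forall x, p < x <= p + K -> `|f x - l| <= e) ->
  l = 0.
Proof.
move=> [mf f2] H; apply/eqP/negP => /negP l0.
have l0' : 0 < `|l| by rewrite normr_gt0.
pose I := \int[mu]_x (f x ^+ 2).
have I0 : 0 <= I by apply: Rintegral_ge0 => x _; exact: sqr_ge0.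
(* long enough for the integral of f^2 to exceed I *)
pose K := (I + 1) * 4 / `|l| ^+ 2.
have K0 : 0 < K by rewrite divr_gt0 ?exprn_gt0// mulr_gt0// ltr_wpDl.
have [p Hp] := H (`|l| / 2) K ltac:(by rewrite divr_gt0) K0.
have sub : `]p, p + K] `<=` `[p, p + K]%classic.
  by apply/subset_itvP; exact: subset_itv_oc_cc.
have : (`|l| ^+ 2 / 4) * K <= I.
  rewrite -[X in _ * X <= _](_ : p + K - p = K); last by ring.
  rewrite -(@Rint_itv R false false p (p + K)); last by rewrite lerDl ltW.
  have iI := intg_itv sub.
  rewrite -RintegralZl//; apply: le_Rint => //; first exact: intgZ.
  move=> x; rewrite indicE; case: (boolP (_ \in _)); rewrite ?mulr0 ?sqr_ge0// mulr1.
  rewrite inE/= in_itv/= => /Hp fl.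
  have : `|l| / 2 <= `|f x|.
    have : `|l| <= `|f x| + `|f x - l|.
      by rewrite -[X in `|X| <= _](_ : f x - (f x - l) = l); [exact: ler_normB|ring].
    by move: fl; lra.
  move=> lf; rewrite -(normr2 (f x)).
  rewrite (_ : `|l| ^+ 2 / 4 = (`|l| / 2) ^+ 2); last by field.
  by rewrite lerXn2r// nnegrE// divr_ge0.
have -> : `|l| ^+ 2 / 4 * K = I + 1 by rewrite /K; field; rewrite normr_eq0.
by rewrite gerDl ler10.
Qed.

Section representation.
Variables (nu : {charge set (measurableTypeR R) -> \bar R}) (u : R -> R).
Let P : {finite_measure set (measurableTypeR R) -> \bar R} := jordan_pos (hahn_proof nu).
Let N : {finite_measure set (measurableTypeR R) -> \bar R} := jordan_neg (hahn_proof nu).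

Lemma charge_integralE f : charge_integral nu f = dint P N f.
Proof. by []. Qed.

Lemma charge_tvE : charge_tv nu setT = (total_mass P N)%:E.
Proof.
rewrite /charge_tv /charge_variation /total_mass EFinD !fineK//.
- exact: fin_num_measure.
- exact: fin_num_measure.
Qed.

Hypotheses (u2 : L2 mu u) (unu : deriv_measure u nu).

(** The weak derivative tested with a cutoff whose derivative concentrates at p
    and at q. *)
Lemma deriv_measure_pts p q : p <= q -> lebesgue_pt u p -> lebesgue_pt u q ->
  u q - u p = dcdf P N q - dcdf P N p.
Proof.
move=> pq up uq; have lu := L2_locint u2.
rewrite dcdfB//.
have c1 : \int[mu]_x (u x * kern p n x) - \int[mu]_x (u x * kern q n x) @[n --> \oo]
    --> u p - u q by apply: cvgB; exact: kern_lim.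
have c2 : dint P N (cutoff p q n) @[n --> \oo] --> dint P N (\1_(`]p, q]%classic)).
  apply: (@dint_bounded_cvg _ _ _ _ _ 1).
  - move=> n; split; first exact: cutoff_meas.
    move=> x; apply: (le_trans (cutoff_bound n x pq)).
    by rewrite indicE; case: (_ \in _).
  - exact: measurable_indic.
  - by move=> x; exact: cvg_cutoff.
move: c1; under eq_fun => n.
  have := unu (test_function_cutoff n pq).
  under eq_Rintegral do rewrite derive1_cutoff mulrBr.
  rewrite RintegralB//; [|exact: locint_kern|exact: locint_kern].
  move=> ->; rewrite charge_integralE. over.
move=> c1; rewrite -[LHS]opprK opprB.
by rewrite (cvg_unique _ c1 (cvgN c2)) ?opprK//; exact: Rhausdorff.
Qed.

(** The difference of u and dcdf is a constant almost everywhere. It is 0 by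
    [L2_level], as dcdf is small near -oo; the same argument near +oo gives the
    total mass of Du. *)
Lemma bv_rep0 : dint P N (cst 1) = 0 /\ {ae mu, forall x, u x = dcdf P N x}.
Proof.
have lp := lebesgue_differentiation (L2_locint u2).
have [p0 [_ lp0]] := ae_itv_ex lp (@ltr01 R).
pose c := u p0 - dcdf P N p0.
have uE : {ae mu, forall x, u x = dcdf P N x + c}.
  apply: ae_imp lp => x lx; rewrite /c.
  have [xp|px] := leP x p0.
    by have := deriv_measure_pts xp lx lp0; lra.
  by have := deriv_measure_pts (ltW px) lp0 lx; lra.
have f2 : L2 mu (fun x => dcdf P N x + c).
  apply: (@L2_ae _ _ _ mu u) => //.
  by apply: measurable_funD => //; exact: dcdf_meas.
have c0 : c = 0.
  apply: (L2_level f2) => e K e0 K0.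
  have [n Hn] := tcdf_Ny P N e0.
  exists (- n%:R - K) => x; rewrite subrK => /andP[_ xn].
  rewrite addrK; apply: (le_trans (dcdf_le _ _ _)); apply: ltW.
  exact: le_lt_trans (tcdf_mono _ _ xn) Hn.
split; last by apply: ae_imp uE => x ->; rewrite c0 addr0.
apply: (L2_level f2) => e K e0 K0.
have [n Hn] := tcdf_y P N e0.
exists n%:R => x /andP[nx _].
rewrite c0 addr0 distrC; apply: (le_trans (dcdf_top _ _ _)).
have := tcdf_mono P N (ltW nx); lra.
Qed.

End representation.
End bv_representative.

Lemma cvg_le_near (R : realType) (f : nat -> R) (l c : R) : f @ \oo --> l ->
  (\forall n \near \oo, f n <= c) -> l <= c.
Proof.
move=> fl fc; rewrite leNgt; apply/negP => cl.
have H : \forall n \near \oo, c < f n by exact: (cvgr_gt _ fl).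
have [n [h1 h2]] := filter_ex (filterI H fc).
by have := lt_le_trans h1 h2; rewrite ltxx.
Qed.

Lemma seq_cvgN (R : realType) (f : nat -> R) (l : R) : f n @[n --> \oo] --> l ->
  - f n @[n --> \oo] --> - l.
Proof. exact: cvgN. Qed.

(** * Variation of finite sequences *)

Section variation_lemmas.
Context (R : realType).
Implicit Types (v w z : nat -> R) (n : nat).

(** The difference of id and a contraction is a contraction too, and their
    increments have the same sign: this is why variations split below. *)
Definition contraction (g : R -> R) := g 0 = 0 /\
  forall s t, s <= t -> 0 <= g t - g s <= t - s.

Lemma contractionB (g : R -> R) s t : contraction g ->
  `|s - t| = `|g s - g t| + `|(s - g s) - (t - g t)|.
Proof.
move=> [_ Hg]; have [st|ts] := leP s t.
  have /andP[g1 g2] := Hg _ _ st.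
  rewrite !ler0_norm; lra.
have /andP[g1 g2] := Hg _ _ (ltW ts).
rewrite !ger0_norm; lra.
Qed.

Lemma contraction_norm (g : R -> R) s : contraction g -> `|g s| <= `|s|.
Proof.
move=> cg; have := contractionB s 0 cg; rewrite cg.1 !subr0 => ->.
by rewrite lerDl.
Qed.

Lemma contraction_lip (g : R -> R) s t : contraction g -> `|g s - g t| <= `|s - t|.
Proof. by move=> cg; rewrite (contractionB s t cg) lerDl. Qed.

(** g and id - g are both nondecreasing, so that the absolute values of their
    increments add up. *)
Lemma var_split (g : R -> R) v n : contraction g ->
  var v n = var (g \o v) n + var (fun i => v i - g (v i)) n.
Proof.
move=> cg; rewrite /var /=.
have N s : `|s| = `|g s| + `|s - g s|.
  by have := contractionB s 0 cg; rewrite cg.1 !subr0.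
rewrite (N (v 0%N)) (N (v n)).
rewrite (eq_bigr (fun i : 'I_n => `|g (v i.+1) - g (v i)| +
  `|v i.+1 - g (v i.+1) - (v i - g (v i))|)).
  by rewrite big_split/=; lra.
by move=> i _; exact: contractionB.
Qed.

Lemma eq_var v w n : (forall i, (i <= n)%N -> v i = w i) -> var v n = var w n.
Proof.
move=> vw; rewrite /var !vw//; congr (_ + _ + _); apply: eq_bigr => i _.
by rewrite !vw// ltnW.
Qed.

Lemma varS v n : var v n <= var v n.+1.
Proof.
rewrite /var big_ord_recr/= -!addrA lerD2l lerD2l.
rewrite -[X in `|X| <= _](_ : v n.+1 - (v n.+1 - v n) = v n); last by ring.
by rewrite addrC; exact: ler_normB.
Qed.

Lemma var_mono v m n : (m <= n)%N -> var v m <= var v n.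
Proof.
move=> /subnK <-; elim: (n - m)%N => // k ih.
by rewrite addSn; apply: (le_trans ih); exact: varS.
Qed.

Lemma sum_dist v i j : (i <= j)%N ->
  \sum_(k < i) `|v k.+1 - v k| + `|v j - v i| <= \sum_(k < j) `|v k.+1 - v k|.
Proof.
move=> /subnK <-; elim: (j - i)%N => [|k ih]; first by rewrite subrr normr0 addr0.
rewrite addSn big_ord_recr/=.
have : `|v (k + i).+1 - v i| <= `|v (k + i).+1 - v (k + i)%N| + `|v (k + i)%N - v i|.
  by apply: le_trans (ler_normD _ _); rewrite subrKA.
move: ih; lra.
Qed.

Lemma var_peak v n i : (i <= n)%N -> 2 * v i <= var v n.
Proof.
move=> /(var_mono v); apply: le_trans.
have := sum_dist v (leq0n i); rewrite big_ord0 add0r /var => H.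
have := ler_norm (v i); have : `|v i| <= `|v i - v 0%N| + `|v 0%N|.
  by apply: le_trans (ler_normD _ _); rewrite subrK.
by move: H; lra.
Qed.

Lemma var_valley v n i j k : (i <= j)%N -> (j <= k)%N -> (k <= n)%N ->
  2 * v i - 2 * v j + 2 * v k <= var v n.
Proof.
move=> ij jk /(var_mono v); apply: le_trans.
have := sum_dist v (leq0n i); rewrite big_ord0 add0r /var => H0.
have H1 := sum_dist v ij; have H2 := sum_dist v jk.
have : `|v i| <= `|v i - v 0%N| + `|v 0%N|.
  by apply: le_trans (ler_normD _ _); rewrite subrK.
have := ler_norm (v i); have := ler_norm (v k).
have := ler_norm (v k - v j); have := ler_norm (- (v j - v i)); rewrite normrN.
by move: H0 H1 H2; lra.
Qed.

Lemma var_cutr v n (Q : nat -> bool) : (forall i, Q i.+1 -> Q i) ->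
  var (fun i => if Q i then v i else 0) n <= var v n.
Proof.
move=> HQ; elim: n => [|n ih].
  by rewrite /var !big_ord0; case: (Q 0%N); rewrite ?normr0// !addr0 addr_ge0.
have [Qn|nQn] := boolP (Q n.+1).
  have Qi i : (i <= n.+1)%N -> Q i.
    move=> /subnK E; move: Qn; rewrite -E; elim: (n.+1 - i)%N => // k ik.
    by rewrite addSn => /HQ.
  by rewrite (@eq_var _ v)// => i /Qi ->.
apply: le_trans (varS v n); apply: le_trans ih.
rewrite /var big_ord_recr/= (negbTE nQn) normr0 addr0 sub0r normrN.
by rewrite addrA.
Qed.

(** Replacing an initial segment by 0 turns the variation inside it into a single
    jump. *)
Lemma var_cutl v n (Q : nat -> bool) : (forall i, Q i -> Q i.+1) ->
  var (fun i => if Q i then v i else 0) n <= var v n.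
Proof.
move=> HQ; have Qm i j : (i <= j)%N -> Q i -> Q j.
  by move=> /subnK <-; elim: (j - i)%N => // k ik; rewrite addSn => /ik/HQ.
set w := fun i => _.
have H k : `|w 0%N| + \sum_(i < k) `|w i.+1 - w i| <= `|v 0%N| + \sum_(i < k) `|v i.+1 - v i|.
  elim: k => [|k ih].
    by rewrite !big_ord0 !addr0 /w; case: (Q _); rewrite ?normr0.
  rewrite !big_ord_recr/= !addrA.
  have [Qk|nQk] := boolP (Q k).
    have wk : w k = v k by rewrite /w Qk.
    have wk1 : w k.+1 = v k.+1 by rewrite /w (HQ _ Qk).
    by rewrite wk wk1 lerD2r.
  have w0 i : (i <= k)%N -> w i = 0.
    by move=> ik; rewrite /w ifF//; apply/negP => /(Qm _ _ ik); exact/negP.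
  rewrite w0// normr0 add0r big1 ?add0r; last first.
    by move=> i _; rewrite !w0 ?subrr ?normr0// ltnW.
  rewrite (w0 k)// subr0 /w; case: (Q _); last by rewrite normr0 !addr_ge0// sumr_ge0.
  have := sum_dist v (leq0n k.+1); rewrite big_ord0 add0r big_ord_recr/= => H.
  have : `|v k.+1| <= `|v k.+1 - v 0%N| + `|v 0%N|.
    by apply: le_trans (ler_normD _ _); rewrite subrK.
  by move: H; lra.
rewrite /var; apply: lerD => //.
by rewrite /w; case: (Q n); rewrite ?normr0.
Qed.

Lemma abel w z n : \sum_(i < n) w i.+1 * (z i.+1 - z i) =
  w n * z n - w 0%N * z 0%N - \sum_(i < n) z i * (w i.+1 - w i).
Proof.
elim: n => [|n ih]; first by rewrite !big_ord0 !subrr.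
rewrite !big_ord_recr/= ih; ring.
Qed.

(** Summation by parts moves the increments from z to w, and |z| <= 1. *)
Lemma abel_var w z n : (forall i, `|z i| <= 1) ->
  - \sum_(i < n) w i.+1 * (z i.+1 - z i) <= var w n.
Proof.
move=> z1; rewrite abel /var.
have H a i : a * z i <= `|a|.
  apply: (le_trans (ler_norm _)); rewrite normrM ler_piMr//.
have H' a i : - (a * z i) <= `|a|.
  apply: (le_trans (ler_norm _)); rewrite normrN normrM ler_piMr//.
have : \sum_(i < n) z i * (w i.+1 - w i) <= \sum_(i < n) `|w i.+1 - w i|.
  by apply: ler_sum => i _; rewrite mulrC; exact: H.
have := H (w 0%N) 0%N; have := H' (w n) n; lra.
Qed.

End variation_lemmas.

(** * Step functions on uniform grids *)

Section grid.
Context (R : realType).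
Implicit Types (L x : R) (n : nat) (h w : R -> R).

Definition grid L n (i : nat) : R := - L + i%:R * (2 * L / n.+1%:R).

Lemma grid0 L n : grid L n 0 = - L. Proof. by rewrite /grid mul0r addr0. Qed.

Lemma grid_last L n : grid L n n.+1 = L.
Proof. by rewrite /grid mulrC divfK// mulr_natl mulr2n addrA addNr add0r. Qed.

Lemma grid_step L n i : grid L n i.+1 = grid L n i + 2 * L / n.+1%:R.
Proof. by rewrite /grid -addrA -natr1 mulrDl mul1r. Qed.

Lemma grid_homo L n : 0 <= L -> {homo grid L n : i j / (i <= j)%N >-> i <= j}.
Proof.
move=> L0 i j ij; rewrite /grid lerD2l ler_wpM2r ?ler_nat//.
by rewrite divr_ge0// mulr_ge0.
Qed.

(** The Riemann step function of h on the grid, with h taken at the right end (b)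
    or at the left end (~~ b) of each cell. The right end suits right-continuous
    functions, and the pair of them suits summation by parts. *)
Definition gstep (b : bool) h L n x : R :=
  \sum_(i < n.+1) h (grid L n (i + b)) * \1_(`]grid L n i, grid L n i.+1]%classic) x.

Lemma grid_loc L n x : 0 <= L -> - L < x <= L ->
  exists i : 'I_n.+1, grid L n i < x <= grid L n i.+1.
Proof.
move=> L0 /andP[Lx xL].
have H k : (k <= n)%N -> x <= grid L n k.+1 ->
    exists i : 'I_n.+1, grid L n i < x <= grid L n i.+1.
  elim: k => [|k ih] kn xk.
    by exists ord0; rewrite grid0 Lx.
  have [xk'|kx] := leP x (grid L n k.+1); first by apply: ih => //; exact: ltnW.
  by exists (Ordinal (kn : (k.+1 < n.+1)%N)); rewrite kx.
by apply: (H n) => //; rewrite grid_last.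
Qed.

Lemma gstepE b h L n x (i : 'I_n.+1) : 0 <= L ->
  grid L n i < x <= grid L n i.+1 -> gstep b h L n x = h (grid L n (i + b)).
Proof.
move=> L0 /andP[ix xi]; rewrite /gstep (bigD1 i)//= indicE mem_set ?mulr1; last first.
  by rewrite /= in_itv/= ix.
rewrite big1 ?addr0// => j ji; rewrite indicE memNset ?mulr0//= in_itv/=.
move=> /andP[jx xj]; move/eqP: ji; apply; apply/val_inj => /=.
apply/eqP; rewrite eqn_leq; apply/andP; split; rewrite leqNgt; apply/negP => ij.
  by have := lt_le_trans jx (le_trans xi (grid_homo n L0 ij)); rewrite ltxx.
by have := lt_le_trans ix (le_trans xj (grid_homo n L0 ij)); rewrite ltxx.
Qed.

Lemma gstep_out b h L n x : 0 <= L -> ~~ (- L < x <= L) -> gstep b h L n x = 0.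
Proof.
move=> L0 xL; rewrite /gstep big1// => i _.
rewrite indicE memNset ?mulr0//= in_itv/= => /andP[ix xi].
move/negP: xL; apply; apply/andP; split.
  by apply: le_lt_trans ix; rewrite -(grid0 L n); exact: grid_homo.
by apply: (le_trans xi); rewrite -[leRHS](grid_last L n); exact: grid_homo.
Qed.

Lemma gstep_bound b h L n x C : 0 <= L -> 0 <= C -> (forall y, `|h y| <= C) ->
  `|gstep b h L n x| <= C * \1_(`]- L, L]%classic) x.
Proof.
move=> L0 C0 hC; have [xL|xL] := boolP (- L < x <= L).
  have [i ix] := grid_loc n L0 xL.
  by rewrite (gstepE _ _ L0 ix) indicE mem_set ?mulr1//= in_itv.
by rewrite gstep_out// normr0 mulr_ge0.
Qed.

Lemma gstep_meas b h L n : measurable_fun setT (gstep b h L n).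
Proof.
by apply: measurable_sum => i; apply: measurable_funM.
Qed.

Lemma mesh_cvg L : (2 * L / n.+1%:R : R) @[n --> \oo] --> 0.
Proof.
rewrite -[X in _ --> X](mulr0 (2 * L)); apply: cvgMr; exact: cvg_harmonic.
Qed.

Lemma gstep_cvg (b : bool) h L x : 0 <= L -> - L < x <= L ->
  (if b then rcs h else {for x, continuous h}) ->
  gstep b h L n x @[n --> \oo] --> h x.
Proof.
move=> L0 xL hb.
have H n : exists i : 'I_n.+1, grid L n i < x <= grid L n i.+1 by exact: grid_loc.
pose I n := projT1 (cid (H n)).
have HI n : grid L n (I n) < x <= grid L n (I n).+1 by rewrite /I; case: cid.
have E n : gstep b h L n x = h (grid L n (I n + b)) by exact: gstepE.
under eq_fun do rewrite E.
have c1 : grid L n (I n + b) @[n --> \oo] --> x.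
  apply: (@squeeze_cvgr _ _ _ _ (fun n => x - 2 * L / n.+1%:R) (fun n => x + 2 * L / n.+1%:R)).
  - apply: nearW => n; have := HI n; rewrite grid_step.
    have := grid_homo n L0 (leqnSn (I n)); rewrite grid_step.
    by case: (b); rewrite ?addn1 ?addn0 ?grid_step; move: (grid _ _ _) (_ / _) => A B; lra.
  - by rewrite -[X in _ --> X]subr0; apply: cvgB; [exact: cvg_cst|exact: mesh_cvg].
  - by rewrite -[X in _ --> X]addr0; apply: cvgD; [exact: cvg_cst|exact: mesh_cvg].
case: b hb E c1 => hb E c1; last exact: (cvg_comp _ _ c1 hb).
apply: hb => // n; rewrite addn1; by have /andP[] := HI n.
Qed.

End grid.

(** * Variation and primitives bounded by 1 *)

Section abel_summation.
Context (R : realType).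
Local Notation mu := (@lebesgue_measure R).
Variables (z zx : R -> R).
Hypotheses (z1 : forall x, `|z x| <= 1) (zx2 : L2 mu zx).
Hypothesis zE : forall p q, p <= q -> z q - z p = \int[mu]_x (\1_(`]p, q]%classic) x * zx x).

Lemma Rint_gstep h L n : 0 <= L -> \int[mu]_x (gstep true h L n x * zx x) =
  \sum_(i < n.+1) h (grid L n i.+1) * (z (grid L n i.+1) - z (grid L n i)).
Proof.
move=> L0.
have lzx := L2_locint zx2.
have I0 i : intg mu (fun x => \1_(`]grid L n i, grid L n i.+1]%classic) x * zx x).
  apply: (locint_intg lzx (a := grid L n i) (b := grid L n i.+1)).
  by apply/subset_itvP; exact: subset_itv_oc_cc.
have I1 (i : 'I_n.+1) : intg mu (fun x => h (grid L n i.+1) * (\1_(`]grid L n i, grid L n i.+1]%classic) x * zx x)).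
  exact: intgZ.
transitivity (\int[mu]_x (\sum_(i < n.+1)
    h (grid L n i.+1) * (\1_(`]grid L n i, grid L n i.+1]%classic) x * zx x))).
  apply: eq_Rintegral => x _; rewrite /gstep mulr_suml; apply: eq_bigr => i _.
  by rewrite addn1 mulrA.
rewrite (@Rint_sum _ _ _ mu)//; apply: eq_bigr => i _.
by rewrite RintegralZl// zE//; exact: grid_homo.
Qed.

Lemma gstep_lim h L C : 0 <= L -> rcs h -> measurable_fun setT h ->
  (forall x, `|h x| <= C) ->
  \int[mu]_x (gstep true h L n x * zx x) @[n --> \oo] -->
  \int[mu]_x (\1_(`]- L, L]%classic) x * h x * zx x).
Proof.
move=> L0 hr mh hC; have C0 : 0 <= C := le_trans (normr_ge0 _) (hC 0).
have lzx := L2_locint zx2; have [mzx _ _] := lzx.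
have mI := indic_itv_meas `]- L, L].
apply: (@dctR _ _ _ mu _ _ (fun x => C * `|\1_(`]- L, L]%classic) x * zx x|)).
- by move=> n; apply: measurable_funM => //; exact: gstep_meas.
- by do 2 (apply: measurable_funM => //).
- apply: nearW => x; apply: cvgM; last exact: cvg_cst.
  rewrite indicE; have [xL|xL] := boolP (- L < x <= L).
    by rewrite mem_set ?mul1r//=; exact: gstep_cvg.
  rewrite memNset ?mul0r//=; last by rewrite in_itv/=; exact/negP.
  by apply: cvg_near_cst; apply: nearW => n; exact: gstep_out.
- apply/intgZ/intg_norm; apply: (locint_intg lzx (a := - L) (b := L)).
  by apply/subset_itvP; exact: subset_itv_oc_cc.
- move=> n x; rewrite !normrM mulrA ler_wpM2r// (ger0_norm (_ : 0 <= \1__ x))//.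
  exact: gstep_bound.
Qed.

Lemma cvg_indic_sym (x : R) : \1_(`]- (n%:R : R), n%:R]%classic) x @[n --> \oo] --> (1 : R).
Proof.
apply: cvg_near_cst; have h1 := nbhs_infty_gtr x; have h2 := nbhs_infty_gtr (- x).
near=> n; rewrite indicE mem_set//= in_itv/=; apply/andP; split.
  by rewrite ltrNl; near: n.
by apply: ltW; near: n.
Unshelve. all: by end_near. Qed.

Lemma window_lim h : L2 mu h ->
  \int[mu]_x (\1_(`]- n%:R, n%:R]%classic) x * h x * zx x) @[n --> \oo] -->
  \int[mu]_x (h x * zx x).
Proof.
move=> h2; have hz := L2_mul h2 zx2.
apply: (@dctR _ _ _ mu _ _ (fun x => `|h x * zx x|)).
- move=> n; apply: measurable_funM; last exact: zx2.1.
  by apply: measurable_funM; [exact: measurable_indic|exact: h2.1].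
- exact: intg_meas hz.
- apply: nearW => x; apply: cvgM; last exact: cvg_cst.
  by rewrite -[X in _ --> X]mul1r; apply: cvgM; [exact: cvg_indic_sym|exact: cvg_cst].
- exact: intg_norm.
- move=> n x; rewrite -mulrA normrM ler_piMl//.
  by rewrite indicE; case: (_ \in _); rewrite ?normr1 ?normr0.
Qed.

(** Riemann sums of int w dz are summed by parts; z is bounded by 1. *)
Lemma calibration_le (w : R -> R) (C c : R) : rcs w -> L2 mu w ->
  (forall x, `|w x| <= C) ->
  (\forall l \near \oo, \forall n \near \oo,
    var (w \o grid l%:R n) n.+1 <= c) ->
  - (\int[mu]_x (w x * zx x)) <= c.
Proof.
move=> wr w2 wC Hc.
have H (l : nat) : (\forall n \near \oo, var (w \o grid l%:R n) n.+1 <= c) ->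
    - (\int[mu]_x (\1_(`]- l%:R, l%:R]%classic) x * w x * zx x)) <= c.
  move=> Hl; have cv := gstep_lim (ler0n R l) wr w2.1 wC.
  have cv' := seq_cvgN cv.
  apply: (cvg_le_near cv').
  apply: filterS Hl => n; apply: le_trans.
  by rewrite Rint_gstep//; apply: (abel_var (w \o grid l%:R n) (z := z \o grid l%:R n)) => i; exact: z1.
apply: (cvg_le_near (seq_cvgN (window_lim w2))).
by apply: filterS Hc => l; exact: H.
Qed.

End abel_summation.

Section integration_by_parts.
Context (R : realType).
Local Notation mu := (@lebesgue_measure R).
Variables (z zx : R -> R).
Hypotheses (z1 : forall x, `|z x| <= 1) (zx2 : L2 mu zx) (cz : continuous z).
Hypothesis zE : forall p q, p <= q -> z q - z p = \int[mu]_x (\1_(`]p, q]%classic) x * zx x).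
Variables P N : {finite_measure set (measurableTypeR R) -> \bar R}.
Hypothesis PN0 : dint P N (cst 1) = 0.
Local Notation U := (dcdf P N).
Hypothesis U2 : L2 mu U.

Lemma dcdf_bound x : `|U x| <= total_mass P N.
Proof.
apply: (le_trans (dcdf_le _ _ _)); rewrite -subr_ge0.
exact: le_trans (dcdf_top P N x).
Qed.

Lemma dint_gstep L n : 0 <= L -> dint P N (gstep false z L n) =
  \sum_(i < n.+1) z (grid L n i) * (U (grid L n i.+1) - U (grid L n i)).
Proof.
move=> L0; rewrite (@dint_sum _ _ _ _ _ 1) => [|i].
  apply: eq_bigr => i _; rewrite addn0 (@dintZ _ _ _ _ _ 1) ?dcdfB//.
    exact: grid_homo.
  by apply: bdd_meas_indic.
split; first by apply: measurable_funM => //; exact: measurable_indic.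
move=> x; rewrite normrM -[leRHS]mulr1; apply: ler_pM => //.
by have [_] := @bdd_meas_indic R _ (measurable_itv `]grid L n i, grid L n i.+1]); exact.
Qed.

(** Summation by parts on a grid, in which the left end for z and the right end
    for U are what makes both Riemann sums converge. *)
Lemma parts_window L : 0 <= L ->
  dint P N (fun x => \1_(`]- L, L]%classic) x * z x) =
  U L * z L - U (- L) * z (- L) - \int[mu]_x (\1_(`]- L, L]%classic) x * U x * zx x).
Proof.
move=> L0.
have mI := indic_itv_meas `]- L, L].
have mz : measurable_fun setT z by exact: continuous_measurable_fun.
have c1 : dint P N (gstep false z L n) @[n --> \oo] -->
    dint P N (fun x => \1_(`]- L, L]%classic) x * z x).
  apply: (@dint_bounded_cvg _ _ _ _ _ 1).
  - move=> n; split; first exact: gstep_meas.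
    move=> x; apply: (le_trans (gstep_bound false n x L0 ler01 z1)).
    by rewrite mul1r indicE; case: (_ \in _).
  - exact: measurable_funM.
  - move=> x; rewrite indicE; have [xL|xL] := boolP (- L < x <= L).
      rewrite mem_set ?mul1r//=.
      by apply: gstep_cvg => //; exact: cz.
    rewrite memNset ?mul0r//=; last by rewrite in_itv/=; exact/negP.
    by apply: cvg_near_cst; apply: nearW => n; exact: gstep_out.
have c2 := gstep_lim zx2 L0 (@dcdf_rcs R P N) (@dcdf_meas R P N) dcdf_bound.
have c3 : (U L * z L - U (- L) * z (- L)) - \int[mu]_x (gstep true U L n x * zx x)
    @[n --> \oo] --> U L * z L - U (- L) * z (- L) -
    \int[mu]_x (\1_(`]- L, L]%classic) x * U x * zx x).
  exact: (cvgB (cvg_cst _) c2).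
apply: (cvg_unique _ c1); first exact: Rhausdorff.
apply: cvg_trans c3; apply: near_eq_cvg; apply: nearW => n /=.
rewrite (Rint_gstep zx2 zE)// dint_gstep//.
rewrite (@abel _ (U \o grid L n) (z \o grid L n)) /= grid0 grid_last.
by rewrite opprB addrC subrK.
Qed.

(** The boundary terms on large windows vanish because U is small at infinity. *)
Lemma parts : dint P N z = - \int[mu]_x (U x * zx x).
Proof.
have mz : measurable_fun setT z by exact: continuous_measurable_fun.
have c1 : dint P N (fun x => \1_(`]- (l%:R : R), l%:R]%classic) x * z x) @[l --> \oo] -->
    dint P N z.
  apply: (@dint_bounded_cvg _ _ _ _ _ 1) => //.
  - move=> n; split; first by apply: measurable_funM => //; exact: measurable_indic.
    move=> x; apply: le_trans (z1 x); rewrite normrM ler_piMl//.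
    by rewrite indicE; case: (_ \in _); rewrite ?normr1 ?normr0.
  - move=> x; rewrite -[X in _ --> X]mul1r; apply: cvgM; last exact: cvg_cst.
    exact: cvg_indic_sym.
have bdry : U l%:R * z l%:R - U (- l%:R) * z (- l%:R) @[l --> \oo] --> (0 : R).
  apply/cvgr0Pnorm_le => e e0; have e2 : 0 < e / 2 by exact: divr_gt0.
  have [n Hn] := tcdf_Ny P N e2; have [m Hm] := tcdf_y P N e2.
  near=> l.
  have nl : (n%:R : R) <= l%:R by rewrite ler_nat; near: l; exact: nbhs_infty_ge.
  have ml : (m%:R : R) <= l%:R by rewrite ler_nat; near: l; exact: nbhs_infty_ge.
  have H1 : `|U l%:R| <= e / 2.
    have := dcdf_top P N l%:R; rewrite PN0 sub0r normrN.
    have := tcdf_mono P N ml; move: Hm; lra.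
  have H2 : `|U (- l%:R)| <= e / 2.
    have nl' : - l%:R <= - n%:R :> R by rewrite lerN2.
    have := tcdf_mono P N nl'; have := dcdf_le P N (- l%:R); move: Hn; lra.
  apply: (le_trans (ler_normB _ _)); rewrite !normrM.
  have H3 : `|U l%:R| * `|z l%:R| <= `|U l%:R| by rewrite ler_piMr.
  have H4 : `|U (- l%:R)| * `|z (- l%:R)| <= `|U (- l%:R)| by rewrite ler_piMr.
  move: H1 H2 H3 H4; lra.
have c2 : (U l%:R * z l%:R - U (- l%:R) * z (- l%:R)) -
    \int[mu]_x (\1_(`]- (l%:R : R), l%:R]%classic) x * U x * zx x) @[l --> \oo] -->
    - \int[mu]_x (U x * zx x).
  by rewrite -[X in _ --> X]sub0r; exact: (cvgB bdry (window_lim zx2 U2)).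
apply: (cvg_unique _ c1); first exact: Rhausdorff.
apply: cvg_trans c2; apply: near_eq_cvg; apply: nearW => l /=.
by rewrite parts_window.
Unshelve. all: by end_near. Qed.

End integration_by_parts.

(** * Integrals of nonmeasurable functions *)

Section squeeze.
Context d (T : measurableType d) (R : realType).
Variable m : {measure set T -> \bar R}.
Import HBNNSimple.

Lemma le_integral_nonmeas (D : set T) (f g : T -> \bar R) :
  (forall x, D x -> 0 <= f x)%E -> (forall x, D x -> f x <= g x)%E ->
  (\int[m]_(x in D) f x <= \int[m]_(x in D) g x)%E.
Proof.
move=> f0 fg; have g0 x : D x -> (0 <= g x)%E by move=> Dx; rewrite (le_trans (f0 _ Dx)) ?fg.
rewrite !ge0_integralE//; apply: le_ereal_sup => _ [h /= hf <-]; exists h => // x.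
apply: (le_trans (hf x)); rewrite /patch; case: ifPn => //; rewrite inE; exact: fg.
Qed.

(** No measurability of f is assumed: the integral is a supremum over simple
    functions, which are themselves measurable, so the null set can be removed
    from each of them. *)
Lemma integral_drop_null (D N0 : set T) (f : T -> \bar R) :
  measurable N0 -> m N0 = 0%E ->
  (\int[m]_(x in D) f x = \int[m]_(x in D `\` N0) f x)%E.
Proof.
move=> mN N00.
have H (g : T -> \bar R) : (forall x, 0 <= g x)%E ->
    (\int[m]_(x in D) g x = \int[m]_(x in D `\` N0) g x)%E.
  move=> g0; apply/eqP; rewrite eq_le; apply/andP; split; last first.
    rewrite (integral_mkcond D) (integral_mkcond (_ `\` _)).
    apply: le_integral_nonmeas => x _; rewrite /patch.
      by case: ifPn.
    case: ifPn => [|_]; last by case: ifPn.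
    by rewrite inE => -[Dx _]; rewrite ifT// inE.
  rewrite [leLHS]ge0_integralE//; apply: ge_ereal_sup => _ [h /= hf <-].
  have mC : measurable (~` N0) by exact: measurableC.
  have E : sintegral m h = sintegral m (proj_nnsfun h mC).
    rewrite -mrestrict -integral_nnsfun// -setTD.
    rewrite -(@ge0_negligible_integral _ _ _ m setT N0 (EFin \o h))//.
    - by rewrite integral_nnsfun// patch_setT.
    - by apply/measurable_EFinP.
    - by move=> x _; rewrite lee_fin.
  rewrite E ge0_integralE//; apply: ereal_sup_ubound; exists (proj_nnsfun h mC) => // x.
  rewrite -mrestrict; have := hf x; rewrite /patch.
  have [Nx|nN] := pselect (N0 x).
    have -> : (x \in ~` N0) = false by apply/negbTE; rewrite notin_setE; exact.
    by move=> _; case: (_ \in _).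
  have -> : (x \in ~` N0) = true by exact: mem_set.
  have -> : (x \in D `\` N0) = (x \in D) by apply/idP/idP; rewrite !inE => // -[].
  by [].
by rewrite [LHS]integralE [RHS]integralE !H.
Qed.

(** A is the only measurable function among f, A and B, and it is below B. As the
    integrals coincide, A dominates every measurable function below B. This is
    applied to the total variation of Du(t), whose measurability in t is not
    known. *)
Lemma integral_squeeze (D N0 : set T) (f A : T -> R) (B : T -> \bar R)
    (V : nat -> T -> R) (M : R) :
  measurable D -> (m D < +oo)%E -> measurable N0 -> m N0 = 0%E ->
  measurable_fun (D `\` N0) A -> (forall i, measurable_fun (D `\` N0) (V i)) ->
  (forall t, (D `\` N0) t -> [/\ f t = A t, (`|A t|%:E <= B t)%E,
     (B t <= M%:E)%E & forall i, ((V i t)%:E <= B t)%E]) ->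
  (forall t, 0 <= B t)%E ->
  (\int[m]_(t in D) (f t)%:E = \int[m]_(t in D) B t)%E ->
  {ae m, forall t, D t -> forall i, V i t <= A t}.
Proof.
move=> mD Dfin mN N00 mA mV H B0 fB; set E := D `\` N0 in mA mV H *.
have mE : measurable E by exact: measurableD.
have Efin : (m E < +oo)%E.
  by apply: le_lt_trans Dfin; apply: le_measure; rewrite ?inE//; exact: subDsetl.
have IE (h : T -> R) : measurable_fun E h -> (forall t, E t -> `|h t| <= M) ->
    intg m (h \_ E).
  move=> mh hM.
  have H1 : intg m (fun x => `|M| * \1_E x).
    apply: intgZ; apply: (@intg_dom _ _ _ _ _ _ _ (L2_indic mE Efin).2) => //.
    by move=> x; rewrite indicE; case: (_ \in _); rewrite ?normr1 ?normr0 expr2 ?mulr1 ?mulr0.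
  apply: (@intg_dom _ _ _ _ _ _ _ H1) => [|x]; first exact/(measurable_restrictT _ mE).
  rewrite /patch indicE; case: ifPn => [|_]; last by rewrite normr0 mulr0.
  by rewrite inE mulr1 => /hM h1; rewrite (le_trans h1)// ler_norm.
have AM t : E t -> `|A t| <= M.
  by move=> /H[_ h1 h2 _]; rewrite -lee_fin (le_trans h1).
have key i : {ae m, forall t, (D t -> V i t <= A t)}.
  (* W is measurable and A <= W <= B *)
  pose W t := Order.max (V i t) `|A t|.
  have mW : measurable_fun E W by apply: measurable_maxr => //; exact: measurableT_comp.
  have WB t : E t -> ((W t)%:E <= B t)%E.
    by move=> /H[_ h1 h2 /(_ i) h3]; rewrite /W EFin_max ge_max h3 h1.
  have W0 t : 0 <= W t by rewrite /W le_max normr_ge0 orbT.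
  have WM t : E t -> `|W t| <= M.
    by move=> Et; rewrite ger0_norm// -lee_fin (le_trans (WB _ Et))//; have [] := H _ Et.
  have iA := IE _ mA AM; have iW := IE _ mW WM.
  have e1 : (\int[m]_(t in D) (f t)%:E = (\int[m]_t ((A \_ E) t))%:E)%E.
    rewrite (integral_drop_null _ _ mN N00) -/E.
    rewrite (@eq_integral _ _ _ _ _ (EFin \o A)); last first.
      by move=> t; rewrite inE => /H[-> _ _ _].
    by rewrite integral_mkcond restrict_EFin /Rintegral fineK//; exact: integrable_fin_num.
  have e2 : ((\int[m]_t ((W \_ E) t))%:E <= \int[m]_(t in D) B t)%E.
    rewrite (integral_drop_null _ _ mN N00) -/E.
    rewrite /Rintegral fineK; last exact: integrable_fin_num.
    rewrite [X in (X <= _)%E](_ : _ = \int[m]_(t in E) (W t)%:E)%E; last first.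
      by rewrite [RHS]integral_mkcond restrict_EFin.
    apply: le_integral_nonmeas => // t Et.
    by rewrite lee_fin.
  have le0 : \int[m]_t ((W \_ E) t - (A \_ E) t) <= 0.
    by rewrite RintegralB// subr_le0 -lee_fin -e1 fB.
  have a0 : {ae m, forall t, (W \_ E) t - (A \_ E) t = 0}.
    apply: Rint_eq0_ae le0; first exact: intgB.
    apply: aeW => t; rewrite /patch; case: ifPn => _; last by rewrite subrr.
    by rewrite subr_ge0 /W le_max ler_norm orbT.
  have aN : {ae m, forall t, ~ N0 t}.
    by exists N0; split => // t /= /contrapT.
  apply: ae_imp (ae_and a0 aN) => t [WA nN] Dt.
  have Et : t \in E by rewrite inE; split.
  move: WA; rewrite /patch Et.
  by move/eqP; rewrite subr_eq0 => /eqP <-; rewrite /W le_max lexx.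
by apply: ae_imp (ae_all key) => t Ht Dt i; exact: Ht.
Qed.

End squeeze.

(** * The flow at almost every time *)

Section slices.
Context (R : realType).
Local Notation mu := (@lebesgue_measure R).
Local Notation mu2 := (mu \x mu)%E.
Local Notation pos := (`]0, +oo[%classic : set R).
Implicit Types (f g u z : R -> R -> R).

Lemma strip_patch f (I : set R) (p : R * R) :
  ((fun p => f p.1 p.2) \_ (strip I)) p = \1_I p.1 * f p.1 p.2.
Proof.
rewrite /patch indicE /strip; have [pI|pI] := boolP (p.1 \in I).
  by rewrite ifT ?mul1r// inE; split => //=; move: pI; rewrite inE.
by rewrite ifF ?mul0r//; apply/negbTE; apply: contra pI; rewrite !inE => -[].
Qed.

Lemma strip_meas f (i : interval R) :
  measurable_fun (strip [set` i]) (fun p => f p.1 p.2) ->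
  measurable_fun setT (fun p : R * R => \1_[set` i] p.1 * f p.1 p.2).
Proof.
move=> mf; rewrite (_ : (fun _ => _) = (fun p => f p.1 p.2) \_ (strip [set` i])); last first.
  by apply/funext => p; rewrite strip_patch.
by apply/(measurable_restrictT _ (measurableX (measurable_itv i) measurableT)).
Qed.

Lemma indic_mul_sub (i j : interval R) t (y : R) : [set` i] `<=` [set` j] ->
  \1_[set` i] t * (\1_[set` j] t * y) = \1_[set` i] t * y.
Proof.
move=> ij; rewrite !indicE; case: (boolP (t \in [set` i])) => [|_]; last by rewrite !mul0r.
by rewrite inE => /ij tj; rewrite (mem_set tj) !mul1r.
Qed.

Lemma pos_meas f (i : interval R) : pos `<=` [set` i] ->
  measurable_fun (strip [set` i]) (fun p => f p.1 p.2) ->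
  measurable_fun setT (fun p : R * R => \1_pos p.1 * f p.1 p.2).
Proof.
move=> ij mf; rewrite (_ : (fun _ => _) = (fun p => \1_pos p.1 * (\1_[set` i] p.1 * f p.1 p.2))).
  apply: measurable_funM; last exact: strip_meas.
  by apply: (measurableT_comp (indic_itv_meas _)).
by apply/funext => p; rewrite indic_mul_sub.
Qed.

Lemma L2loc_pos_meas f : L2loc_L2 f ->
  measurable_fun setT (fun p : R * R => \1_pos p.1 * f p.1 p.2).
Proof.
move=> [mf _]; apply: pos_meas mf; apply/subset_itvP.
by apply: subset_itvr; rewrite bnd_simp.
Qed.

Lemma L2loc_meas_t f t : L2loc_L2 f -> 0 <= t -> measurable_fun setT (f t).
Proof.
move=> [mf _] t0; have := measurable_section t (strip_meas mf).
rewrite (_ : (fun x => _) = f t)//; apply/funext => x /=.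
by rewrite indicE mem_set ?mul1r//= in_itv/= t0.
Qed.

Lemma L2loc_cut f tau : L2loc_L2 f -> 0 < tau ->
  L2 mu2 (fun p : R * R => \1_(`[0, tau]%classic) p.1 * f p.1 p.2).
Proof.
move=> [mf f2] tau0; have := f2 _ tau0.
rewrite (_ : _ \_ _ = (fun p : R * R => \1_(`[0, tau]%classic) p.1 * f p.1 p.2)); last first.
  by apply/funext => p; rewrite strip_patch.
apply: finite_norm_L2; apply: strip_meas; apply: measurable_funS mf => //.
  exact: measurableX.
by move=> [t x] /= [h _]; split => //=; move: h => /=; rewrite !in_itv/= => /andP[->].
Qed.

Lemma box_L2 tau K : 0 < tau -> 0 < K -> L2 mu2 (box tau K : R * R -> R).
Proof.
move=> tau0 K0; apply: (L2_tensor (m1 := mu) (m2 := mu)).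
  exact: L2_bnd.
exact: L2_bnd.
Qed.

Lemma L2loc_box f : L2loc_L2 f -> box_intg f.
Proof.
move=> Lf; split => [|tau K tau0 K0]; first exact: L2loc_pos_meas.
have := L2_mul (box_L2 tau0 K0) (L2loc_cut Lf tau0).
congr (_.-integrable _ _); apply/funext => p /=; congr EFin.
rewrite /box ![\1_(`]0, tau]%classic) _ * _]mulrC -!mulrA indic_mul_sub//.
exact: subset_itv_oc_cc.
Qed.

(** The truncation F agrees with f at almost every point and is bounded at all
    of them. *)
Lemma bounded_box f : measurable_fun (strip pos) (fun p => f p.1 p.2) ->
  {ae mu2, forall p, 0 < p.1 -> `|f p.1 p.2| <= 1} -> box_intg f.
Proof.
move=> mf f1; have mf' := pos_meas (@subset_refl _ _) mf.
split => // tau K tau0 K0.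
have bi : intg mu2 (box tau K : R * R -> R).
  by apply: intg_tensor; exact: intg_bnd.
pose F (p : R * R) := Order.max (- 1) (Order.min 1 (\1_pos p.1 * f p.1 p.2)).
have mF : measurable_fun setT F.
  by apply: measurable_maxr => //; apply: measurable_minr.
have F1 p : `|F p| <= 1.
  rewrite ler_norml /F le_max lexx/= ge_max; apply/andP; split; first by rewrite lerNl; lra.
  by rewrite ge_min lexx.
apply: (@intg_ae _ _ _ mu2 (fun p => box tau K p * F p)).
- rewrite (_ : (fun _ => _) = (fun p => box tau K p * (\1_pos p.1 * f p.1 p.2))).
    by apply: measurable_funM => //; exact: (intg_meas bi).
  by apply/funext => p; rewrite box_pos.
- apply: ae_imp f1 => p f1; rewrite box_pos /box !indicE.
  have [p0|np] := boolP (p.1 \in pos); last first.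
    by rewrite /F indicE (negbTE np) !mul0r min_r// max_r// lerN10.
  move: p0; rewrite inE/= in_itv/= andbT => p0.
  have E : \1_pos p.1 = 1 :> R by rewrite indicE mem_set//= in_itv/= p0.
  rewrite /F E !mul1r; congr (_ * _).
  have := f1 p0; rewrite ler_norml => /andP[h1 h2].
  by rewrite min_r// max_r.
- apply: (@intg_dom _ _ _ mu2 (fun p => `|box tau K p|)).
  + by apply: measurable_funM => //; exact: (intg_meas bi).
  + exact: intg_norm.
  + by move=> p; rewrite normrM ler_piMr.
Qed.

Lemma L2loc_slice f : L2loc_L2 f -> {ae mu, forall t, 0 < t -> L2 mu (f t)}.
Proof.
move=> Lf.
have H (n : nat) : {ae mu, forall t, L2 mu (fun x => \1_(`[0, n.+1%:R]%classic) t * f t x)}.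
  by apply: ae_imp (L2_section (L2loc_cut Lf (ltr0Sn _ n))).
apply: ae_imp (ae_all H) => t Ht t0.
have := Ht (Num.bound t); rewrite (_ : (fun x => _) = f t)//; apply/funext => x.
rewrite indicE mem_set ?mul1r//= in_itv/= ltW//=.
have := archi_boundP (ltW t0); move/ltW/le_trans; apply.
by rewrite ler_nat.
Qed.

Lemma continuous_ae_le1 (z : R -> R) : continuous z ->
  {ae mu, forall x, `|z x| <= 1} -> forall x, `|z x| <= 1.
Proof.
move=> cz z1 x; rewrite leNgt; apply/negP => h.
have cN : {for x, continuous (fun y => `|z y|)}.
  by apply: continuous_comp; [exact: cz|exact: norm_continuous].
have /nbhs_ballP [e /= e0 He] : \forall y \near x, 1 < `|z y|.
  exact: (cvgr_gt _ cN).
have /(ae_itv_ex z1) [y [/andP[xy yx] zy]] : x < x + e by rewrite ltrDl.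
have : 1 < `|z y|.
  apply: He; rewrite /ball/= ltr0_norm ?subr_lt0//.
  by lra.
by rewrite ltNge zy.
Qed.

Definition regular_slice (ut zx z : R -> R) := [/\ L2 mu zx,
  {ae mu, forall x, ut x = zx x}, continuous z, forall x, `|z x| <= 1 &
  forall p q, p <= q -> z q - z p = \int[mu]_x (\1_(`]p, q]%classic) x * zx x)].

(** The identities of [weak_deriv_x] for rational endpoints hold outside of a
    common null set of times, hence [weak_primitive] applies at all other times. *)
Lemma ae_regular_slice (ut z zx : R -> R -> R) :
  measurable_fun (strip pos) (fun p => z p.1 p.2) ->
  {ae mu2, forall p, 0 < p.1 -> `|z p.1 p.2| <= 1} ->
  {ae mu, forall t : R, 0 < t -> continuous (z t)} ->
  L2loc_L2 zx -> weak_deriv (0, 1) z zx ->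
  {ae mu2, forall p, 0 < p.1 -> ut p.1 p.2 = zx p.1 p.2} ->
  {ae mu, forall t, 0 < t -> regular_slice (ut t) (zx t) (z t)}.
Proof.
move=> mz z1 cz Lzx dz utzx.
have wd : {ae mu, forall t, 0 < t -> forall (r s : rat) k, r <= s ->
    \int[mu]_x (z t x * (kern (ratr r) k x - kern (ratr s) k x)) =
     - \int[mu]_x (zx t x * cutoff (ratr r) (ratr s) k x)}.
  pose P n t := if (unpickle n : option (rat * rat * nat)) is Some w then
    (0 < t -> w.1.1 <= w.1.2 ->
    \int[mu]_x (z t x * (kern (ratr w.1.1) w.2 x - kern (ratr w.1.2) w.2 x)) =
     - \int[mu]_x (zx t x * cutoff (ratr w.1.1) (ratr w.1.2) w.2 x)) else True.
  have HP n : {ae mu, forall t, P n t}.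
    rewrite /P; case: unpickle => [[[r s] k]|]; last exact: aeW.
    have [rs|rs] := leP r s; last first.
      by apply: aeW.
    have rs' : ratr r <= (ratr s : R) by rewrite ler_rat.
    have := weak_deriv_x k (bounded_box mz z1) (L2loc_box Lzx) dz rs'.
    by apply: ae_imp => t /= H t0 _; exact: H.
  apply: ae_imp (ae_all HP) => t Ht t0 r s k rs.
  by have := Ht (pickle (r, s, k)); rewrite /P pickleK; exact.
have := ae_and (ae_and wd cz) (ae_and (L2loc_slice Lzx) (ae_and (ae_section z1) (ae_section utzx))).
apply: ae_imp => t [[wt ct] [Lt [zt ut_t]]] t0.
have ct' := ct t0; split.
- exact: Lt.
- by apply: ae_imp ut_t => x; exact.
- by [].
- by apply: continuous_ae_le1 => //; apply: ae_imp zt => x; exact.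
- by apply: weak_primitive => //; [exact/L2_locint/Lt|exact: wt].
Qed.

End slices.

(** * Calibration of the variation *)

Section calibration.
Context (R : realType).
Local Notation mu := (@lebesgue_measure R).
Local Notation mu2 := (mu \x mu)%E.
Local Notation pos := (`]0, +oo[%classic : set R).

Lemma rcs_near (U : R -> R) (y e : R) : rcs U -> 0 < e ->
  exists2 d, 0 < d & forall x, y <= x <= y + d -> `|U x - U y| <= e.
Proof.
move=> rU e0; apply: contrapT => H.
have Hn (n : nat) : exists x, y <= x <= y + n.+1%:R^-1 /\ e < `|U x - U y|.
  apply: contrapT => Hn; apply: H; exists n.+1%:R^-1; first by rewrite invr_gt0.
  by move=> x xy; rewrite leNgt; apply/negP => ex; apply: Hn; exists x.
have [x_ Hx] := choice Hn.
have xc : x_ @ \oo --> y.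
  apply: (squeeze_cvgr (f := cst y) (h := fun n => y + n.+1%:R^-1)).
  - by apply: nearW => n; have [] := Hx n.
  - exact: cvg_cst.
  - rewrite -[X in _ --> X]addr0; apply: cvgD; first exact: cvg_cst.
    exact: cvg_harmonic.
have := rU y x_ (fun n => _) xc; rewrite cvgrPdist_le => Hc.
have /Hc /(_ _ e0) : forall n, y <= x_ n by move=> n; have [/andP[]] := Hx n.
case=> n _ /(_ n (leqnn n)); rewrite distrC => h.
by have [_] := Hx n; rewrite ltNge h.
Qed.

(** Averages to the right express the values of U by integrals, which are
    measurable in time. *)
Lemma rcs_avg (U : R -> R) (C y : R) : rcs U -> measurable_fun setT U ->
  (forall x, `|U x| <= C) ->
  \int[mu]_x (U x * (m.+1%:R * \1_(`]y, y + m.+1%:R^-1]%classic) x)) @[m --> \oo] --> U y.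
Proof.
move=> rU mU UC; apply/cvgrPdist_le => e e0.
have [d d0 Hd] := rcs_near y rU e0.
have Hm : \forall m \near \oo, (m.+1%:R^-1 : R) < d by exact: (cvgr_lt _ (@cvg_harmonic R)).
apply: filterS Hm => m md.
pose rho (x : R) : R := m.+1%:R * \1_(`]y, y + m.+1%:R^-1]%classic) x.
rewrite -[X in _ - X]/(\int[mu]_x (U x * rho x)).
have m0 : 0 < m.+1%:R :> R by [].
have i1 : intg mu rho.
  apply: intgZ; exact: intg_bnd.
have r0 x : 0 <= rho x by rewrite /rho mulr_ge0.
have I1 : \int[mu]_x rho x = 1.
  rewrite /rho RintegralZl//; last first.
    exact: intg_bnd.
  by rewrite Rint_itv ?lerDl ?invr_ge0// addrAC subrr add0r divff.
have iU : intg mu (fun x => U x * rho x).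
  apply: (@intg_dom _ _ _ mu (fun x => C * rho x)).
  - by apply: measurable_funM => //; exact: (intg_meas i1).
  - exact: intgZ.
  - by move=> x; rewrite normrM (ger0_norm (r0 x)) ler_wpM2r.
have iy : intg mu (fun x => U y * rho x) by exact: intgZ.
have ie : intg mu (fun x => e * rho x) by exact: intgZ.
have -> : U y = \int[mu]_x (U y * rho x) by rewrite RintegralZl// I1 mulr1.
rewrite -RintegralB//.
apply: (le_trans (le_normr_Rintegral _ _)) => //; first exact: intgB.
have -> : e = \int[mu]_x (e * rho x) by rewrite RintegralZl// I1 mulr1.
apply: le_Rint => //; first exact/intg_norm/intgB.
move=> x; rewrite -mulrBl normrM (ger0_norm (r0 x)).
rewrite /rho indicE; have [xy|_] := boolP (x \in _); last by rewrite !mulr0.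
rewrite ler_wpM2r ?mulr_ge0// distrC; apply: Hd.
move: xy; rewrite inE/= in_itv/= => /andP[h1 h2]; rewrite (ltW h1)/=.
by apply: (le_trans h2); rewrite lerD2l ltW.
Qed.

(** What is retained of the flow at almost every time: U - w may be tested against
    ut, and the integral of ut over an interval is an increment of z. *)
Definition calibrated (M : R) (u ut : R -> R) := exists U : R -> R,
  [/\ rcs U, measurable_fun setT U, forall x, `|U x| <= M & {ae mu, forall x, u x = U x}] /\
  [/\ L2 mu u, L2 mu ut,
    (forall (w : R -> R) C c, rcs w -> L2 mu w -> (forall x, `|w x| <= C) ->
      (\forall l \near \oo, \forall n \near \oo,
         var (w \o grid l%:R n) n.+1 <= var (U \o grid l%:R n) n.+1 - c) ->
      \int[mu]_x ((U x - w x) * ut x) <= - c) &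
    forall p q, p <= q -> -2 <= \int[mu]_x (\1_(`]p, q]%classic) x * ut x)].

(** The pairing of z with Du(t) is A t = - int u zx by integration by parts, and it
    is at most |Du(t)|(R), which bounds the variation of U along every grid. The
    integrals in time of the two ends of this chain coincide, so the variation
    along every grid is at most A t. *)
Lemma tv_flow_calibrated (u0 : R -> R) u : TVF_strong_solution u0 u ->
  exists ut M, [/\ W12loc_L2 u ut, {ae mu, forall x, u 0 x = u0 x} &
    {ae mu, forall t, 0 < t -> calibrated M (u t) (ut t)}].
Proof.
move=> [ut [z [zx [Du [[[hDu [M hM]] hW h0] [[mz z1 cz Lzx dz] [utzx hE]]]]]]].
exists ut, M; split => //.
have [Lu Lut _ u2 _] := hW.
have muu t : 0 <= t -> L2 mu (u t).
  by move=> t0; apply: finite_norm_L2; [exact: L2loc_meas_t|exact: u2].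
pose P t : {finite_measure set (measurableTypeR R) -> \bar R} := jordan_pos (hahn_proof (Du t)).
pose N t : {finite_measure set (measurableTypeR R) -> \bar R} := jordan_neg (hahn_proof (Du t)).
pose U t := dcdf (P t) (N t).
pose S t := 0 < t -> [/\ regular_slice (ut t) (zx t) (z t), deriv_measure (u t) (Du t) &
   (charge_tv (Du t) setT <= M%:E)%E].
have aS : {ae mu, forall t, S t}.
  have := ae_and (ae_regular_slice mz z1 cz Lzx dz utzx) (ae_and hDu hM).
  by apply: ae_imp => t [h1 [h2 h3]] t0; split; [exact: h1|exact: (h2 t0).2|exact: h3].
pose V t l n := var (U t \o grid l%:R n) n.+1.
pose A t := - \int[mu]_x ((\1_pos t * u t x) * (\1_pos t * zx t x)).
have pos1 t : 0 < t -> \1_pos t = 1 :> R.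
  by move=> t0; rewrite indicE mem_set//= in_itv/= t0.
have AE t : 0 < t -> A t = - \int[mu]_x (u t x * zx t x).
  by move=> t0; rewrite /A pos1//; congr (- _); apply: eq_Rintegral => x _; rewrite !mul1r.
have SU t : 0 < t -> S t -> [/\ rcs (U t), measurable_fun setT (U t), forall x, `|U t x| <= M,
    {ae mu, forall x, u t x = U t x} & [/\ L2 mu (U t), dint (P t) (N t) (cst 1) = 0 & total_mass (P t) (N t) <= M]].
  move=> t0 /(_ t0)[_ h2 h3]; have [PN0 uU] := bv_rep0 (muu _ (ltW t0)) h2.
  have mU : measurable_fun setT (U t) by exact: dcdf_meas.
  have tM : total_mass (P t) (N t) <= M by rewrite -lee_fin -charge_tvE.
  split => //; first exact: dcdf_rcs.
    by move=> x; apply: le_trans tM; exact: dcdf_bound.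
  by split => //; apply: L2_ae uU (muu _ (ltW t0)).
have mF : measurable_fun setT (fun p : R * R => (\1_pos p.1 * u p.1 p.2) * (\1_pos p.1 * zx p.1 p.2)).
  by apply: measurable_funM; exact: L2loc_pos_meas.
have mA : measurable_fun setT A.
  by apply: measurable_funN; exact: (@meas_Rint _ _ _ _ _ mu _ mF).
have aV : {ae mu, forall t, 0 < t -> forall l n, V t l n <= A t}.
  (* an enumeration of the grids *)
  pose ix (i : nat) : nat * nat := odflt (0, 0)%N (unpickle i).
  have aVn (k : nat) : {ae mu, forall t, `]0, k.+1%:R[%classic t ->
      forall i, V t (ix i).1 (ix i).2 <= A t}.
    have Dfin : (mu [set` `](0 : R), k.+1%:R[%R] < +oo)%E.
      by rewrite lebesgue_measure_itv/= lte_fin; case: ifP => _; rewrite ?ltry.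
    have [N0 [mN N00 SN]] := aS.
    have HS t : (`]0, k.+1%:R[%classic `\` N0) t -> 0 < t /\ S t.
      move=> [h1 h2]; split; first by move: h1; rewrite /= in_itv/= => /andP[].
      by apply: contrapT => /SN.
    have mE : measurable (`]0, k.+1%:R[%classic `\` N0 : set R) by exact: measurableD.
    have mUy y : measurable_fun (`]0, k.+1%:R[%classic `\` N0) (fun t => U t y).
      apply: (@measurable_fun_cvg _ _ _ _ (fun m t => \int[mu]_x ((\1_pos t * u t x) *
           (m.+1%:R * \1_(`]y, y + m.+1%:R^-1]%classic) x)))).
        move=> m; apply: measurable_funTS.
        apply: (@meas_Rint _ _ _ _ _ mu (fun p => (\1_pos p.1 * u p.1 p.2) * (m.+1%:R * \1_(`]y, y + m.+1%:R^-1]%classic) p.2))).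
        apply: measurable_funM; first exact: L2loc_pos_meas.
        apply: measurable_funM => //.
        by apply: (measurableT_comp (indic_itv_meas _)).
      move=> t /HS[t0 St]; have [rU mU UM uU _] := SU _ t0 St.
      have E m : \int[mu]_x ((\1_pos t * u t x) * (m.+1%:R * \1_(`]y, y + m.+1%:R^-1]%classic) x)) =
          \int[mu]_x (U t x * (m.+1%:R * \1_(`]y, y + m.+1%:R^-1]%classic) x)).
        have mI : measurable_fun setT (fun x : R => m.+1%:R * \1_(`]y, y + m.+1%:R^-1]%classic) x : R).
          by apply: measurable_funM => //; exact: indic_itv_meas.
        apply: Rint_ae.
        - apply: measurable_funM => //; apply: measurable_funM => //.
          exact: (muu _ (ltW t0)).1.
        - exact: measurable_funM.
        - by apply: ae_imp uU => x ->; rewrite pos1// mul1r.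
      rewrite (_ : (fun m => _) = fun m => \int[mu]_x (U t x * (m.+1%:R * \1_(`]y, y + m.+1%:R^-1]%classic) x))).
        have Hc := rcs_avg (y := y) rU mU UM.
        exact: Hc.
      by apply/funext => m; exact: E.
    apply: (@integral_squeeze _ _ _ mu _ N0 (fun t => charge_integral (Du t) (z t)) A
       (fun t => charge_tv (Du t) setT) (fun i t => V t (ix i).1 (ix i).2) M) => //.
    - exact: measurable_funTS.
    - move=> i; rewrite /V /var; apply: measurable_funD.
        apply: measurable_funD; first by apply: measurableT_comp => //; exact: mUy.
        apply: measurable_sum => j; apply: measurableT_comp => //.
        by apply: measurable_funB; exact: mUy.
      by apply: measurableT_comp => //; exact: mUy.
    - move=> t /HS[t0 St]; have [rU mU UM uU [U2 PN0 tM]] := SU _ t0 St.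
      have [[Lz ae_ut czt z1t zE] _ h3] := St t0.
      have fA : charge_integral (Du t) (z t) = A t.
        rewrite charge_integralE (parts z1t Lz czt zE PN0 U2) AE//; congr (- _).
        apply: Rint_ae; [exact: measurable_funM mU Lz.1|exact: measurable_funM (muu _ (ltW t0)).1 Lz.1|].
        by apply: ae_imp uU => x ->.
      split => //.
      + rewrite -fA charge_integralE charge_tvE lee_fin -[leRHS]mul1r.
        apply: dint_bound; split => //; exact: continuous_measurable_fun.
      + move=> i; rewrite charge_tvE lee_fin; apply: var_dcdf => //.
        exact: grid_homo.
    - exact: hE.
  apply: ae_imp (ae_all aVn) => t Ht t0 l n.
  have := Ht (Num.bound t) _ (pickle (l, n)); rewrite /ix pickleK; apply.
  rewrite /= in_itv/= t0/=; apply: (lt_le_trans (archi_boundP (ltW t0))).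
  by rewrite ler_nat.
apply: ae_imp (ae_and aS aV) => t [St Vt] t0.
have [rU mU UM uU [U2 PN0 tM]] := SU _ t0 St.
have [[Lz ae_ut czt z1t zE] _ h3] := St t0.
have mut : measurable_fun setT (ut t) by apply: L2loc_meas_t => //; exact: ltW.
have Lutt : L2 mu (ut t).
  apply: (@L2_ae _ _ _ mu (zx t)) => //; apply: ae_imp ae_ut => x ->.
  by [].
exists (U t); split; split => //.
- exact: muu (ltW t0).
- move=> w C c rw w2 wC Hc.
  have E1 : - (\int[mu]_x (w x * zx t x)) <= A t - c.
    apply: (calibration_le z1t Lz zE rw w2 wC).
    apply: filterS Hc => l; apply: filterS => n; move/le_trans; apply.
    by rewrite lerD2r; exact: Vt.
  have -> : \int[mu]_x ((U t x - w x) * ut t x) = \int[mu]_x (U t x * zx t x - w x * zx t x).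
    apply: Rint_ae.
    + by apply: measurable_funM => //; apply: measurable_funB => //; exact: w2.1.
    + by apply: measurable_funB; apply: measurable_funM => //; [exact: Lz.1|exact: w2.1|exact: Lz.1].
    + by apply: ae_imp ae_ut => x ->; rewrite mulrBl.
  rewrite RintegralB//; [|exact: L2_mul|exact: L2_mul].
  have AU : A t = - \int[mu]_x (U t x * zx t x).
    rewrite AE//; congr (- _); apply: Rint_ae.
    + exact: measurable_funM (muu _ (ltW t0)).1 Lz.1.
    + exact: measurable_funM mU Lz.1.
    + by apply: ae_imp uU => x ->.
  by move: E1; rewrite AU; lra.
- move=> p q pq; have -> : \int[mu]_x (\1_(`]p, q]%classic) x * ut t x) = z t q - z t p.
    rewrite zE//; apply: Rint_ae.
    + by apply: measurable_funM => //; exact: indic_itv_meas.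
    + by apply: measurable_funM; [exact: indic_itv_meas|exact: Lz.1].
    + by apply: ae_imp ae_ut => x ->.
  by have := z1t q; have := z1t p; rewrite !ler_norml; lra.
Qed.

End calibration.

(** * Increments in time *)

Section increments.
Context (R : realType).
Local Notation mu := (@lebesgue_measure R).
Local Notation mu2 := (mu \x mu)%E.
Local Notation pos := (`]0, +oo[%classic : set R).

Lemma indic_pos (t : R) : 0 < t -> \1_pos t = 1 :> R.
Proof. by move=> t0; rewrite indicE mem_set//= in_itv/= t0. Qed.

Lemma locint_windows (f : R -> R) : measurable_fun setT f ->
  (forall n : nat, intg mu (fun x => \1_(`[- n%:R, n%:R]%classic) x * f x)) ->
  locally_integrable setT f.
Proof.
move=> mf fi; split => // [|K _ cK]; first exact: openT.
have mK : measurable K by exact: compact_measurable.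
have [M [_ HM]] := compact_bounded cK.
have [n Kn] : exists n : nat, K `<=` `[- n%:R, n%:R]%classic.
  exists (Num.bound (`|M| + 1)) => x Kx /=.
  have h1 : M < `|M| + 1 by have := ler_norm M; lra.
  have h2 := HM _ h1 _ Kx; have h3 := archi_boundP (ltW (le_lt_trans (normr_ge0 _) (_ : `|M| < `|M| + 1))).
  rewrite in_itv/= -ler_norml (le_trans h2)// ltW// h3//; lra.
have /integrableP[_] := fi n; apply: le_lt_trans.
rewrite [leLHS]integral_mkcond; apply: ge0_le_integral => //.
- by move=> x _; apply: erestrict_ge0.
- apply/(measurable_restrictT _ mK); apply/measurable_EFinP.
  by apply: measurableT_comp => //; exact: measurable_funTS.
- apply: measurableT_comp => //; apply/measurable_EFinP.
  by apply: measurable_funM => //; exact: measurable_indic.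
- move=> x _ /=; rewrite /patch; case: ifPn => xK; last by rewrite (_ : point = 0%E)// lee_fin.
  by rewrite indicE mem_set ?mul1r//; apply: Kn; rewrite inE in xK.
Qed.

Variables u ut : R -> R -> R.
Hypothesis hW : W12loc_L2 u ut.

Lemma W12_L2 t : 0 <= t -> L2 mu (u t).
Proof.
have [Lu _ _ u2 _] := hW; move=> t0.
by apply: finite_norm_L2; [exact: L2loc_meas_t|exact: u2].
Qed.

Lemma W12_cvg t : 0 <= t ->
  \int[mu]_x ((u s x - u t x) ^+ 2) @[s --> within `[0, +oo[%classic (nbhs t)] --> 0.
Proof.
move=> t0; have [_ _ _ _ /(_ _ t0) h] := hW.
apply: (@Lnorm2_cvg0 _ _ _ mu _ (within `[0, +oo[%classic (nbhs t)) _ (fun s x => u s x - u t x)) => //.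
near=> s; apply: L2B; last exact: W12_L2.
apply: W12_L2; have : `[0, +oo[%classic s by near: s; exact: withinT.
by rewrite /= in_itv/= andbT.
Unshelve. all: by end_near. Qed.

Lemma W12_cvg_seq (t : R) (s_ : nat -> R) : 0 <= t -> (forall n, 0 <= s_ n) -> s_ @ \oo --> t ->
  \int[mu]_x ((u (s_ n) x - u t x) ^+ 2) @[n --> \oo] --> 0.
Proof.
move=> t0 s0 st.
apply: (cvg_comp s_ (fun s => \int[mu]_x ((u s x - u t x) ^+ 2)) _ (W12_cvg t0)).
move=> A /= HA.
have : \forall n \near \oo, `[0, +oo[%classic (s_ n) -> A (s_ n) by exact: (st _ HA).
by apply: filterS => n h; apply: h; rewrite /= in_itv/= andbT; exact: s0.
Qed.

Lemma W12_dual_cvg (t : R) (s_ : nat -> R) h : L2 mu h -> 0 <= t -> (forall n, 0 <= s_ n) ->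
  s_ @ \oo --> t ->
  \int[mu]_x (u (s_ n) x * h x) @[n --> \oo] --> \int[mu]_x (u t x * h x).
Proof.
move=> h2 t0 s0 st; have ut2 := W12_L2 t0.
have us2 n := W12_L2 (s0 n).
have H : \int[mu]_x ((u (s_ n) x - u t x) * h x) @[n --> \oo] --> 0.
  apply: cvg_L2_mul => //; last exact: W12_cvg_seq.
  by apply: nearW => n; exact: L2B.
have E n : \int[mu]_x (u (s_ n) x * h x) =
    \int[mu]_x ((u (s_ n) x - u t x) * h x) + \int[mu]_x (u t x * h x).
  rewrite -RintegralD//; [|exact/L2_mul/h2/L2B|exact: L2_mul].
  by apply: eq_Rintegral => x _; rewrite mulrBl subrK.
under eq_fun do rewrite E.
have Hc := cvgD H (cvg_cst (\int[mu]_x (u t x * h x))); rewrite add0r in Hc.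
exact: Hc.
Qed.

Let H p q (t : R) := \int[mu]_x (\1_pos t * u t x * \1_(`]p, q]%classic) x).

Lemma H_cont p q t : 0 < t -> {for t, continuous (H p q)}.
Proof.
move=> t0; have I2 : L2 mu (\1_(`]p, q]%classic) : R -> R).
  exact: L2_bnd.
have ut2 := W12_L2 (ltW t0).
have pos_near : \forall s \near t, 0 < s by exact: lt_nbhsr.
have C0 : \int[mu]_x ((u s x - u t x) ^+ 2) @[s --> t] --> 0.
  move=> A HA; have := W12_cvg (ltW t0) HA; rewrite /= => HA'.
  have : \forall s \near t, `[0, +oo[%classic s -> A (\int[mu]_x ((u s x - u t x) ^+ 2)) by exact: HA'.
  move=> HB; apply: filterS (filterI HB pos_near) => s [h s0]; apply: h.
  by rewrite /= in_itv/= ltW.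
have C1 : \int[mu]_x ((u s x - u t x) * \1_(`]p, q]%classic) x) @[s --> t] --> 0.
  apply: cvg_L2_mul => //; near=> s; apply: L2B => //; apply: W12_L2; apply: ltW.
  by near: s.
rewrite /prop_for /continuous_at.
have HE s : 0 < s -> H p q s = \int[mu]_x ((u s x - u t x) * \1_(`]p, q]%classic) x) + H p q t.
  move=> s0; have us2 := W12_L2 (ltW s0).
  rewrite /H; under eq_Rintegral do rewrite indic_pos// mul1r.
  under [X in _ = _ + X]eq_Rintegral do rewrite indic_pos// mul1r.
  rewrite -RintegralD//; [|exact/L2_mul/I2/L2B|exact: L2_mul].
  by apply: eq_Rintegral => x _; rewrite mulrBl subrK.
apply: (@cvg_trans _ ((\int[mu]_x ((u s x - u t x) * \1_(`]p, q]%classic) x) + H p q t) @[s --> t])).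
  by apply: near_eq_cvg; apply: filterS pos_near => s s0; symmetry; exact: HE.
have Hc := cvgD C1 (cvg_cst (H p q t)); rewrite add0r in Hc.
exact: Hc.
Unshelve. all: by end_near. Qed.

Lemma H_locint p q : p <= q -> locally_integrable setT (H p q).
Proof.
move=> pq; have [Lu _ _ _ _] := hW.
have mH : measurable_fun setT (H p q).
  apply: (@meas_Rint _ _ _ _ _ mu (fun z => \1_pos z.1 * u z.1 z.2 * \1_(`]p, q]%classic) z.2)).
  apply: measurable_funM; first exact: L2loc_pos_meas.
  by apply: (measurableT_comp (indic_itv_meas _)).
apply: locint_windows => // n.
have [i1 _] := box_fubini (L2loc_box Lu) (ltr0Sn R n) (rad_gt0 p q)
  (bdd_on_indic (@subset_refl _ _)) (bdd_on_indic (@sub_rad_itv _ p q)).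
apply: (@intg_dom _ _ _ mu _ _ _ (intg_norm i1)).
  by apply: measurable_funM => //; exact: indic_itv_meas.
move=> t; rewrite !normrM !(ger0_norm (_ : 0 <= \1__ _))//.
have [t0|t0] := ltP 0 t.
  rewrite ler_wpM2r// !indicE; case: (boolP (t \in `[_, _]%classic)) => // tn.
  rewrite mem_set//=; move: tn; rewrite inE/= !in_itv/= t0 => /andP[_ tn]; apply: (le_trans tn).
  by rewrite ler_nat.
have -> : H p q t = 0.
  rewrite /H; under eq_Rintegral do rewrite indicE memNset/= ?in_itv/= ?ltNge ?t0// !mul0r.
  by rewrite Rint0.
by rewrite normr0 mulr0 mulr_ge0.
Qed.

Section primitive.
Variables (t1 t2 : R) (t10 : 0 <= t1) (t12 : t1 < t2).
Let G (s x : R) := \1_(`]t1, t2]%classic) s * ut s x.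
Let W x := \int[mu]_s G s x.

Let I2 : L2 mu (\1_(`]t1, t2]%classic) : R -> R).
Proof. exact: L2_bnd. Qed.

Let G2 : L2 mu2 (fun z : R * R => G z.1 z.2).
Proof.
have [_ Lut _ _ _] := hW.
have c2 := L2loc_cut Lut (le_lt_trans t10 t12).
have E : (fun z : R * R => G z.1 z.2) = (fun z => \1_(`]t1, t2]%classic) z.1 * (\1_(`[0, t2]%classic) z.1 * ut z.1 z.2)).
  apply/funext => z; rewrite /G indic_mul_sub// => s /=; rewrite !in_itv/= => /andP[h1 ->].
  by rewrite andbT ltW// (le_lt_trans t10).
apply: (@L2_dom _ _ _ mu2 _ _ _ c2).
  rewrite E; apply: measurable_funM; last exact: c2.1.
  by apply: (measurableT_comp (indic_itv_meas _)).
move=> z; rewrite [X in `|X| <= _](congr1 (@^~ z) E) normrM ler_piMl//.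
by rewrite indicE; case: (_ \in _); rewrite ?normr1 ?normr0.
Qed.

Let Gh_intg h : L2 mu h -> intg mu2 (fun z : R * R => G z.1 z.2 * h z.2).
Proof.
move=> h2; have := L2_mul G2 (L2_tensor (m1 := mu) (m2 := mu) I2 h2).
congr (_.-integrable _ _); apply/funext => z /=; congr EFin.
rewrite /G indicE; case: (_ \in _); rewrite ?mul1r// !mul0r//.
Qed.

Let W_meas : measurable_fun setT W.
Proof.
apply: (@meas_Rint _ _ _ _ _ mu (fun z : R * R => G z.2 z.1)).
exact: (measurableT_comp G2.1 (@measurable_swap _ _ R R)).
Qed.

Let Wh_ae h : L2 mu h -> {ae mu, forall x, W x * h x = \int[mu]_s (G s x * h x)}.
Proof.
move=> h2; have := @ae_integrable2 _ _ _ _ _ mu mu _ (Gh_intg h2).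
apply: ae_imp => x /= ix; have [->|h0] := eqVneq (h x) 0.
  by rewrite mulr0; under eq_Rintegral do rewrite mulr0; rewrite Rint0.
have iG : intg mu (fun s => G s x).
  have := intgZ (h x)^-1 (ix : intg mu (fun s => G s x * h x)).
  congr (_.-integrable _ _); apply/funext => s /=; congr EFin.
  by rewrite mulrC mulfK.
by rewrite /W -RintegralZr.
Qed.

Let Wh_meas h : L2 mu h -> measurable_fun setT (fun x => \int[mu]_s (G s x * h x)).
Proof. by move=> h2; exact: (intg_meas (fubini_intg2 (Gh_intg h2))). Qed.

Let Wh_intg h : L2 mu h -> intg mu (fun x => W x * h x).
Proof.
move=> h2; apply: (@intg_ae _ _ _ mu (fun x => \int[mu]_s (G s x * h x))).
- by apply: measurable_funM => //; exact: h2.1.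
- by apply: ae_imp (Wh_ae h2) => x ->.
- exact: (fubini_intg2 (Gh_intg h2)).
Qed.

Let WhE h : L2 mu h -> \int[mu]_x (W x * h x) =
  \int[mu]_s (\1_(`]t1, t2]%classic) s * \int[mu]_x (ut s x * h x)).
Proof.
move=> h2; rewrite (@Rint_ae _ _ _ mu _ (fun x => \int[mu]_s (G s x * h x))); last first.
- exact: Wh_ae.
- exact: Wh_meas.
- by apply: measurable_funM => //; exact: h2.1.
rewrite -(fubini_swap (Gh_intg h2)); apply: eq_Rintegral => s _ /=.
rewrite /G indicE; case: (_ \in _); last first.
  by under eq_Rintegral do rewrite !mul0r; rewrite Rint0 mul0r.
by rewrite mul1r; under eq_Rintegral do rewrite mul1r.
Qed.

Lemma dual_intg h : L2 mu h ->
  intg mu (fun s => \1_(`]t1, t2]%classic) s * \int[mu]_x (ut s x * h x)).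
Proof.
move=> h2; have := fubini_intg (Gh_intg h2).
congr (_.-integrable _ _); apply/funext => s /=; congr EFin.
rewrite /G indicE; case: (_ \in _); last first.
  by under eq_Rintegral do rewrite !mul0r; rewrite Rint0 mul0r.
by rewrite mul1r; under eq_Rintegral do rewrite mul1r.
Qed.

(** Both sides have the same integrals over bounded intervals, by [weak_deriv_t];
    its Lebesgue points in time are provided by the continuity of t |-> u t in L2. *)
Let increment_pos : 0 < t1 -> {ae mu, forall x, u t2 x - u t1 x - W x = 0}.
Proof.
move=> t1p; have [Lu Lut dt _ _] := hW.
have u12 := W12_L2 t10; have u22 := W12_L2 (ltW (le_lt_trans t10 t12)).
have Ipq p q : L2 mu (\1_(`]p, q]%classic) : R -> R).
  exact: L2_bnd.
have uI t p q : 0 <= t -> intg mu (fun x => u t x * \1_(`]p, q]%classic) x).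
  by move=> t0; apply: L2_mul => //; exact: W12_L2.
have HE p q t : 0 < t -> \int[mu]_x (u t x * \1_(`]p, q]%classic) x) = H p q t.
  by move=> t0; apply: eq_Rintegral => x _; rewrite indic_pos// mul1r.
have mD : measurable_fun setT (fun x => u t2 x - u t1 x - W x).
  by apply: measurable_funB => //; apply: measurable_funB; [exact: u22.1|exact: u12.1].
have iD p q : intg mu (fun x => (u t2 x - u t1 x - W x) * \1_(`]p, q]%classic) x).
  have := intgB (intgB (uI _ p q (ltW (le_lt_trans t10 t12))) (uI _ p q t10)) (Wh_intg (Ipq p q)).
  by congr (_.-integrable _ _); apply/funext => x /=; congr EFin; rewrite !mulrBl.
apply: ae0_itv.
  apply: locint_windows => // n; apply: (@intg_dom _ _ _ mu _ _ _ (intg_norm (iD (- n.+1%:R) n%:R))).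
    by apply: measurable_funM => //; exact: indic_itv_meas.
  move=> x; rewrite mulrC !normrM; apply: ler_wpM2l => //.
  rewrite !ger0_norm//; apply: indic_sub => y /=; rewrite !in_itv/= => /andP[h1 ->].
  by rewrite andbT; apply: lt_le_trans h1; rewrite ltrN2 ltr_nat.
move=> p q pq.
have -> : \int[mu]_x (\1_(`]p, q]%classic) x * (u t2 x - u t1 x - W x)) =
   \int[mu]_x (u t2 x * \1_(`]p, q]%classic) x - u t1 x * \1_(`]p, q]%classic) x - W x * \1_(`]p, q]%classic) x).
  by apply: eq_Rintegral => x _; rewrite mulrC !mulrBl.
have t2p := lt_trans t1p t12.
rewrite RintegralB//; [|exact/intgB/uI/ltW/t1p/uI/ltW/t2p|exact: Wh_intg].
rewrite RintegralB//; [|exact/uI/ltW/t2p|exact/uI].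
rewrite !HE// WhE//.
have Hl t : 0 < t -> lebesgue_pt (H p q) t.
  move=> t0; apply: (@continuous_lebesgue_pt _ _ _ setT) => //.
  - by split=> //; exact: openT.
  - by have [] := H_locint (ltW pq).
  - exact: H_cont.
have := weak_deriv_t (L2loc_box Lu) (L2loc_box Lut) dt t1p (ltW t12) (ltW pq)
   (Hl _ t1p) (Hl _ t2p) (H_locint (ltW pq)).
rewrite -/(H p q t1) -/(H p q t2) => ->.
have [_ ->] := box_fubini (L2loc_box Lut) t2p (rad_gt0 p q)
  (bdd_on_indic (@sub_pos_itv _ t1 t2 t1p)) (bdd_on_indic (@sub_rad_itv _ p q)).
apply/eqP; rewrite subr_eq0; apply/eqP; apply: eq_Rintegral => s _.
rewrite indicE; case: (boolP (s \in _)) => [|_]; last by rewrite !mul0r.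
rewrite inE/= in_itv/= => /andP[s1 _]; congr (_ * _).
by apply: eq_Rintegral => x _; rewrite indic_pos ?mul1r// (lt_trans t1p).
Qed.

Lemma W12_increment_pos h : 0 < t1 -> L2 mu h ->
  \int[mu]_x (u t2 x * h x) - \int[mu]_x (u t1 x * h x) =
  \int[mu]_s (\1_(`]t1, t2]%classic) s * \int[mu]_x (ut s x * h x)).
Proof.
move=> t1p h2.
have u12 := W12_L2 t10; have u22 := W12_L2 (ltW (le_lt_trans t10 t12)).
rewrite -WhE// -RintegralB//; [|exact: L2_mul|exact: L2_mul].
apply: Rint_ae.
- by apply: measurable_funB; apply: measurable_funM; [exact: u22.1|exact: h2.1|exact: u12.1|exact: h2.1].
- by apply: measurable_funM => //; exact: h2.1.
- apply: ae_imp (increment_pos t1p) => x /eqP; rewrite subr_eq0 => /eqP <-.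
  by rewrite mulrBl.
Qed.

End primitive.

(** Positive times are treated first; t1 = 0 is reached by continuity in L2. *)
Lemma W12_increment h t1 t2 : L2 mu h -> 0 <= t1 -> t1 <= t2 ->
  \int[mu]_x (u t2 x * h x) - \int[mu]_x (u t1 x * h x) =
  \int[mu]_s (\1_(`]t1, t2]%classic) s * \int[mu]_x (ut s x * h x)).
Proof.
move=> h2 t10; rewrite le_eqVlt => /orP[/eqP <-|t12].
  rewrite subrr; under eq_Rintegral do rewrite set_itvoc0 indic0 mul0r.
  by rewrite Rint0.
move: t10; rewrite le_eqVlt => /orP[/eqP t10|t10]; last first.
  exact: (W12_increment_pos (ltW t10)).
rewrite -t10 in t12 *.
pose s_ (n : nat) := t2 * n.+2%:R^-1.
have s0 n : 0 < s_ n by rewrite mulr_gt0 ?invr_gt0.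
have st n : s_ n < t2.
  by rewrite gtr_pMr// invf_lt1 ?ltr0n// ltr1n.
have sc : s_ @ \oo --> 0.
  rewrite -[X in _ --> X](mulr0 t2); apply: cvgM; first exact: cvg_cst.
  by have := @cvg_harmonic R; rewrite -(cvg_shiftS); exact.
have c1 : \int[mu]_x (u t2 x * h x) - \int[mu]_x (u (s_ n) x * h x) @[n --> \oo] -->
    \int[mu]_x (u t2 x * h x) - \int[mu]_x (u 0 x * h x).
  by apply: cvgB; [exact: cvg_cst|apply: W12_dual_cvg => // n; exact: ltW].
pose K s := \int[mu]_x (ut s x * h x).
have iK := dual_intg (lexx 0) t12 h2; rewrite -/(K _) in iK.
have [_ Lut _ _ _] := hW.
have c2 : \int[mu]_s (\1_(`]s_ n, t2]%classic) s * (\1_(`]0, t2]%classic) s * K s)) @[n --> \oo] -->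
    \int[mu]_s (\1_(`]0, t2]%classic) s * K s).
  apply: (@dctR _ _ _ mu _ _ (fun s => `|\1_(`]0, t2]%classic) s * K s|)).
  - by move=> n; apply: measurable_funM; [exact: indic_itv_meas|exact: (intg_meas iK)].
  - exact: (intg_meas iK).
  - apply: aeW => s; have [s00|s00] := ltP 0 s; last first.
      rewrite [\1_(`]0, _]%classic) s]indicE memNset/= ?in_itv/= ?ltNge ?s00// mul0r.
      by under eq_fun do rewrite mulr0; exact: cvg_cst.
    apply: (@cvg_trans _ ((cst (\1_(`]0, t2]%classic) s * K s) : nat -> R) @ \oo)); last exact: cvg_cst.
    apply: near_eq_cvg; have Hs : \forall n \near \oo, s_ n < s by exact: (cvgr_lt _ sc).
    apply: filterS Hs => n sn /=; rewrite mulrA; congr (_ * _).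
    rewrite !indicE -natrM mulnb; congr (_%:R); congr nat_of_bool.
    apply/idP/andP => [h0|[]//]; split => //.
    by move: h0; rewrite !inE/= !in_itv/= => /andP[_ ->]; rewrite sn.
  - exact: intg_norm.
  - move=> n s; rewrite normrM ler_piMl// indicE; case: (_ \in _); rewrite ?normr1 ?normr0//.
have E n : \int[mu]_s (\1_(`]s_ n, t2]%classic) s * (\1_(`]0, t2]%classic) s * K s)) =
    \int[mu]_x (u t2 x * h x) - \int[mu]_x (u (s_ n) x * h x).
  rewrite (W12_increment_pos (ltW (s0 n)) (st n) (s0 n) h2); apply: eq_Rintegral => s _.
  rewrite indic_mul_sub// => x /=; rewrite !in_itv/= => /andP[h1 ->].
  by rewrite (lt_trans (s0 n)).
have c2' : \int[mu]_x (u t2 x * h x) - \int[mu]_x (u (s_ n) x * h x) @[n --> \oo] -->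
    \int[mu]_s (\1_(`]0, t2]%classic) s * K s).
  by apply: cvg_trans c2; under [X in _ `=>` X @ _]eq_fun do rewrite E.
by apply: (cvg_unique _ c1 c2'); exact: Rhausdorff.
Qed.

End increments.

Lemma half_norm (R : realType) (a : R) : `|(a + `|a|) / 2| <= `|a|.
Proof.
rewrite normrM (@ger0_norm _ 2^-1)//.
by have h2 := ler_normD a `|a|; rewrite normr_id in h2; lra.
Qed.

Lemma clamp_lip (R : realType) (a b r s : R) :
  `|Num.max a (Num.min b r) - Num.max a (Num.min b s)| <= `|r - s|.
Proof.
wlog rs : r s / r <= s.
  by move=> H; have [/H//|/ltW/H] := leP r s; rewrite [leLHS]distrC [leRHS]distrC.
have [h1|h1] := leP b r; have [h2|h2] := leP b s; rewrite ?subrr ?normr0//; last first.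
- by case: (leP a r) => ?; case: (leP a s) => ?; rewrite !ler0_norm; lra.
- by case: (leP a r) => ?; case: (leP a b) => ?; rewrite !ler0_norm; lra.
- by move: (lt_le_trans h2 (le_trans h1 rs)); rewrite ltxx.
Qed.

(** * Decay of convex integrals *)

Section energy.
Context (R : realType).
Local Notation mu := (@lebesgue_measure R).
Local Notation mu2 := (mu \x mu)%E.
Variables u ut : R -> R -> R.
Hypothesis hW : W12loc_L2 u ut.

Lemma W12_bounded t1 t2 : 0 <= t1 -> t1 <= t2 ->
  exists C, forall t, t1 <= t <= t2 -> \int[mu]_x (u t x ^+ 2) <= C.
Proof.
move=> t10 t12; pose N t := \int[mu]_x (u t x ^+ 2).
have cN : {within `[t1, t2], continuous N}.
  apply/subspace_continuousP => t /=; rewrite in_itv/= => /andP[t1t _].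
  have t0 := le_trans t10 t1t; have ut2 := W12_L2 hW t0.
  have W0 : \int[mu]_x ((u s x - u t x) ^+ 2) @[s --> within `[t1, t2]%classic (nbhs t)] --> 0.
    move=> A HA; have HA' := W12_cvg hW t0 HA.
    have HB : \forall s \near t, `[0, +oo[%classic s -> A (\int[mu]_x ((u s x - u t x) ^+ 2)) by exact: HA'.
    rewrite /= /within /=; apply: filterS HB => s h st; apply: h.
    by move: st; rewrite /= !in_itv/= andbT => /andP[h _]; exact: le_trans h.
  have near2 : \forall s \near within `[t1, t2]%classic (nbhs t), L2 mu (u s).
    apply: filterS (withinT _ _) => s; rewrite /= in_itv/= => /andP[h _].
    by apply: (W12_L2 hW); exact: le_trans h.
  have W1 : \int[mu]_x ((u s x - u t x) * (2 * u t x)) @[s --> within `[t1, t2]%classic (nbhs t)] --> 0.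
    apply: cvg_L2_mul => //; last exact: L2Z.
    by apply: filterS near2 => s us2; exact: L2B.
  have WN : (\int[mu]_x ((u s x - u t x) ^+ 2) + \int[mu]_x ((u s x - u t x) * (2 * u t x)) + N t)
      @[s --> within `[t1, t2]%classic (nbhs t)] --> (0 + 0 + N t).
    by apply: cvgD; [exact: cvgD|exact: cvg_cst].
  rewrite !add0r in WN.
  apply: (cvg_trans _ WN).
  apply: near_eq_cvg; apply: filterS near2 => s us2 /=.
  have i1 := (L2B us2 ut2).2; have i2 := L2_mul (L2B us2 ut2) (L2Z 2 ut2); have i3 := ut2.2.
  rewrite /N -RintegralD// -RintegralD//; last exact: intgD.
  by apply: eq_Rintegral => x _; ring.
have [c _ Hc] := EVT_max t12 cN.
by exists (N c) => t tt; apply: Hc; rewrite in_itv.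
Qed.

Variables g F : R -> R -> R.
Hypothesis gc : forall x, contraction (g x).
Hypothesis gm : forall v : R -> R, measurable_fun setT v -> measurable_fun setT (fun x => g x (v x)).
Hypothesis Fm : forall v : R -> R, measurable_fun setT v -> measurable_fun setT (fun x => F x (v x)).
Hypothesis F2 : forall x s, `|F x s| <= s ^+ 2.
Hypothesis FS : forall x s r, F x r - F x s <= g x r * (r - s).

Let gL2 v : L2 mu v -> L2 mu (fun x => g x (v x)).
Proof.
move=> v2; apply: (@L2_dom _ _ _ mu v) => //; first exact: gm v2.1.
by move=> x; exact: contraction_norm.
Qed.

Let FL1 v : L2 mu v -> intg mu (fun x => F x (v x)).
Proof.
by move=> v2; apply: (@intg_dom _ _ _ mu (fun x => v x ^+ 2)) => //; [exact: Fm v2.1|exact: v2.2].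
Qed.

Let K r s := \int[mu]_x (ut s x * g x (u r x)).

Let K_cvg s (t : R) (t_ : nat -> R) : L2 mu (ut s) -> 0 <= t -> (forall n, 0 <= t_ n) ->
  t_ @ \oo --> t -> K (t_ n) s @[n --> \oo] --> K t s.
Proof.
move=> s2 t0 tn0 tt; have ut2 := W12_L2 hW t0.
have utn2 n := W12_L2 hW (tn0 n).
have c0 := W12_cvg_seq hW t0 tn0 tt.
have H : \int[mu]_x ((g x (u (t_ n) x) - g x (u t x)) * ut s x) @[n --> \oo] --> 0.
  apply: cvg_L2_mul => //.
    by apply: nearW => n; apply: L2B; exact: gL2.
  apply: (squeeze_cvgr _ (cvg_cst 0) c0); apply: nearW => n; apply/andP; split.
    by apply: Rintegral_ge0 => x _; exact: sqr_ge0.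
  apply: le_Rint; [exact: (L2B (gL2 _) (gL2 _)).2|exact: (L2B _ _).2|].
  move=> x; rewrite -[leLHS]normr2 -[leRHS]normr2 ler_sqr ?nnegrE//.
  exact: contraction_lip.
have E n : K (t_ n) s = \int[mu]_x ((g x (u (t_ n) x) - g x (u t x)) * ut s x) + K t s.
  rewrite /K -RintegralD//; [|exact/L2_mul/s2/L2B/gL2/ut2/gL2|exact/L2_mul/gL2].
  by apply: eq_Rintegral => x _; ring.
under eq_fun do rewrite E.
have Hc := cvgD H (cvg_cst (K t s)); rewrite add0r in Hc.
exact: Hc.
Qed.

(** FS is the convexity inequality for F, of derivative g. Summed over a partition
    of [t1, t2], it bounds the increment of int F(u) by the integral of a step
    function in time: K(r, s) with s the current time and r the end of its cell.
    This tends to K(s, s) as the mesh tends to 0. *)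
Lemma energy_decay t1 t2 c : 0 <= t1 -> t1 <= t2 ->
  {ae mu, forall s, t1 < s <= t2 -> \int[mu]_x (ut s x * g x (u s x)) <= - c} ->
  \int[mu]_x F x (u t2 x) - \int[mu]_x F x (u t1 x) <= - c * (t2 - t1).
Proof.
move=> t10; rewrite le_eqVlt => /orP[/eqP -> _|t12 Hc]; first by rewrite !subrr mulr0.
have [_ Lut _ _ _] := hW.
pose L := (t2 - t1) / 2; pose m := (t1 + t2) / 2.
have L0 : 0 < L by rewrite /L; lra.
have Lm : m - L = t1 by rewrite /L /m; lra.
have Lp : m + L = t2 by rewrite /L /m; lra.
(* the grid is centred at 0; cl maps it to [t1, t2], and stays there off the grid *)
pose cl (r : R) := Num.max t1 (Num.min t2 (m + r)).
have cl1 r : t1 <= cl r by rewrite le_max lexx.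
have cl2 r : cl r <= t2 by rewrite ge_max (ltW t12) ge_min lexx.
have clE r : - L <= r <= L -> cl r = m + r.
  by move=> /andP[h1 h2]; rewrite /cl min_r ?max_r//; lra.
have gr n i : (i <= n.+1)%N -> - L <= grid L n i <= L.
  move=> ni; have h1 := grid_homo n (ltW L0) (leq0n i).
  by have h2 := grid_homo n (ltW L0) ni; rewrite grid0 in h1; rewrite grid_last in h2; rewrite h1.
pose p n i := cl (grid L n i).
have pE n i : (i <= n.+1)%N -> p n i = m + grid L n i by move=> ni; apply: clE; exact: gr.
have pS n i : (i <= n)%N -> p n i < p n i.+1.
  move=> ni; rewrite (pE _ _ (leqW ni)) (pE n i.+1 ni) grid_step.
  have d0 : 0 < 2 * L / n.+1%:R.
    by apply: divr_gt0; [apply: mulr_gt0|exact: ltr0Sn].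
  by move: (grid L n i) (2 * L / _) d0 => A B d0; lra.
have p0 n i : 0 <= p n i by exact: le_trans (cl1 _).
pose S n s := gstep true (fun r => K (cl r) s) L n (s - m).
have SE n s : S n s = \sum_(i < n.+1) (\1_(`]p n i, p n i.+1]%classic) s * K (p n i.+1) s).
  apply: eq_bigr => i _; rewrite addn1 mulrC; congr (_ * _); rewrite !indicE.
  congr (_%:R); congr nat_of_bool; rewrite (pE n i (ltnW (ltn_ord i))) (pE n i.+1 (ltn_ord i)).
  by apply/idP/idP; rewrite !inE/= !in_itv/= ltrBrDl lerBlDl.
have SF n : S n = fun s => \sum_(i < n.+1) (\1_(`]p n i, p n i.+1]%classic) s * K (p n i.+1) s).
  by apply/funext => s; exact: SE.
have Si n (i : 'I_n.+1) : intg mu (fun s => \1_(`]p n i, p n i.+1]%classic) s * K (p n i.+1) s).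
  by apply: (dual_intg hW (p0 _ _) (pS _ _ _)); [rewrite -ltnS|exact/gL2/(W12_L2 hW)].
have iS n : intg mu (S n).
  by rewrite SF; exact: intg_sum.
pose E t := \int[mu]_x F x (u t x).
have incr n : E t2 - E t1 <= \int[mu]_s S n s.
  have -> : E t2 - E t1 = \sum_(i < n.+1) (E (p n i.+1) - E (p n i)).
    rewrite -(big_mkord xpredT (fun i => E (p n i.+1) - E (p n i))) telescope_sumr//.
    by rewrite (pE n n.+1 (leqnn _)) (pE n 0%N (leq0n _)) grid_last grid0 Lm Lp.
  rewrite SF (@Rint_sum _ _ _ mu)//.
  apply: ler_sum => i _.
  have ilt : (i <= n)%N by rewrite -ltnS.
  have a2 := W12_L2 hW (p0 n i); have b2 := W12_L2 hW (p0 n i.+1).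
  have := W12_increment hW (gL2 b2) (p0 n i) (ltW (pS n i ilt)); rewrite -/(K _ _) => <-.
  rewrite /E -RintegralB//; [|exact: FL1|exact: FL1].
  rewrite -RintegralB//; [|exact/L2_mul/gL2|exact/L2_mul/gL2].
  apply: le_Rint; [exact/intgB/FL1/a2/FL1|exact/intgB/L2_mul/gL2/b2/a2/L2_mul/gL2|].
  by move=> x; rewrite -mulrBl mulrC; exact: FS.
have I1 : intg mu (\1_(`]t1, t2]%classic) : R -> R).
  exact: intg_bnd.
(* the positive part of S n s + c, in a form which passes to the limit *)
pose e n s := ((S n s + c) + `|S n s + c|) / 2 * \1_(`]t1, t2]%classic) s.
have Sout n s : s \notin `]t1, t2]%classic -> S n s = 0.
  move=> sn; apply: gstep_out; first exact: ltW.
  apply: contra sn; rewrite inE/= in_itv/= => /andP[h1 h2].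
  by move: Lm Lp h1 h2; lra.
have me n : measurable_fun setT (e n).
  apply: measurable_funM; last exact: indic_itv_meas.
  apply: measurable_funM => //; have mS := intg_meas (iS n).
  apply: measurable_funD; first exact: measurable_funD.
  by apply: measurableT_comp => //; exact: measurable_funD.
have [C HC] := W12_bounded t10 (ltW t12).
pose D s := \1_(`]t1, t2]%classic) s * (C + `|c|) + \int[mu]_x ((\1_(`[0, t2]%classic) s * ut s x) ^+ 2).
have iD : intg mu D.
  apply: intgD; first by have := intgZ (C + `|c|) I1; congr (_.-integrable _ _);
    apply/funext => s /=; rewrite mulrC.
  exact: (fubini_intg (L2loc_cut Lut (le_lt_trans t10 t12)).2).
have good : {ae mu, forall s, t1 < s -> L2 mu (ut s)}.
  by apply: ae_imp (L2loc_slice Lut) => s h st; apply: h; exact: le_lt_trans st.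
have eD : {ae mu, forall s, forall n, `|e n s| <= D s}.
  apply: ae_imp good => s gs n.
  have D20 : 0 <= \int[mu]_x ((\1_(`[0, t2]%classic) s * ut s x) ^+ 2).
    by apply: Rintegral_ge0 => x _; exact: sqr_ge0.
  rewrite /e /D indicE; have [sI|sI] := boolP (s \in `]t1, t2]%classic); last first.
    by rewrite mulr0 normr0 mul0r add0r.
  rewrite !(mulr1, mul1r); move: (sI); rewrite inE/= in_itv/= => /andP[s1 s2].
  have s2' := gs s1.
  have E2 : \int[mu]_x ((\1_(`[0, t2]%classic) s * ut s x) ^+ 2) = \int[mu]_x (ut s x ^+ 2).
    by apply: eq_Rintegral => x _; rewrite indicE mem_set ?mul1r//= in_itv/= s2 ltW// (le_lt_trans t10).
  have KB r : `|K (cl r) s| <= \int[mu]_x (ut s x ^+ 2) + C.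
    have r2 := W12_L2 hW (le_trans t10 (cl1 r)).
    apply: (le_trans (young_Rint ltr01 s2' (gL2 r2))); rewrite invr1 !mul1r lerD2l.
    apply: (le_trans _ (HC (cl r) _)); last by rewrite cl1 cl2.
    apply: le_Rint; [exact: (gL2 r2).2|exact: r2.2|].
    move=> x; rewrite -[leLHS]normr2 -[leRHS]normr2 ler_sqr ?nnegrE//.
    exact: contraction_norm.
  have SB : `|S n s| <= \int[mu]_x (ut s x ^+ 2) + C.
    have := gstep_bound true n (s - m) (ltW L0) (le_trans (normr_ge0 _) (KB 0)) KB.
    by move/le_trans; apply; rewrite ler_piMr// (le_trans (normr_ge0 _) (KB 0)).
  rewrite E2; apply: (le_trans (half_norm _)); apply: (le_trans (ler_normD _ _)).
  by rewrite [leRHS]addrC addrA lerD2r.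
have e0 : \int[mu]_s e n s @[n --> \oo] --> \int[mu]_s (cst 0 s : R).
  apply: (@dctR_ae _ _ _ mu e (cst 0) D) => //.
  apply: ae_imp (ae_and good Hc) => s [gs Hs].
  rewrite /e indicE; have [sI|sI] := boolP (s \in `]t1, t2]%classic); last first.
    by under eq_fun do rewrite mulr0; exact: cvg_cst.
  move: (sI); rewrite inE/= in_itv/= => /andP[s1 s2]; have s2' := gs s1.
  have sL : - L < s - m <= L by move: Lm Lp s1 s2; lra.
  have cS : S n s @[n --> \oo] --> K s s.
    have -> : K s s = K (cl (s - m)) s.
      by rewrite clE ?addrA ?[m + s]addrC ?addrK//; case/andP: sL => /ltW ->.
    apply: (gstep_cvg (b := true) (h := fun r => K (cl r) s) (ltW L0) sL).
    move=> x y_ _ yx; apply: K_cvg => //; [exact: le_trans (cl1 _)|by move=> n; exact: le_trans (cl1 _)|].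
    apply/cvgrPdist_le => d d0; move/cvgrPdist_le : yx => /(_ _ d0).
    apply: filterS => n h; apply: (le_trans (clamp_lip _ _ _ _)).
    by rewrite opprD addrACA subrr add0r.
  have cSc : S n s + c @[n --> \oo] --> K s s + c by apply: cvgD => //; exact: cvg_cst.
  have cv : (S n s + c + `|S n s + c|) / 2 * 1 @[n --> \oo] --> (K s s + c + `|K s s + c|) / 2 * 1.
    apply: cvgM; last exact: cvg_cst.
    apply: cvgM; last exact: cvg_cst.
    by apply: cvgD => //; exact: cvg_norm.
  suff E0 : (K s s + c + `|K s s + c|) / 2 * 1 = 0 by rewrite E0 in cv.
  have h : K s s + c <= 0.
    by rewrite -lerBrDr sub0r; apply: Hs; rewrite s1 s2.
  by rewrite ler0_norm ?subrr ?mul0r.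
have fin n : E t2 - E t1 + c * (t2 - t1) <= \int[mu]_s e n s.
  have -> : c * (t2 - t1) = \int[mu]_s (c * \1_(`]t1, t2]%classic) s).
    by rewrite RintegralZl// Rint_itv// ltW.
  rewrite (le_trans (lerD (incr n) (lexx _)))//.
  have ic := intgZ c I1.
  have ie : intg mu (e n).
    apply: (@intg_dom _ _ _ mu (fun s => `|S n s + c * \1_(`]t1, t2]%classic) s|)).
    - exact: me.
    - by apply: intg_norm; exact: intgD.
    - move=> s; rewrite /e indicE; case: (boolP (s \in _)) => sI; last by rewrite mulr0 normr0.
      by rewrite !mulr1; exact: half_norm.
  rewrite -RintegralD//; apply: le_Rint => //; first exact: intgD.
  move=> s; rewrite /e indicE; case: (boolP (s \in _)) => sI.
    by rewrite !mulr1; have := ler_norm (S n s + c); lra.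
  by rewrite Sout// !mulr0 addr0.
have := cvg_le_near (seq_cvgN e0) (c := - (E t2 - E t1 + c * (t2 - t1))).
rewrite [\int[mu]_s cst 0 s](Rint0 mu) oppr0 => H.
have : 0 <= - (E t2 - E t1 + c * (t2 - t1)) by apply: H; apply: nearW => n; rewrite lerN2.
by rewrite /E; lra.
Qed.

End energy.

(** * Truncations of right-continuous functions *)

Section right_continuity.
Context (R : realType).
Implicit Types (f h U : R -> R).

Lemma rcsB f h : rcs f -> rcs h -> rcs (fun x => f x - h x).
Proof. by move=> rf rh x y_ xy yc; apply: cvgB; [exact: rf|exact: rh]. Qed.

Lemma rcsM f h : rcs f -> rcs h -> rcs (fun x => f x * h x).
Proof. by move=> rf rh x y_ xy yc; apply: cvgM; [exact: rf|exact: rh]. Qed.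

Lemma rcs_contraction (g : R -> R) U : contraction g -> rcs U -> rcs (g \o U).
Proof.
move=> gc rU x y_ xy yc; apply/cvgrPdist_le => e e0.
have := rU x y_ xy yc; move/cvgrPdist_le => /(_ _ e0).
by apply: filterS => n; apply: le_trans; exact: (contraction_lip (U x) (U (y_ n)) gc).
Qed.

Lemma rcs_indic_co (a b : R) : rcs (\1_(`[a, b[%classic) : R -> R).
Proof.
move=> x y_ xy yc.
have H : \forall n \near \oo, \1_(`[a, b[%classic) x = \1_(`[a, b[%classic) (y_ n) :> R.
  have [xb|bx] := ltP x b; last first.
    apply: nearW => n; have byn := le_trans bx (xy n).
    by rewrite !indicE !memNset//= in_itv/= ltNge ?bx ?byn andbF.
  have Hb : \forall n \near \oo, y_ n < b by exact: (cvgr_lt _ yc).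
  have [ax|xa] := leP a x.
    apply: filterS Hb => n yb; rewrite !indicE !mem_set//= in_itv/= ?ax ?xb//.
    by rewrite (le_trans ax (xy n)).
  have Ha : \forall n \near \oo, y_ n < a by exact: (cvgr_lt _ yc).
  by apply: filterS Ha => n ya; rewrite !indicE !memNset//= in_itv/= leNgt ?xa ?ya.
apply: (@cvg_trans _ ((cst (\1_(`[a, b[%classic) x) : nat -> R) @ \oo)); last exact: cvg_cst.
by apply: near_eq_cvg; apply: filterS H => n /= ->.
Qed.

Lemma contraction_max0 : contraction (fun s : R => Num.max s 0).
Proof.
split; first by rewrite maxxx.
by move=> s t st; case: (leP s 0) => ?; case: (leP t 0) => ?; apply/andP; split; lra.
Qed.

Lemma var_ge0 (v : nat -> R) n : 0 <= var v n.
Proof. by rewrite /var !addr_ge0// sumr_ge0. Qed.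

Lemma var_contraction (g : R -> R) (v : nat -> R) n : contraction g -> var (g \o v) n <= var v n.
Proof. by move=> gc; rewrite (var_split v n gc) lerDl var_ge0. Qed.

Lemma grid_pt (x d : R) : 0 < d -> \forall l \near \oo, \forall n \near \oo,
  exists2 i, (i <= n.+1)%N & x <= grid (l%:R : R) n i <= x + d.
Proof.
move=> d0.
have Hl : \forall l \near \oo, `|x| < (l%:R : R).
  exists (Num.bound `|x|).+1 => // l /= hl; apply: (lt_le_trans (archi_boundP (normr_ge0 x))).
  by rewrite ler_nat ltnW.
apply: filterS Hl => l xl.
have Hm : \forall n \near \oo, 2 * (l%:R : R) / n.+1%:R < d by exact: (cvgr_lt _ (mesh_cvg _)).
apply: filterS Hm => n nd.
have xl' : - (l%:R : R) < x <= l%:R.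
  by move: xl; rewrite ltr_norml => /andP[-> /ltW ->].
have [i /andP[ix xi]] := grid_loc n (ler0n R l) xl'.
exists i.+1; first exact: ltn_ord.
by rewrite xi/= grid_step; move: (grid _ _ _) (_ / _) ix nd => A B; lra.
Qed.

End right_continuity.

Section calibrated_decay.
Context (R : realType).
Local Notation mu := (@lebesgue_measure R).

Lemma contraction_L2 (g : R -> R -> R) v : (forall x, contraction (g x)) ->
  (forall v : R -> R, measurable_fun setT v -> measurable_fun setT (fun x => g x (v x))) ->
  L2 mu v -> L2 mu (fun x => g x (v x)).
Proof.
move=> gc gm v2; apply: (@L2_dom _ _ _ mu v) => //; first exact: gm v2.1.
by move=> x; exact: contraction_norm.
Qed.

(** The competitor is U - g(U). *)
Lemma calibrated_decay M (v vt : R -> R) (g : R -> R -> R) c : calibrated M v vt ->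
  (forall x, contraction (g x)) ->
  (forall v : R -> R, measurable_fun setT v -> measurable_fun setT (fun x => g x (v x))) ->
  (forall U, rcs U -> measurable_fun setT U -> {ae mu, forall x, v x = U x} ->
     rcs (fun x => g x (U x)) /\
     \forall l \near \oo, \forall n \near \oo,
       var ((fun x => U x - g x (U x)) \o grid l%:R n) n.+1 <= var (U \o grid l%:R n) n.+1 - c) ->
  \int[mu]_x (vt x * g x (v x)) <= - c.
Proof.
move=> [U [[rU mU UM vU] [v2 vt2 H _]]] gc gm HU.
have [rg Hv] := HU _ rU mU vU.
have U2 : L2 mu U by apply: L2_ae vU v2.
have gU2 := contraction_L2 gc gm U2; have gv2 := contraction_L2 gc gm v2.
have -> : \int[mu]_x (vt x * g x (v x)) = \int[mu]_x ((U x - (U x - g x (U x))) * vt x).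
  apply: Rint_ae.
  - by apply: measurable_funM; [exact: vt2.1|exact: gv2.1].
  - apply: measurable_funM; last exact: vt2.1.
    by apply: measurable_funB => //; apply: measurable_funB => //; exact: gU2.1.
  - by apply: ae_imp vU => x ->; rewrite opprB addrC subrK mulrC.
apply: (H (fun x => U x - g x (U x)) (M + M)) => //.
- exact: rcsB.
- exact: L2B.
- move=> x; apply: (le_trans (ler_normB _ _)); apply: lerD => //.
  exact: (le_trans (contraction_norm _ (gc x))).
Qed.

End calibrated_decay.

(** * Sign and support bound *)

Section positivity.
Context (R : realType).
Local Notation mu := (@lebesgue_measure R).
Variables (u ut : R -> R -> R) (M a b : R).
Hypothesis hW : W12loc_L2 u ut.
Hypothesis hC : {ae mu, forall t, 0 < t -> calibrated M (u t) (ut t)}.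
Hypothesis u00 : {ae mu, forall x, 0 <= u 0 x}.
Hypothesis u0s : {ae mu, forall x, ~ `[a, b[%classic x -> u 0 x = 0}.

Let g (x s : R) := s - \1_(`[a, b[%classic) x * Num.max s 0.
Let F (x s : R) := g x s ^+ 2 / 2.

Let gE x s : g x s = if x \in `[a, b[%classic then s - Num.max s 0 else s.
Proof. by rewrite /g indicE; case: (_ \in _); rewrite ?mul1r ?mul0r ?subr0. Qed.

Let gc x : contraction (g x).
Proof.
split => [|s t st]; rewrite !gE; case: (_ \in _) => //; rewrite ?maxxx ?subrr//.
  by case: (leP s 0) => ?; case: (leP t 0) => ?; apply/andP; split; lra.
by rewrite lexx subr_ge0 st.
Qed.

Let gm (v : R -> R) : measurable_fun setT v -> measurable_fun setT (fun x => g x (v x)).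
Proof.
move=> mv; apply: measurable_funB => //; apply: measurable_funM; first exact: indic_itv_meas.
exact: measurable_maxr.
Qed.

Let Fm (v : R -> R) : measurable_fun setT v -> measurable_fun setT (fun x => F x (v x)).
Proof.
move=> mv; apply: measurable_funM => //; apply: measurable_funX; exact: gm.
Qed.

Let F2 x s : `|F x s| <= s ^+ 2.
Proof.
rewrite /F normrM normrX (@ger0_norm _ 2^-1)//.
have := contraction_norm s (gc x); rewrite -(ler_sqr _ _)// => h.
by have := sqr_ge0 s; rewrite normr2 in h *; move: h; rewrite normr2; lra.
Qed.

Let FS x s r : F x r - F x s <= g x r * (r - s).
Proof.
rewrite /F !gE; case: (_ \in _); last by have := sqr_ge0 (r - s); nra.
case: (leP s 0) => hs; case: (leP r 0) => hr; rewrite ?subr0 ?subrr ?expr0n/= ?mul0r ?subr0.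
- by have := sqr_ge0 (r - s); nra.
- by have := sqr_ge0 s; lra.
- by nra.
- by [].
Qed.

Let decay0 t : 0 <= t -> \int[mu]_x F x (u t x) - \int[mu]_x F x (u 0 x) <= 0.
Proof.
move=> t0; have := @energy_decay R u ut hW g F gc gm Fm F2 FS 0 t 0 (lexx 0) t0.
rewrite oppr0 mul0r; apply.
apply: ae_imp hC => s Cs /andP[s0 _].
rewrite -[leRHS]oppr0; apply: (calibrated_decay (Cs s0)) => // U rU mU _; split.
  apply: rcsB => //; apply: rcsM; first exact: rcs_indic_co.
  by apply: (@rcs_contraction R (fun s => Num.max s 0) U); [exact: contraction_max0|exact: rU].
apply: nearW => l; apply: nearW => n; rewrite subr0.
set p := grid l%:R n; have ph := grid_homo n (ler0n R l).
pose v := (fun s => Num.max s 0) \o (U \o p).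
rewrite (@eq_var _ _ (fun i => if a <= p i then (if p i < b then v i else 0) else 0)); last first.
  move=> i _ /=; rewrite /g opprB addrC subrK indicE.
  have -> : (p i \in `[a, b[%classic) = (a <= p i) && (p i < b).
    by apply/idP/idP; rewrite inE/= in_itv.
  by case: (a <= p i); case: (p i < b); rewrite /= ?mul1r ?mul0r.
apply: (le_trans (var_cutl _ _ _)) => [i /le_trans|]; first by apply; exact: ph.
apply: (le_trans (var_cutr _ _ _)) => [i|]; first by apply: le_lt_trans; exact: ph.
exact: (var_contraction (U \o p) n.+1 (contraction_max0 R)).
Qed.

(** The energy with derivative g(x, s) = s - 1_[a,b[ s_+ vanishes initially and is
    not increased, since the competitor 1_[a,b[ U_+ has less variation than U. *)
Lemma flow_nneg t : 0 <= t ->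
  {ae mu, forall x, 0 <= u t x /\ (~ `[a, b[%classic x -> u t x = 0)}.
Proof.
move=> t0; have ut2 := W12_L2 hW t0; have u02 := W12_L2 hW (lexx 0).
have F0 : \int[mu]_x F x (u 0 x) = 0.
  rewrite -[RHS](Rint0 mu); apply: (@Rint_ae _ _ _ mu (fun x => F x (u 0 x)) (cst 0)) => //.
    by apply: Fm; exact: u02.1.
  apply: ae_imp (ae_and u00 u0s) => x [h1 h2]; rewrite /F gE.
  have [xI|xI] := boolP (x \in `[a, b[%classic); first by rewrite max_l// subrr expr0n/= mul0r.
  by rewrite h2 ?expr0n/= ?mul0r//; move/negP: xI; rewrite inE.
have iF : intg mu (fun x => F x (u t x)).
  by apply: (@intg_dom _ _ _ mu (fun x => u t x ^+ 2)); [by apply: Fm; exact: ut2.1|exact: ut2.2|move=> x; exact: F2].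
have aF : {ae mu, forall x, F x (u t x) = 0}.
  apply: Rint_eq0_ae => //.
    by apply: aeW => x; rewrite /F divr_ge0// sqr_ge0.
  by have := decay0 t0; rewrite F0 subr0.
apply: ae_imp aF => x /eqP; rewrite /F mulf_eq0 expf_eq0/= invr_eq0 pnatr_eq0 orbF gE => /eqP.
have [xI|xI] := boolP (x \in `[a, b[%classic).
  move/eqP; rewrite subr_eq0 => /eqP E; split; first by rewrite E le_max lexx orbT.
  by move=> nI; exfalso; apply: nI; rewrite inE in xI.
by move=> ->; split.
Qed.

End positivity.

(** * Mass above a level *)

Section truncation.
Context (R : realType).
Implicit Types (k e s r : R).

Definition excess k s : R := Num.max (s - k) 0.
Definition trunc k e s : R := Num.min (excess k s) e.
(** A primitive of [trunc k e], written so that the bounds by multiples of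
    [excess] are polynomial inequalities. *)
Definition truncF k e s : R := trunc k e s * (s - k) - trunc k e s ^+ 2 / 2.

Lemma excess_ge0 k s : 0 <= excess k s. Proof. by rewrite le_max lexx orbT. Qed.

Lemma excess_le k s : 0 <= k -> excess k s <= `|s|.
Proof. by move=> k0; rewrite ge_max normr_ge0 andbT; have := ler_norm s; lra. Qed.

Variant trunc_spec k e s : R -> R -> Type :=
| TruncLow : s <= k -> trunc_spec k e s 0 0
| TruncMid : k < s -> s <= k + e -> trunc_spec k e s (s - k) (s - k)
| TruncHigh : k + e < s -> trunc_spec k e s (s - k) e.

Lemma truncP k e s : 0 < e -> trunc_spec k e s (excess k s) (trunc k e s).
Proof.
move=> e0; rewrite /trunc /excess.
have [sk|ks] := leP (s - k) 0.
  by rewrite min_l ?ltW//; constructor; lra.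
by have [h|h] := leP (s - k) e; constructor; lra.
Qed.

Lemma contraction_trunc k e : 0 <= k -> 0 < e -> contraction (trunc k e).
Proof.
move=> k0 e0; split; first by case: truncP => //; lra.
by move=> s t st; case: truncP => // *; case: truncP => // *; apply/andP; split; lra.
Qed.

Lemma truncF_norm k e s : 0 <= k -> 0 < e -> `|truncF k e s| <= s ^+ 2.
Proof.
move=> k0 e0; rewrite /truncF; case: truncP => // [sk|ks se|es].
- by rewrite mul0r expr0n/= mul0r subrr normr0 sqr_ge0.
- rewrite ger0_norm; last by have := sqr_ge0 (s - k); lra.
  by have : (s - k) ^+ 2 <= s ^+ 2 by [rewrite ler_sqr ?nnegrE; lra]; have := sqr_ge0 (s - k); lra.
- have h : (s - k) ^+ 2 <= s ^+ 2 by rewrite ler_sqr ?nnegrE; lra.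
  have h2 := sqr_ge0 (s - k - e); rewrite ger0_norm; last by nra.
  by have := sqr_ge0 (s - k); nra.
Qed.

Lemma truncFS k e s r : 0 < e ->
  truncF k e r - truncF k e s <= trunc k e r * (r - s).
Proof.
move=> e0; have h1 := sqr_ge0 (r - s); have h2 := sqr_ge0 (r - k - e).
have h3 := sqr_ge0 (s - k - e).
by rewrite /truncF; case: truncP => // *; case: truncP => // *; nra.
Qed.

Lemma truncF_excess k e s : 0 < e ->
  e * excess k s - e ^+ 2 / 2 <= truncF k e s <= e * excess k s.
Proof.
move=> e0; rewrite /truncF; case: truncP => // *; apply/andP; split; nra.
Qed.

Lemma excess_meas k (v : R -> R) : measurable_fun setT v ->
  measurable_fun setT (fun x => excess k (v x)).
Proof. by move=> mv; apply: measurable_maxr => //; exact: measurable_funB. Qed.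

Lemma trunc_meas k e (v : R -> R) : measurable_fun setT v ->
  measurable_fun setT (fun x => trunc k e (v x)).
Proof. by move=> mv; apply: measurable_minr => //; exact: excess_meas. Qed.

Lemma truncF_meas k e (v : R -> R) : measurable_fun setT v ->
  measurable_fun setT (fun x => truncF k e (v x)).
Proof.
move=> mv; apply: measurable_funB.
  by apply: measurable_funM; [exact: trunc_meas|exact: measurable_funB].
by apply: measurable_funM => //; apply: measurable_funX; exact: trunc_meas.
Qed.

Lemma trunc_high (k e s : R) : 0 < e -> k + e < s -> trunc k e s = e.
Proof. by move=> e0; case: truncP => // *; lra. Qed.

Lemma trunc_low (k e s : R) : 0 < e -> s < k -> trunc k e s = 0.
Proof. by move=> e0; case: truncP => // *; lra. Qed.

Lemma rcs_gt (U : R -> R) (c x : R) : rcs U -> c < U x ->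
  exists2 d, 0 < d & forall y, x <= y <= x + d -> c < U y.
Proof.
move=> rU cx; have e0 : 0 < (U x - c) / 2 by lra.
have [d d0 Hd] := rcs_near x rU e0; exists d => // y /Hd; rewrite ler_norml; lra.
Qed.

Lemma rcs_lt (U : R -> R) (c x : R) : rcs U -> U x < c ->
  exists2 d, 0 < d & forall y, x <= y <= x + d -> U y < c.
Proof.
move=> rU cx; have e0 : 0 < (c - U x) / 2 by lra.
have [d d0 Hd] := rcs_near x rU e0; exists d => // y /Hd; rewrite ler_norml; lra.
Qed.

End truncation.

Section levels.
Context (R : realType).
Local Notation mu := (@lebesgue_measure R).
Variables (u ut : R -> R -> R) (M a b : R).
Hypothesis ab : a < b.
Hypothesis hW : W12loc_L2 u ut.
Hypothesis hC : {ae mu, forall t, 0 < t -> calibrated M (u t) (ut t)}.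
Hypothesis hN : forall t, 0 <= t ->
  {ae mu, forall x, 0 <= u t x /\ (~ `[a, b[%classic x -> u t x = 0)}.

Let I1 : intg mu (\1_(`[a, b[%classic) : R -> R).
Proof. exact: intg_bnd. Qed.

Lemma flow_intg t : 0 <= t -> intg mu (u t).
Proof.
move=> t0; have ut2 := W12_L2 hW t0.
have I2 : L2 mu (\1_(`[a, b[%classic) : R -> R).
  exact: L2_bnd.
apply: (@intg_ae _ _ _ mu (fun x => u t x * \1_(`[a, b[%classic) x)); first exact: ut2.1.
  apply: ae_imp (hN t0) => x [_ h]; rewrite indicE.
  by have [xI|xI] := boolP (x \in _); rewrite ?mulr1// h ?mul0r//; move/negP: xI; rewrite inE.
exact: L2_mul.
Qed.

Definition level k t : R := \int[mu]_x excess k (u t x).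

Lemma excess_intg k t : 0 <= k -> 0 <= t ->
  intg mu (fun x => excess k (u t x)).
Proof.
move=> k0 t0; apply: (@intg_dom _ _ _ mu (fun x => `|u t x|)).
- by apply: excess_meas; exact: (W12_L2 hW t0).1.
- exact/intg_norm/flow_intg.
- by move=> x; rewrite ger0_norm ?excess_ge0// excess_le.
Qed.

Lemma level_ge0 k t : 0 <= level k t.
Proof. by apply: Rintegral_ge0 => x _; exact: excess_ge0. Qed.

Lemma level_out k t x : 0 <= k -> 0 <= u t x /\ (~ `[a, b[%classic x -> u t x = 0) ->
  ~ `[a, b[%classic x -> excess k (u t x) = 0.
Proof. by move=> k0 [_ h] /h ->; rewrite /excess max_r// sub0r oppr_le0. Qed.

(** The excess over k exceeds the one over l by at most l - k, and only on [a, b[. *)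
Lemma level_anti k l t : 0 <= t -> 0 <= k -> k <= l ->
  level l t <= level k t <= level l t + (l - k) * (b - a).
Proof.
move=> t0 k0 kl; have l0 := le_trans k0 kl.
have i1 := excess_intg k0 t0; have i2 := excess_intg l0 t0.
apply/andP; split.
  by apply: le_Rint => // x; rewrite /excess ge_max !le_max lexx orbT andbT; apply/orP; left; lra.
rewrite -(Rint_itv true true (ltW ab)) -RintegralZl// /level -RintegralD//; last exact: intgZ.
apply: le_Rint_ae => //; first by apply: intgD => //; exact: intgZ.
apply: ae_imp (hN t0) => x hx; have [xI|xI] := pselect (`[a, b[%classic x).
  rewrite indicE mem_set// mulr1; rewrite /excess.
  by case: (leP (u t x - k) 0) => ?; case: (leP (u t x - l) 0) => ?; lra.
by rewrite (level_out k0 hx xI) addr_ge0 ?excess_ge0// mulr_ge0// subr_ge0.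
Qed.

Lemma level0 t : 0 <= t -> level 0 t = \int[mu]_x u t x.
Proof.
move=> t0; apply: Rint_ae.
- by apply: excess_meas; exact: (W12_L2 hW t0).1.
- exact: (W12_L2 hW t0).1.
- by apply: ae_imp (hN t0) => x [h _]; rewrite /excess subr0 max_l.
Qed.

Lemma level_gt0 k t U : 0 < level k t -> {ae mu, forall x, u t x = U x} ->
  0 <= t -> 0 <= k -> exists x, k < U x.
Proof.
move=> lk uU t0 k0; apply: contrapT => H.
suff : level k t = 0 by move=> E; rewrite E ltxx in lk.
rewrite -[RHS](Rint0 mu); apply: (@Rint_ae _ _ _ mu _ (cst 0)) => //.
  by apply: excess_meas; exact: (W12_L2 hW t0).1.
apply: ae_imp uU => x ->; rewrite /excess max_r// subr_le0 leNgt; apply/negP => h.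
by apply: H; exists x.
Qed.

(** The truncated excess g = trunc k e has a primitive close to e times the excess:
    [energy_decay] with the variation of g(U) as a rate, divided by e. *)
Lemma level_decay_trunc k e c t1 t2 : 0 <= k -> 0 < e -> 0 <= t1 -> t1 <= t2 ->
  {ae mu, forall s, t1 < s <= t2 -> forall U, rcs U -> {ae mu, forall x, u s x = U x} ->
     \forall l \near \oo, \forall n \near \oo,
       c * e <= var (trunc k e \o (U \o grid l%:R n)) n.+1} ->
  level k t2 <= level k t1 - c * (t2 - t1) + e * (b - a) / 2.
Proof.
move=> k0 e0 t10 t12 Hv; have t20 := le_trans t10 t12.
have gc (x : R) := contraction_trunc k0 e0.
have gm (v : R -> R) : measurable_fun setT v -> measurable_fun setT (fun x => trunc k e (v x)).
  exact: trunc_meas.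
have := @energy_decay R u ut hW (fun=> trunc k e) (fun=> truncF k e) gc gm
  (fun v mv => truncF_meas k e mv) (fun _ s => truncF_norm s k0 e0)
  (fun _ s r => truncFS k s r e0) t1 t2 (c * e) t10 t12.
have Fi t : 0 <= t -> intg mu (fun x => truncF k e (u t x)).
  move=> t0; have u2 := W12_L2 hW t0.
  apply: (@intg_dom _ _ _ mu (fun x => u t x ^+ 2)); [exact: truncF_meas u2.1|exact: u2.2|].
  by move=> x; exact: truncF_norm.
have Fu t : 0 <= t -> \int[mu]_x truncF k e (u t x) <= e * level k t.
  move=> t0; rewrite -RintegralZl//; last exact: excess_intg.
  apply: le_Rint; [exact: Fi|exact/intgZ/excess_intg|].
  by move=> x; have /andP[] := truncF_excess k (u t x) e0.
have Fl t : 0 <= t -> e * level k t - e ^+ 2 / 2 * (b - a) <= \int[mu]_x truncF k e (u t x).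
  move=> t0; rewrite -(Rint_itv true true (ltW ab)) -RintegralZl//; last exact: excess_intg.
  rewrite -RintegralZl// -RintegralB//; [|exact/intgZ/excess_intg|exact: intgZ].
  apply: le_Rint_ae; [exact/intgB/intgZ/I1/intgZ/excess_intg|exact: Fi|].
  apply: ae_imp (hN t0) => x hx; have /andP[h1 _] := truncF_excess k (u t x) e0.
  have [xI|xI] := pselect (`[a, b[%classic x); first by rewrite indicE mem_set// mulr1.
  have ex := level_out k0 hx xI; rewrite ex indicE memNset// mulr0 mulr0 subrr.
  have uk : u t x <= k by have := ex; rewrite /excess => h; have : u t x - k <= 0 by [rewrite -h le_max lexx]; lra.
  by rewrite /truncF; case: truncP => // *; lra.
have Hae : {ae mu, forall s, t1 < s <= t2 -> \int[mu]_x (ut s x * trunc k e (u s x)) <= - (c * e)}.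
  apply: ae_imp (ae_and hC Hv) => s [Cs Hs] /andP[s1 s2].
  apply: (@calibrated_decay _ _ _ _ (fun=> trunc k e) _ (Cs (le_lt_trans t10 s1))) => // U rU mU uU; split.
    by apply: (@rcs_contraction R (trunc k e) U) => //; exact: gc 0.
  have := Hs _ U rU uU; rewrite s1 s2 => /(_ isT).
  apply: filterS => l; apply: filterS => n Hn.
  rewrite (var_split (U \o grid l%:R n) n.+1 (gc 0)) addrAC.
  by rewrite lerDr subr_ge0.
move=> /(_ Hae); have := Fu _ t10; have := Fl _ t20; move: (\int[mu]_x _) (\int[mu]_x _) => A B h1 h2 h3.
rewrite -(ler_pM2l e0) mulrDr mulrBr.
have -> : e * (e * (b - a) / 2) = e ^+ 2 / 2 * (b - a) by ring.
have -> : e * (c * (t2 - t1)) = c * e * (t2 - t1) by ring.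
by rewrite mulNr in h3; lra.
Qed.

(** The error of the previous lemma vanishes as e tends to 0. *)
Lemma level_decay k e0 c t1 t2 : 0 <= k -> 0 < e0 -> 0 <= t1 -> t1 <= t2 ->
  (forall e, 0 < e -> e <= e0 ->
  {ae mu, forall s, t1 < s <= t2 -> forall U, rcs U -> {ae mu, forall x, u s x = U x} ->
     \forall l \near \oo, \forall n \near \oo,
       c * e <= var (trunc k e \o (U \o grid l%:R n)) n.+1}) ->
  level k t2 <= level k t1 - c * (t2 - t1).
Proof.
move=> k0 e00 t10 t12 He; apply/ler_addgt0Pr => d d0.
pose e := Num.min e0 (d / (b - a)).
have ba : 0 < b - a by rewrite subr_gt0.
have e_0 : 0 < e by rewrite lt_min e00 divr_gt0.
have ed : e * (b - a) <= d by rewrite -ler_pdivlMr// ge_min lexx orbT.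
have := level_decay_trunc k0 e_0 t10 t12 (He _ e_0 _); rewrite ge_min lexx => /(_ isT).
by lra.
Qed.

Lemma level_noninc k t1 t2 : 0 <= k -> 0 <= t1 -> t1 <= t2 -> level k t2 <= level k t1.
Proof.
move=> k0 t10 t12; have := @level_decay k 1 0 t1 t2 k0 ltr01 t10 t12.
rewrite mul0r subr0; apply => e e0 _; apply: aeW => s _ U _ _.
by apply: nearW => l; apply: nearW => n; rewrite mul0r var_ge0.
Qed.

(** U exceeds k + e somewhere at every time s <= t2, because the level is monotone
    in time; there the truncated excess has a peak of height e. *)
Lemma level_peak k t1 t2 : 0 <= k -> 0 <= t1 -> t1 <= t2 -> 0 < level k t2 ->
  level k t2 <= level k t1 - 2 * (t2 - t1).
Proof.
move=> k0 t10 t12 l2; have t20 := le_trans t10 t12.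
have ba : 0 < b - a by rewrite subr_gt0.
pose e0 := level k t2 / (2 * (b - a)).
have e00 : 0 < e0 by rewrite divr_gt0// mulr_gt0.
apply: (@level_decay k e0) => // e ep ee0; apply: aeW => s /andP[s1 s2] U rU uU.
have s0 : 0 <= s by rewrite (le_trans t10)// ltW.
have lks : 0 < level (k + e) s.
  apply: (lt_le_trans _ (level_noninc (addr_ge0 k0 (ltW ep)) s0 s2)).
  have /andP[_] := @level_anti k (k + e) t2 t20 k0 (ltac:(by rewrite lerDl ltW)).
  rewrite [k + e]addrC addrK => h1.
  have h2 : e * (b - a) <= e0 * (b - a) by rewrite ler_wpM2r// ltW.
  have h3 : e0 * (b - a) = level k t2 / 2 by rewrite /e0; field; rewrite gt_eqF.
  by move: h1 h2; rewrite h3; lra.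
have [x kx] := level_gt0 lks uU s0 (addr_ge0 k0 (ltW ep)).
have [d d0 Hd] := rcs_gt rU kx.
apply: filterS (grid_pt x d0) => l; apply: filterS => n [i ni xi].
apply: le_trans (var_peak _ ni); rewrite /= trunc_high//; exact: Hd.
Qed.

(** Between two peaks of height e the truncated excess comes back to 0, which adds
    another 2 e to its variation. *)
Lemma level_valley k e0 t1 t2 : 0 <= k -> 0 < e0 -> 0 <= t1 -> t1 <= t2 ->
  {ae mu, forall s, t1 < s <= t2 -> forall U, rcs U -> {ae mu, forall x, u s x = U x} ->
     exists x y z, [/\ x < y, y < z, k + e0 < U x, U y < k & k + e0 < U z]} ->
  level k t2 <= level k t1 - 4 * (t2 - t1).
Proof.
move=> k0 e00 t10 t12 H; apply: (@level_decay k e0) => // e ep ee0.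
apply: ae_imp H => s Hs s12 U rU uU.
have [x [y [z [xy yz kx ky kz]]]] := Hs s12 U rU uU.
have [d1 d10 H1] := rcs_gt rU kx; have [d2 d20 H2] := rcs_lt rU ky.
have [d3 d30 H3] := rcs_gt rU kz.
pose c1 := Num.min d1 ((y - x) / 2); pose c2 := Num.min d2 ((z - y) / 2).
have c10 : 0 < c1 by rewrite lt_min d10; lra.
have c20 : 0 < c2 by rewrite lt_min d20; lra.
have [cd1 cy] : c1 <= d1 /\ c1 <= (y - x) / 2 by rewrite !ge_min !lexx orbT.
have [cd2 cz] : c2 <= d2 /\ c2 <= (z - y) / 2 by rewrite !ge_min !lexx orbT.
apply: filterS (filterI (grid_pt x c10) (filterI (grid_pt y c20) (grid_pt z d30))) => l [G1 [G2 G3]].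
apply: filterS (filterI G1 (filterI G2 G3)) => n [[i ni xi] [[j nj yj] [m nm zm]]].
have lt_idx p q : grid (l%:R : R) n p < grid (l%:R : R) n q -> (p <= q)%N.
  move=> pq; rewrite leqNgt; apply/negP => /ltnW qp.
  by have := lt_le_trans pq (grid_homo n (ler0n R l) qp); rewrite ltxx.
have ij : (i <= j)%N by apply: lt_idx; lra.
have jm : (j <= m)%N by apply: lt_idx; lra.
have := var_valley (trunc k e \o (U \o grid (l%:R : R) n)) ij jm nm.
rewrite /= (@trunc_high _ k e (U (grid _ _ i)))//; last first.
  by apply: (le_lt_trans _ (H1 (grid l%:R n i) _)); [rewrite lerD2l|lra].
rewrite (@trunc_high _ k e (U (grid _ _ m)))//; last first.
  by apply: (le_lt_trans _ (H3 (grid l%:R n m) _)); [rewrite lerD2l|lra].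
rewrite (@trunc_low _ k e (U (grid _ _ j)))//; last by apply: H2; lra.
by move: (var _ _) => V; lra.
Qed.

Definition mass t : R := \int[mu]_x u t x.

(** The mass lost per unit of time is the difference of two values of z. *)
Lemma mass_ge t : 0 <= t -> mass 0 - 2 * t <= mass t.
Proof.
move=> t0.
have I2 : L2 mu (\1_(`]a, b]%classic) : R -> R).
  exact: L2_bnd.
have E s : 0 <= s -> mass s = \int[mu]_x (u s x * \1_(`]a, b]%classic) x).
  move=> s0; have us2 := W12_L2 hW s0; apply: Rint_ae.
  - exact: us2.1.
  - by apply: measurable_funM; [exact: us2.1|exact: I2.1].
  - apply: ae_imp (ae_and (hN s0) (ae_neq a)) => x [[_ h] xa]; rewrite indicE.
    have [|xI] := boolP (x \in `]a, b]%classic); first by rewrite mulr1.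
    rewrite mulr0 h//= in_itv/= => /andP[ax xb]; move/negP: xI; apply.
    by rewrite inE/= in_itv/= lt_neqAle eq_sym xa ax ltW.
suff : - (2 * t) <= mass t - mass 0 by lra.
rewrite !E// (W12_increment hW I2 (lexx 0) t0) -subr_ge0 opprK.
have := t0; rewrite le_eqVlt => /orP[/eqP <-|tp].
  under eq_Rintegral do rewrite set_itvoc0 indic0 mul0r.
  by rewrite Rint0 mulr0 addr0.
have iK := dual_intg hW (lexx 0) tp I2.
have I0 : intg mu (\1_(`]0, t]%classic) : R -> R).
  exact: intg_bnd.
have -> : 2 * t = \int[mu]_s (2 * \1_(`]0, t]%classic) s).
  by rewrite RintegralZl// Rint_itv// subr0.
rewrite -RintegralD//; last exact: intgZ.
apply: Rint_ge0_ae.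
  exact: measurable_funD (intg_meas iK) (intg_meas (intgZ 2 I0)).
apply: ae_imp hC => s Cs; rewrite indicE; have [sI|_] := boolP (s \in _); last first.
  by rewrite mul0r mulr0 addr0.
rewrite inE/= in_itv/= in sI; have /andP[s0 _] := sI.
have [U [_ [_ _ _ Hz]]] := Cs s0; have := Hz a b (ltW ab).
rewrite mul1r mulr1 (_ : \int[mu]_x (\1_(`]a, b]%classic) x * ut s x) = \int[mu]_x (ut s x * \1_(`]a, b]%classic) x)).
  by lra.
by apply: eq_Rintegral => x _; rewrite mulrC.
Qed.

(** While there is mass left, [level_peak] at the level 0 is the inequality opposite
    to [mass_ge]. *)
Lemma mass_eq t : 0 <= t -> 2 * t < mass 0 -> mass t = mass 0 - 2 * t.
Proof.
move=> t0 tm; have h := mass_ge t0; apply/eqP; rewrite eq_le h andbT.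
have := @level_peak 0 0 t (lexx 0) (lexx 0) t0; rewrite !level0// subr0; apply.
by apply: lt_le_trans h; rewrite subr_gt0.
Qed.

(** The total mass decreases at rate exactly 2 and the mass above k at rate at
    least 2. *)
Lemma below_mono k t1 t2 : 0 <= k -> 0 <= t1 -> t1 <= t2 -> 2 * t2 < mass 0 ->
  0 < level k t2 -> mass t1 - level k t1 <= mass t2 - level k t2.
Proof.
move=> k0 t10 t12 tm lk; have := level_peak k0 t10 t12 lk.
have tm1 : 2 * t1 < mass 0 by apply: le_lt_trans tm; rewrite ler_wpM2l.
rewrite (mass_eq t10 tm1) (mass_eq (le_trans t10 t12) tm).
by move: (level _ _) (level _ _) (mass 0) => A B C; lra.
Qed.

Lemma below_le k t : 0 <= k -> 0 <= t -> mass t - level k t <= k * (b - a).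
Proof.
move=> k0 t0; have := @level_anti 0 k t t0 (lexx 0) k0; rewrite level0// subr0 -/(mass t).
by lra.
Qed.

End levels.

(** * Extended support *)

Section extended_support.
Context (R : realType).
Local Notation mu := (@lebesgue_measure R).
Implicit Type f : R -> R.

Lemma ess_supp_sub_ext f : ess_supp f `<=` ext_supp f.
Proof. by move=> x fx I [_ _]; exact. Qed.

(** The open sets on which f vanishes may be taken among countably many intervals
    with rational ends. *)
Lemma ae0_out_ess_supp f : {ae mu, forall x, ~ ess_supp f x -> f x = 0}.
Proof.
pose Z (w : rat * rat) := {ae mu, forall x, ratr w.1 < x < ratr w.2 -> f x = 0}.
pose P n x := if (unpickle n : option (rat * rat)) is Some w then
  Z w -> ratr w.1 < x < ratr w.2 -> f x = 0 else True.
have HP n : {ae mu, forall x, P n x}.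
  rewrite /P; case: unpickle => [w|]; last exact: aeW.
  have [Zw|nZ] := pselect (Z w); last exact: aeW.
  by apply: ae_imp Zw => x Hx _.
apply: ae_imp (ae_all HP) => x Px /contrapT [U [oU Ux U0]].
have /nbhs_ballP [e /= e0 He] : nbhs x U by exact: open_nbhs_nbhs.
have xe1 : x - e < x by rewrite gtrBl.
have xe2 : x < x + e by rewrite ltrDl.
have [r] := rat_in_itvoo xe1; rewrite in_itv/= => /andP[r1 r2].
have [s] := rat_in_itvoo xe2; rewrite in_itv/= => /andP[s1 s2].
have := Px (pickle (r, s)); rewrite /P pickleK /=; apply; last by rewrite r2.
apply: ae_imp U0 => y Uy /andP[ry ys]; apply/Uy/He.
by rewrite /ball/= ltr_norml; lra.
Qed.

Variables (f : R -> R) (a b : R).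
Hypothesis fab : ext_supp f = `[a, b]%classic.

Lemma ae0_out_ext_supp : {ae mu, forall x, ~ `[a, b]%classic x -> f x = 0}.
Proof.
apply: ae_imp (ae0_out_ess_supp f) => x fx nx; apply: fx => sx; apply: nx.
by rewrite -fab; exact: ess_supp_sub_ext.
Qed.

(** Otherwise the closed interval [a + d, +oo[ would contain the support. *)
Lemma ext_supp_left d : a < b -> 0 < d -> ~ {ae mu, forall x, a <= x < a + d -> f x = 0}.
Proof.
move=> ab d0 H.
have : ext_supp f a by rewrite fab /= in_itv/= lexx ltW.
move=> /(_ `[a + d, +oo[%classic); rewrite /= in_itv/= andbT; apply/not_implyP; split; last first.
  by apply/negP; rewrite -ltNge ltrDl.
split; [exact: interval_closed|exact: interval_is_interval|].
move=> x sx; rewrite /= in_itv/= andbT leNgt; apply/negP => xd; apply: sx.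
exists `]-oo, a + d[%classic; split; [exact: interval_open|by rewrite /= in_itv|].
apply: ae_imp (ae_and H ae0_out_ext_supp) => y [h1 h2]; rewrite /= in_itv/= => yd.
have [ay|ya] := leP a y; first by apply: h1; rewrite ay.
by apply: h2; rewrite /= in_itv/= leNgt ya.
Qed.

Lemma ext_supp_right d : a < b -> 0 < d -> ~ {ae mu, forall x, b - d < x <= b -> f x = 0}.
Proof.
move=> ab d0 H.
have : ext_supp f b by rewrite fab /= in_itv/= lexx ltW.
move=> /(_ `]-oo, b - d]%classic); rewrite /= in_itv/=; apply/not_implyP; split; last first.
  by apply/negP; rewrite -ltNge gtrBl.
split; [exact: interval_closed|exact: interval_is_interval|].
move=> x sx; rewrite /= in_itv/= leNgt; apply/negP => xd; apply: sx.
exists `]b - d, +oo[%classic; split; [exact: interval_open|by rewrite /= in_itv/= andbT|].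
apply: ae_imp (ae_and H ae0_out_ext_supp) => y [h1 h2]; rewrite /= in_itv/= andbT => yd.
have [yb|by_] := leP y b; first by apply: h1; rewrite yd.
by apply: h2; rewrite /= in_itv/= [y <= b]leNgt by_ andbF.
Qed.

End extended_support.

(** * Filling the support and extinction *)

Section profile.
Context (R : realType).
Local Notation mu := (@lebesgue_measure R).
Variables (u ut : R -> R -> R) (M a b : R).
Hypothesis ab : a < b.
Hypothesis hW : W12loc_L2 u ut.
Hypothesis hC : {ae mu, forall t, 0 < t -> calibrated M (u t) (ut t)}.
Hypothesis hN : forall t, 0 <= t ->
  {ae mu, forall x, 0 <= u t x /\ (~ `[a, b[%classic x -> u t x = 0)}.
Local Notation level := (level u).
Local Notation mass := (mass u).

Lemma dual_near0 h tau : L2 mu h -> 0 < tau -> 0 < \int[mu]_x (u 0 x * h x) ->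
  exists2 r, 0 < r <= tau & forall s, 0 < s <= r ->
    (\int[mu]_x (u 0 x * h x)) / 2 < \int[mu]_x (u s x * h x).
Proof.
move=> h2 tau0; set eta := \int[mu]_x (u 0 x * h x) => eta0.
apply: contrapT => H.
have Hn (n : nat) : exists s, 0 < s <= tau / n.+1%:R /\ \int[mu]_x (u s x * h x) <= eta / 2.
  apply: contrapT => Hn; apply: H; exists (tau / n.+1%:R).
    rewrite divr_gt0//= ler_pdivrMr// ler_pMr// ler1n//.
  by move=> s sr; rewrite ltNge; apply/negP => hs; apply: Hn; exists s.
have [s_ Hs] := choice Hn.
have sc : s_ @ \oo --> 0.
  apply: (squeeze_cvgr (f := cst 0) (h := fun n => tau / n.+1%:R)).
  - by apply: nearW => n; have [/andP[/ltW -> ->]] := Hs n.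
  - exact: cvg_cst.
  - by rewrite -[X in _ --> X](mulr0 tau); apply: cvgMr; exact: cvg_harmonic.
have := W12_dual_cvg hW h2 (lexx 0) (fun n => _) sc.
have s0 n : 0 <= s_ n by have [/andP[/ltW]] := Hs n.
move=> /(_ s0) c.
have Hl : \forall n \near \oo, \int[mu]_x (u (s_ n) x * h x) <= eta / 2.
  by apply: nearW => n; have [] := Hs n.
by have := cvg_le_near c Hl; rewrite -/eta; lra.
Qed.

Lemma mass_point (i : interval R) p q c s U : 0 <= s -> p <= q -> [set` i] `<=` `[p, q] ->
  0 <= c ->
  c * (q - p) < \int[mu]_x (u s x * \1_([set` i]) x) -> {ae mu, forall x, u s x = U x} ->
  exists2 x, [set` i] x & c < U x.
Proof.
move=> s0 pq ipq c0 hc uU; apply: contrapT => H; have us2 := W12_L2 hW s0.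
move: hc; apply/negP; rewrite -leNgt -(Rint_itv true true pq).
have I1 : intg mu (\1_(`[p, q[%classic) : R -> R).
  exact: intg_bnd.
rewrite -RintegralZl//; apply: le_Rint_ae; [|exact: intgZ|].
  by apply: L2_mul => //; exact: (L2_itv ipq).
apply: ae_imp (ae_and uU (ae_neq q)) => x [-> xq]; rewrite !indicE.
have [xi|_] := boolP (x \in [set` i]); last by rewrite mulr0 mulr_ge0.
rewrite inE in xi; have := ipq _ xi; rewrite /= in_itv/= => /andP[px xq'].
rewrite mem_set ?mulr1; last by rewrite /= in_itv/= px lt_neqAle xq xq'.
by rewrite leNgt; apply/negP => cU; apply: H; exists x.
Qed.

Hypothesis hl : forall d, 0 < d -> 0 < \int[mu]_x (u 0 x * \1_(`[a, a + d[%classic) x).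
Hypothesis hr : forall d, 0 < d -> 0 < \int[mu]_x (u 0 x * \1_(`]b - d, b]%classic) x).

(** If there were a gap at almost every small time, [level_valley] would apply with
    U > c near both ends. The mass above k would lose 4 r in the time r while the
    total mass loses 2 r only; as the two masses differ by at most k (b - a) <= r,
    this is impossible. *)
Lemma fill d tau : 0 < d -> a + d < b - d -> 0 < tau ->
  exists k s, [/\ 0 < k, 0 < s <= tau & {ae mu, forall x, a + d <= x < b - d -> k <= u s x}].
Proof.
move=> d0 dd tau0; have ba : 0 < b - a by rewrite subr_gt0.
have sl : `[a, a + d[ `<=` `[a, a + d] by exact: subset_itv_co_cc.
have sr : `]b - d, b] `<=` `[b - d, b] by exact: subset_itv_oc_cc.
have [r1 /andP[r10 r1t] H1] := dual_near0 (L2_itv sl) tau0 (hl d0).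
have [r2 /andP[r20 r2t] H2] := dual_near0 (L2_itv sr) tau0 (hr d0).
pose r := Num.min r1 r2.
have r0 : 0 < r by rewrite lt_min r10.
have [rr1 rr2] : r <= r1 /\ r <= r2 by rewrite !ge_min !lexx orbT.
have Il0 := hl d0; have Ir0 := hr d0.
set Il := \int[mu]_x _ in H1 Il0; set Ir := \int[mu]_x _ in H2 Ir0.
pose c := Num.min (Il / (2 * d)) (Ir / (2 * d)).
have d20 : 0 < 2 * d by lra.
have c0 : 0 < c.
  by rewrite /c lt_min; apply/andP; split; apply: divr_gt0.
have [c1 c2] : c * d <= Il / 2 /\ c * d <= Ir / 2.
  have E (X : R) : c <= X / (2 * d) -> c * d <= X / 2.
    by rewrite ler_pdivlMr// => h; lra.
  by split; apply: E; rewrite /c ge_min lexx ?orbT.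
(* low enough for k + c / 2 <= c and k (b - a) <= r *)
pose k := Num.min (c / 2) (r / (b - a)).
have k0 : 0 < k by rewrite lt_min !divr_gt0.
have kc : k <= c / 2 by rewrite ge_min lexx.
have kr : k * (b - a) <= r by rewrite -ler_pdivlMr// ge_min lexx orbT.
apply: contrapT => H.
have lv : level k r <= level k 0 - 4 * (r - 0).
  apply: (level_valley ab hW hC hN (ltW k0) (_ : 0 < c / 2) (lexx 0) (ltW r0)); first by lra.
  apply: aeW => s /andP[s0 sr'] U rU uU.
  have [x xl cx] : exists2 x, `[a, a + d[%classic x & c < U x.
    apply: (mass_point (ltW s0) _ sl (ltW c0) _ uU); first by lra.
    have -> : a + d - a = d by lra.
    by apply: (le_lt_trans c1); apply: H1; rewrite s0 (le_trans sr').
  have [z zr cz] : exists2 x, `]b - d, b]%classic x & c < U x.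
    apply: (mass_point (ltW s0) _ sr (ltW c0) _ uU); first by lra.
    have -> : b - (b - d) = d by lra.
    by apply: (le_lt_trans c2); apply: H2; rewrite s0 (le_trans sr').
  have [y yI ky] : exists2 y, a + d <= y < b - d & U y < k.
    apply: contrapT => Hy; apply: H; exists k, s; split => //.
      by rewrite s0 (le_trans sr')// (le_trans rr1).
    apply: ae_imp uU => y -> yI; rewrite leNgt; apply/negP => h; apply: Hy.
    by exists y.
  move: xl zr; rewrite /= !in_itv/= => /andP[ax xa] /andP[bz zb].
  by exists x, y, z; split => //; lra.
have h1 := mass_ge ab hW hC hN (ltW r0).
have h2 := below_le ab hW hN (ltW k0) (ltW r0).
have /andP[h3 _] := level_anti ab hW hN (lexx 0) (lexx 0) (ltW k0).
rewrite (level0 hW hN (lexx 0)) -/(mass 0) in h3.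
by move: (level k r) (level k 0) lv h2 h3 => A B lv h2 h3; lra.
Qed.

(** At the time when [a + d, b - d[ is filled up to the level k the inequality is
    clear, and [below_mono] propagates it. *)
Lemma below_fill d tau : 0 < d -> a + d < b - d -> 0 < tau ->
  exists2 k, 0 < k & forall l t, 0 <= l <= k -> tau <= t -> 2 * t < mass 0 ->
    0 < level l t -> l * (b - a - 2 * d) <= mass t - level l t.
Proof.
move=> d0 dd tau0; have [k [s [k0 /andP[s0 st] Hs]]] := fill d0 dd tau0.
exists k => // l t /andP[l0 lk] tt tm lt.
have s0' := ltW s0.
apply: (le_trans _ (below_mono ab hW hC hN l0 s0' (le_trans st tt) tm lt)).
have dd' : a + d <= b - d by exact: ltW.
have -> : l * (b - a - 2 * d) = \int[mu]_x (l * \1_(`[a + d, b - d[%classic) x).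
  have I1 : intg mu (\1_(`[a + d, b - d[%classic) : R -> R).
    exact: intg_bnd.
  by rewrite RintegralZl// Rint_itv//; congr (_ * _); lra.
have i1 := flow_intg hW hN s0'; have i2 := excess_intg hW hN l0 s0'.
rewrite -RintegralB//; apply: le_Rint_ae; [|exact: intgB|].
  exact/intgZ/intg_bnd.
apply: ae_imp (ae_and Hs (hN s0')) => x [h1 [h2 _]]; rewrite indicE /excess.
have [xI|_] := boolP (x \in _); last first.
  by rewrite mulr0; case: (leP (u s x - l) 0) => ?; lra.
rewrite inE/= in_itv/= in xI; have := h1 xI; rewrite mulr1.
by case: (leP (u s x - l) 0) => ?; lra.
Qed.

Lemma small_level t : 0 <= t -> 0 < mass t -> exists2 e, 0 < e &
  forall l, 0 <= l <= e -> 0 < level l t.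
Proof.
move=> t0 m0; have ba : 0 < b - a by rewrite subr_gt0.
exists (mass t / (2 * (b - a))) => [|l /andP[l0 le]]; first by rewrite divr_gt0// mulr_gt0.
have h := below_le ab hW hN l0 t0.
have : l * (b - a) <= mass t / 2.
  by move: le; rewrite ler_pdivlMr ?mulr_gt0//; lra.
by move: (level l t) h => A; lra.
Qed.

(** On a gap ]p, q[ the function min(u, l) vanishes, so that its integral is at
    most l (b - a - (q - p)); this contradicts [below_fill] for d = (q - p) / 4. *)
Lemma no_gap t p q : 0 < t -> 2 * t < mass 0 -> a <= p -> p < q -> q <= b ->
  ~ {ae mu, forall x, p < x < q -> u t x = 0}.
Proof.
move=> t0 tm ap pq qb H; have t0' := ltW t0; have ba : 0 < b - a by rewrite subr_gt0.
(* small compared with the gap *)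
pose d := (q - p) / 4.
have d0 : 0 < d by rewrite /d; lra.
have dd : a + d < b - d by rewrite /d; lra.
have [k k0 Hk] := below_fill d0 dd t0.
have mt : 0 < mass t by rewrite (mass_eq ab hW hC hN t0' tm) subr_gt0.
have [e e0 He] := small_level t0' mt.
pose l := Num.min k e.
have l0 : 0 < l by rewrite lt_min k0.
have lk : 0 <= l <= k by rewrite (ltW l0) ge_min lexx.
have le : 0 <= l <= e by rewrite (ltW l0) ge_min lexx orbT.
have := Hk l t lk (lexx t) tm (He _ le).
have i1 := flow_intg hW hN t0'; have i2 := excess_intg hW hN (ltW l0) t0'.
have Ipq (r s : R) : intg mu (\1_(`[r, s[%classic) : R -> R).
  exact: intg_bnd.
have : mass t - level l t <= \int[mu]_x (l * \1_(`[a, b[%classic) x - l * \1_(`[p, q[%classic) x).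
  rewrite -RintegralB//; apply: le_Rint_ae; [exact: intgB|by apply: intgB; exact: intgZ|].
  apply: ae_imp (ae_and (ae_and H (ae_neq p)) (hN t0')) => x [[h1 xp] [h2 h3]].
  have [xI|xI] := pselect (`[p, q[%classic x).
    move: (xI); rewrite /= in_itv/= => /andP[px xq].
    have u0 : u t x = 0 by apply: h1; rewrite lt_neqAle eq_sym xp px.
    rewrite u0 !indicE !mem_set//; last first.
      by rewrite /= in_itv/=; apply/andP; split; lra.
    by rewrite subrr sub0r oppr_le0 excess_ge0.
  rewrite [\1_(`[p, q[%classic) x]indicE (memNset xI) mulr0 subr0.
  have [xab|xab] := pselect (`[a, b[%classic x).
    rewrite indicE mem_set// mulr1 /excess.
    by case: (leP (u t x - l) 0) => ?; lra.
  by rewrite h3// sub0r indicE memNset// mulr0 oppr_le0 excess_ge0.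
rewrite RintegralB//; [|exact: intgZ|exact: intgZ].
rewrite !RintegralZl// (Rint_itv true true (ltW ab)) (Rint_itv true true (ltW pq)).
have E : l * (b - a - 2 * d) = l * (b - a) - l * (q - p) / 2 by rewrite /d; field.
rewrite E; have : 0 < l * (q - p) by rewrite mulr_gt0// subr_gt0.
by move: (level l t) => A; lra.
Qed.

Lemma flow_support t : 0 < t -> 2 * t < mass 0 -> ess_supp (u t) = `[a, b]%classic.
Proof.
move=> t0 tm; apply/seteqP; split => x.
  move=> sx; apply: contrapT => xI; apply: sx.
  exists (~` `[a, b]%classic); split => //.
    by rewrite openC; exact: interval_closed.
  apply: ae_imp (hN (ltW t0)) => y [_ h] yI; apply: h => yI'; apply: yI.
  by move: yI'; rewrite /= !in_itv/= => /andP[-> /ltW].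
rewrite /= in_itv/= => /andP[ax xb] [U [oU Ux U0]].
have /nbhs_ballP [e /= e0 He] : nbhs x U by exact: open_nbhs_nbhs.
pose p := Num.max a (x - e); pose q := Num.min b (x + e).
have ap : a <= p by rewrite le_max lexx.
have qb : q <= b by rewrite ge_min lexx.
have xp : x - e <= p by rewrite le_max lexx orbT.
have qx : q <= x + e by rewrite ge_min lexx orbT.
have pq : p < q by rewrite gt_max !lt_min; apply/andP; split; apply/andP; split => //; lra.
apply: (no_gap t0 tm ap pq qb); apply: ae_imp U0 => y Uy /andP[py yq].
by apply/Uy/He; rewrite /ball/= ltr_norml; lra.
Qed.

(** K = mass / (b - a - 2 d) is the level that [below_fill] declares extinct, so
    u <= K. As u has the mean value A, the integral of |u - A| is twice that of
    (u - A)_+, hence at most 2 (K - A) (b - a). *)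
Lemma flow_flat d : 0 < d -> d <= (b - a) / 4 -> 0 < mass 0 ->
  exists2 t1, 0 < t1 /\ 2 * t1 < mass 0 & forall t, t1 < t -> 2 * t < mass 0 ->
   intg mu (fun x => \1_(`[a, b]%classic) x * `|u t x - mass t / (b - a)|) /\
   \int[mu]_x (\1_(`[a, b]%classic) x * `|u t x - mass t / (b - a)|) <= 8 * d / (b - a) * mass t.
Proof.
move=> d0 d4 m0; have ba : 0 < b - a by rewrite subr_gt0.
have dd : a + d < b - d by lra.
have tau0 : 0 < mass 0 / 4 by lra.
have [k k0 Hk] := below_fill d0 dd tau0.
pose D := b - a - 2 * d.
have D0 : 0 < D by rewrite /D; lra.
(* the second bound makes K below at most k *)
pose t1 := Num.max (mass 0 / 4) ((mass 0 - k * D) / 2).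
exists t1.
  split; first by rewrite lt_max tau0.
  have kD : 0 < k * D by rewrite mulr_gt0.
  have : t1 < mass 0 / 2 by rewrite gt_max; apply/andP; split; lra.
  by lra.
move=> t t1t tm.
have [h1 h2] : mass 0 / 4 < t /\ (mass 0 - k * D) / 2 < t.
  by move: t1t; rewrite gt_max => /andP.
have t0 : 0 <= t by lra.
have mE := mass_eq ab hW hC hN t0 tm.
have mt : 0 < mass t by rewrite mE; lra.
pose K := mass t / D; pose A := mass t / (b - a).
have K0 : 0 < K by rewrite divr_gt0.
have KD : K * D = mass t by rewrite /K divfK// gt_eqF.
have Kk : 0 <= K <= k.
  by rewrite ltW//= ler_pdivrMr// mE; lra.
have lK : level K t = 0.
  apply/eqP; rewrite eq_le level_ge0 andbT leNgt; apply/negP => lK.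
  have := Hk K t Kk (ltW h1) tm lK; rewrite -/D KD.
  by move: (level K t) lK => B; lra.
have iK := excess_intg hW hN (ltW K0) t0.
have uK : {ae mu, forall x, u t x <= K}.
  have ae0 : {ae mu, forall x, excess K (u t x) = 0}.
    apply: Rint_eq0_ae => //; first by apply: aeW => x; exact: excess_ge0.
    by rewrite -/(level K t) lK.
  apply: ae_imp ae0 => x h; rewrite -subr_le0 -h; exact: (ltac:(by rewrite le_max lexx)).
have AK : A <= K.
  by rewrite ler_pM2l// lef_pV2 ?posrE// /D; lra.
have i1 := flow_intg hW hN t0; have ut2 := W12_L2 hW t0.
have Iab : intg mu (\1_(`[a, b]%classic) : R -> R).
  exact: intg_bnd.
have Rab : \int[mu]_x (\1_(`[a, b]%classic) x) = b - a by rewrite Rint_itv// ltW.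
have mf : measurable_fun setT (fun x => \1_(`[a, b]%classic) x * `|u t x - A|).
  apply: measurable_funM; first exact: indic_itv_meas.
  by apply: measurableT_comp => //; apply: measurable_funB => //; exact: ut2.1.
have iu : intg mu (fun x => \1_(`[a, b]%classic) x * `|u t x - A|).
  apply: (@intg_dom _ _ _ mu (fun x => `|u t x| + `|A| * \1_(`[a, b]%classic) x)) => //.
    by apply: intgD; [exact: intg_norm|exact: intgZ].
  move=> x; rewrite indicE; case: (_ \in _); rewrite ?mul0r ?mulr0 ?normr0 ?addr0//.
  by rewrite mul1r mulr1 normr_id ler_normB.
split => //.
apply: (@le_trans _ _ (\int[mu]_x (2 * (K - A) * \1_(`[a, b]%classic) x - (u t x - A * \1_(`[a, b]%classic) x)))).
  apply: le_Rint_ae => //; first by apply: intgB; [exact: intgZ|apply: intgB => //; exact: intgZ].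
  apply: ae_imp (ae_and uK (hN t0)) => x [h3 [h4 h5]]; rewrite -/A indicE.
  have [xI|xI] := boolP (x \in _).
    rewrite mul1r !mulr1; case: (leP 0 (u t x - A)) => h6.
      by rewrite ger0_norm//; lra.
    by rewrite ltr0_norm//; lra.
  rewrite mul0r !mulr0 h5 ?subrr// => xI'; move/negP: xI; apply; rewrite inE.
  by move: xI'; rewrite /= !in_itv/= => /andP[-> /ltW].
have iA := intgZ A Iab.
rewrite RintegralB//; [|exact: intgZ|exact: intgB].
rewrite RintegralB// !RintegralZl// Rab -/(mass t).
have E1 : A * (b - a) = mass t by rewrite /A divfK// gt_eqF.
rewrite E1 subrr subr0.
have -> : 2 * (K - A) * (b - a) = 2 * K * (2 * d).
  by rewrite -mulrA mulrBl E1 -KD /D; ring.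
have -> : 8 * d / (b - a) * mass t = 2 * (2 * A) * (2 * d) by rewrite /A; field; rewrite gt_eqF.
rewrite ler_pM2r ?mulr_gt0// ler_pM2l//.
rewrite /K /A ler_pdivrMr//.
have -> : 2 * (mass t / (b - a)) * D = mass t * (2 * D / (b - a)) by field; rewrite gt_eqF.
by rewrite ler_pMr// ler_pdivlMr// /D; lra.
Qed.

End profile.

Lemma pos_mass_on (R : realType) (f : R -> R) (i : interval R) (p q : R) :
  let mu := @lebesgue_measure R in
  L2 mu f -> {ae mu, forall x, 0 <= f x} -> [set` i] `<=` `[p, q] ->
  ~ {ae mu, forall x, [set` i] x -> f x = 0} ->
  0 < \int[mu]_x (f x * \1_([set` i]) x).
Proof.
move=> mu f2 f0 ipq nf; rewrite ltNge; apply/negP => h; apply: nf.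
have fi : intg mu (fun x => f x * \1_([set` i]) x).
  by apply: L2_mul => //; exact: (L2_itv ipq).
have : {ae mu, forall x, f x * \1_([set` i]) x = 0}.
  by apply: Rint_eq0_ae => //; apply: ae_imp f0 => x fx; rewrite mulr_ge0.
by apply: ae_imp => x + xi; rewrite indicE mem_set// mulr1.
Qed.

Theorem theorem2p15 (R : realType) (u0 : R -> R) (a b : R) (u : R -> R -> R)
    (T : R) :
  BV u0 ->
  {ae @lebesgue_measure R, forall x, 0 <= u0 x} ->
  a < b ->
  ext_supp u0 = `[a, b]%classic ->
  TVF_strong_solution u0 u ->
  T = 2^-1 * \int[@lebesgue_measure R]_(x in `[a, b]) u0 x ->
  (forall t : R, 0 < t < T -> ess_supp (u t) = `[a, b]%classic) /\
  'N[@lebesgue_measure R]_1[EFin \o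
     ((fun x : R => u t x / (T - t) - 2 * (\1_(`[a, b]%classic) x / (b - a)))%R \_ `[a, b]%classic)]%E
    @[t --> T^'-] --> 0%E.
Proof.
move=> [[mu0 _ _] _] u00 ab supp0 sol TE.
have [ut [M [hW init hC]]] := tv_flow_calibrated sol.
have u2 := W12_L2 hW (lexx 0).
have nneg0 : {ae @lebesgue_measure R, forall x, 0 <= u 0 x}.
  by apply: ae_imp (ae_and init u00) => x [->].
have out0 : {ae @lebesgue_measure R, forall x, ~ `[a, b]%classic x -> u 0 x = 0}.
  by apply: ae_imp (ae_and init (ae0_out_ext_supp supp0)) => x [->].
have out0' : {ae @lebesgue_measure R, forall x, ~ `[a, b[%classic x -> u 0 x = 0}.
  apply: ae_imp (ae_and out0 (ae_neq b)) => x [h xb] xI; apply: h => xI'; apply: xI.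
  by move: xI'; rewrite /= !in_itv/= => /andP[-> xb']; rewrite lt_neqAle xb xb'.
have hN := flow_nneg hW hC nneg0 out0'.
have hl d : 0 < d -> 0 < \int[@lebesgue_measure R]_x (u 0 x * \1_(`[a, a + d[%classic) x).
  move=> d0; apply: (pos_mass_on u2 nneg0 (@subset_itv_co_cc _ _ _ _)) => h.
  apply: (ext_supp_left supp0 ab d0); apply: ae_imp (ae_and init h) => x [<- hx] xI.
  by apply: hx; rewrite /= in_itv.
have hr d : 0 < d -> 0 < \int[@lebesgue_measure R]_x (u 0 x * \1_(`]b - d, b]%classic) x).
  move=> d0; apply: (pos_mass_on u2 nneg0 (@subset_itv_oc_cc _ _ _ _)) => h.
  apply: (ext_supp_right supp0 ab d0); apply: ae_imp (ae_and init h) => x [<- hx] xI.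
  by apply: hx; rewrite /= in_itv.
have ba : 0 < b - a by rewrite subr_gt0.
have iu := flow_intg hW hN (lexx 0).
have massT : mass u 0 = 2 * T.
  rewrite TE mulrA divff// mul1r Rintegral_mkcond /mass; apply: Rint_ae.
  - exact: u2.1.
  - by apply/(measurable_restrictT _ (measurable_itv _)); exact: measurable_funTS.
  - apply: ae_imp (ae_and init out0) => x [E h]; rewrite /patch -E.
    by case: ifPn => // xI; apply: h => xI'; move/negP: xI; rewrite inE.
have m0 : 0 < mass u 0.
  apply: (lt_le_trans (hl 1 ltr01)); apply: le_Rint_ae => //.
    by apply: L2_mul => //; exact: L2_bnd.
  by apply: ae_imp nneg0 => x x0; rewrite ler_piMr// indicE; case: (_ \in _).
have T0 : 0 < T by move: m0; rewrite massT; lra.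
split=> [t /andP[t0 tT]|].
  by apply: (flow_support ab hW hC hN hl hr t0); rewrite massT ltr_pM2l.
pose f t := (fun x : R => u t x / (T - t) - 2 * (\1_(`[a, b]%classic) x / (b - a)))%R \_ `[a, b]%classic.
have fE t x : 0 < T - t -> mass u t = 2 * (T - t) ->
    `|f t x| = (T - t)^-1 * (\1_(`[a, b]%classic) x * `|u t x - mass u t / (b - a)|).
  move=> Tt mE; rewrite /f /patch indicE; case: (boolP (x \in _)) => [xI|_]; last first.
    by rewrite mul0r mulr0 normr0.
  have i0 : 0 < (T - t)^-1 by rewrite invr_gt0.
  rewrite (_ : true%:R = 1 :> R)// !mul1r -[in RHS](gtr0_norm i0) -normrM; congr `|_|.
  by rewrite mE; field; rewrite !gt_eqF.
(* d is the width of the ends of [a, b] which may not be filled yet *)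
have key d : 0 < d -> d <= (b - a) / 4 -> exists2 t1, t1 < T & forall t, t1 < t < T ->
    exists2 n, 'N[@lebesgue_measure R]_1[EFin \o f t]%E = n%:E & 0 <= n <= 16 * d / (b - a).
  move=> d0 d4.
  have [t1 [t10 t1m] H] := flow_flat ab hW hC hN hl hr d0 d4 m0.
  exists t1; first by move: t1m; rewrite massT ltr_pM2l.
  move=> t /andP[t1t tT]; have tm : 2 * t < mass u 0 by rewrite massT ltr_pM2l.
  have [i1 h1] := H t t1t tm.
  have t0 : 0 <= t by rewrite ltW// (lt_trans t10).
  have mE : mass u t = 2 * (T - t) by rewrite (mass_eq ab hW hC hN t0 tm) massT mulrBr.
  have Tt : 0 < T - t by rewrite subr_gt0.
  exists (\int[@lebesgue_measure R]_x `|f t x|).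
    rewrite Lnorm1 /Rintegral fineK//; apply: integrable_fin_num => //.
    have := intgZ (T - t)^-1 i1.
    by congr (_.-integrable _ _); apply/funext => x /=; rewrite fE.
  apply/andP; split; first by apply: Rintegral_ge0 => x _.
  under eq_Rintegral do rewrite (fE t _ Tt mE).
  rewrite RintegralZl//.
  rewrite ler_pdivrMl//; apply: (le_trans h1); rewrite mE.
  by have -> : 8 * d / (b - a) * (2 * (T - t)) = (T - t) * (16 * d / (b - a)) by ring.
have ev d : 0 < d -> d <= (b - a) / 4 -> \forall t \near T^'-,
    exists2 n, 'N[@lebesgue_measure R]_1[EFin \o f t]%E = n%:E & 0 <= n <= 16 * d / (b - a).
  move=> d0 d4; have [t1 t1T H] := key d d0 d4.
  by near=> t; apply: H; apply/andP; split; near: t; [exact: nbhs_left_gt|exact: nbhs_left_lt].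
apply/fine_cvgP; split.
  have q0 : 0 < (b - a) / 4 by rewrite divr_gt0.
  by apply: filterS (ev _ q0 (lexx _)) => t [n -> _].
apply/cvgr0Pnorm_le => e e0.
pose d := Num.min ((b - a) / 4) (e * (b - a) / 16).
have d0 : 0 < d by rewrite /d lt_min; apply/andP; split; rewrite divr_gt0// mulr_gt0.
have d4 : d <= (b - a) / 4 by rewrite /d ge_min lexx.
have de : 16 * d / (b - a) <= e.
  rewrite ler_pdivrMr// mulrC -ler_pdivlMr//.
  by rewrite /d ge_min lexx orbT.
apply: filterS (ev _ d0 d4) => t [n /= -> /andP[n0 nd]] /=.
by rewrite ger0_norm// (le_trans nd).
Unshelve. all: by end_near. Qed.
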